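(* Let $k\ge1$, let $F\in S_m(\mathcal B,\varepsilon)$ with $\varepsilon$ summable and $m\ge k+1$, let $h>0$ and $X\in H^2$. Consider the terms of the extended Taylor expansion of $\widetilde F(X+Y)$ to order $k$, as functions of $Y\in B^2$: for $1\le i\le k-1$, $$\frac1{i!}\widetilde\Phi_i(X)\cdot Y^i=\frac1{i!}\sum_{J\in\Gamma^i,\ \delta\in\{0,1\}^i}\left(\prod_{r=1}^i\ell_{w_{j_r}^{\delta_r}}(Y)\right)\frac{\partial^iF}{\partial w_{j_1}^{\delta_1}\cdots\partial w_{j_i}^{\delta_i}}(X),$$ and the rest $$R_k(X):Y\mapsto\sum_{J\in\Gamma^k,\ \delta\in\{0,1\}^k}\left(\prod_{r=1}^k\ell_{w_{j_r}^{\delta_r}}(Y)\right)\int_0^1\frac{(1-s)^{k-1}}{(k-1)!}\,\mathcal P\left(\frac{\partial^kF}{\partial w_{j_1}^{\delta_1}\cdots\partial w_{j_k}^{\delta_k}}\right)(X+sY)\,ds .$$ Each of these terms has a finite $N_s$ norm for a well-chosen $s$; precisely, $$N_i\left(\frac1{i!}\widetilde\Phi_i(X)\cdot Y^i\right)\le\frac1{i!}\|F\|_{m,\varepsilon}\left(2\max\left(1,\sqrt{\tfrac h2}\right)\sum_{j\in\Gamma}\varepsilon_j\right)^i\int_{\mathbb R}(1+|v|)^i\,d\mu_{\mathbb R,1}(v)$$ for $1\le i\le k-1$, and $$N_k(R_k(X))\le\frac1{k!}\|F\|_{m,\varepsilon}\left(2\max\left(1,\sqrt{\tfrac h2}\right)\sum_{j\in\Gamma}\varepsilon_j\right)^k\int_{\mathbb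 R}(1+|v|)^k\,d\mu_{\mathbb R,1}(v).$$
   Context: Wiener space. $H$ is a real, separable, infinite dimensional Hilbert space with scalar product $\langle\cdot,\cdot\rangle$ and norm $|\cdot|$; $B$ is the Banach space obtained by completing $H$ for a measurable norm (in the sense of Gross), and $H$ is identified with its dual, so that $B'\subset H\subset B$. For $h>0$, $\mu_{B,h}$ is the Gaussian probability measure of variance $h$ on the Borel $\sigma$-algebra of $B$: for $y_1,\dots,y_n\in B'$ orthonormal in $H$, the image of $\mu_{B,h}$ under $x\mapsto (y_1(x),\dots,y_n(x))$ is $(2\pi h)^{-n/2}e^{-|v|^2/(2h)}dv$ on $\mathbb R^n$. $\mu_{\mathbb R,1}$ is the standard Gaussian measure on $\mathbb R$. For $a\in H$, $\ell_a\in L^2(B,\mu_{B,h})$ is the image of $a$ under the continuous extension to $H$ of the map $B'\ni y\mapsto y(\cdot)$; it satisfies $\ell_a(x+y)=\ell_a(x)+\langle a,y\rangle$ for $y\in H$. For a finite dimensional subspace $E\subset H$ with orthonormal basis $(w_1,\dots,w_n)$, $\tilde\pi_E(x)=\sum_j\ell_{w_j}(x)w_j$ for $x\in B$. A Borel function $f$ on $H$ admits $\tilde f$ as a stochastic extension in $L^p(B,\mu_{B,h})$ if, for every increasing sequence $(E_n)$ of finite dimensional subspaces of $H$ with dense union, $f\circ\tilde\pi_{E_n}\in L^p(B,\mu_{B,h})$ and $f\circ\tilde\pi_{E_n}\to\tilde f$ in $L^p(B,\mu_{B,h})$. All this is used likewise for $(H^2,B^2,\mu_{B^2,h})$. Symbol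 classes. $\mathcal B=(e_j)_{j\in\Gamma}$ is a Hilbert basis of $H$ ($\Gamma$ countable) with all $e_j\in B'$; $u_j=(e_j,0)$, $v_j=(0,e_j)$, and $w_j^0=u_j$, $w_j^1=v_j$. For $m\in\mathbb N$, $M\ge0$ and a family $\varepsilon=(\varepsilon_j)_{j\in\Gamma}$ of nonnegative reals, $S_m(\mathcal B,M,\varepsilon)$ is the set of bounded continuous $F:H^2\to\mathbb C$ such that for every pair of finitely supported multi-indices $(\alpha,\beta)$ with $0\le\alpha_j,\beta_j\le m$ for all $j$, the derivative $\prod_{j}\partial_{u_j}^{\alpha_j}\partial_{v_j}^{\beta_j}F$ exists, is continuous on $H^2$ and is bounded in modulus by $M\prod_j\varepsilon_j^{\alpha_j+\beta_j}$. $S_m(\mathcal B,\varepsilon)=\bigcup_{M\ge0}S_m(\mathcal B,M,\varepsilon)$ and $\|F\|_{m,\varepsilon}=\inf\{M\ge0: F\in S_m(\mathcal B,M,\varepsilon)\}$. Notation. $J=(j_1,\dots,j_i)\in\Gamma^i$, $\delta=(\delta_1,\dots,\delta_i)\in\{0,1\}^i$. For $G\in S_1(\mathcal B,\varepsilon)$ with $\varepsilon$ summable, $\widetilde G=\mathcal P(G)$ denotes a function on $B^2$ which is the stochastic extension of $G$ in $L^q(B^2,\mu_{B^2,h'})$ simultaneously for all $h'\in]0,2h]$ and all $q\in[1,+\infty[$ (such a function exists). For a nonnegative integer $s$ and $\widetilde G\in L^1(B^2,\mu_{B^2,h/2})$, $$N_s(\widetilde G)=\sup_{Y\in H^2}\frac{\|\widetilde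 G(\cdot+Y)\|_{L^1(B^2,\mu_{B^2,h/2})}}{(1+|Y|)^s}.$$ *)

(* Defs.v *)
From HB Require Import structures.
From mathcomp Require Import all_boot all_order all_algebra.
From mathcomp Require Import finmap.
From mathcomp Require Import complex.
From mathcomp Require Import all_classical all_reals all_analysis.
Import Order.TTheory GRing.Theory Num.Theory.
Import numFieldNormedType.Exports.

Set Implicit Arguments.
Unset Strict Implicit.
Unset Printing Implicit Defensive.

Local Open Scope classical_set_scope.
Local Open Scope ring_scope.

Notation cRe := (@complex.Re _).
Notation cIm := (@complex.Im _).
Notation cmod := (@ComplexField.Normc.normc _).
Notation borel T := (g_sigma_algebraType (@open T)).

Section ComplexValued.
Context (R : realType).

Definition ccontinuous (T : topologicalType) (f : T -> R[i]) : Prop :=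
  continuous (cRe \o f) /\ continuous (cIm \o f).

Definition cmeasurable d (T : measurableType d) (f : T -> R[i]) : Prop :=
  measurable_fun [set: T] (cRe \o f) /\ measurable_fun [set: T] (cIm \o f).

Definition cLnorm d (T : measurableType d) (mu : {measure set T -> \bar R})
    (p : R) (f : T -> R[i]) : \bar R :=
  Lnorm mu p%:E (EFin \o (fun x => cmod (f x))).

Definition in_cLp d (T : measurableType d) (mu : {measure set T -> \bar R})
    (p : R) (f : T -> R[i]) : Prop :=
  cmeasurable f /\ (cLnorm mu p f < +oo)%E.

Definition cRintegral d (T : measurableType d) (mu : {measure set T -> \bar R})
    (D : set T) (f : T -> R[i]) : R[i] :=
  Complex (Rintegral mu D (cRe \o f)) (Rintegral mu D (cIm \o f)).

(* Unordered (commutative) convergence of a countable family of complex numbers: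
   the net of finite partial sums converges. *)
Definition has_csum (I : choiceType) (f : I -> R[i]) (l : R[i]) : Prop :=
  forall eps : R, 0 < eps -> exists A : {fset I}, forall A' : {fset I},
    (A `<=` A')%fset -> cmod (\sum_(i <- A') f i - l) < eps.

Definition csum (I : choiceType) (f : I -> R[i]) : R[i] := xget 0 (has_csum f).

Section Derivatives.
Context (V : normedModType R).

Definition cderive (w : V) (F : V -> R[i]) : V -> R[i] :=
  fun X => Complex ('D_w (cRe \o F) X) ('D_w (cIm \o F) X).

(* [:: w1; ...; wn] stands for d^n / dw1 ... dwn, the innermost derivative
   being the one along wn. *)
Definition iter_cderive (s : seq V) (F : V -> R[i]) : V -> R[i] :=
  foldr cderive F s.

Fixpoint iter_cderivable (s : seq V) (F : V -> R[i]) : Prop :=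
  if s is w :: s' then
    iter_cderivable s' F /\
    (forall X, derivable (cRe \o iter_cderive s' F) X w /\
               derivable (cIm \o iter_cderive s' F) X w)
  else True.

End Derivatives.
End ComplexValued.

(* The product measure N(0, sigma^2)^{(x) n} on R^n, as an iterated integral
   over sections; its density is (2 pi sigma^2)^(-n/2) e^(-|v|^2/(2 sigma^2)). *)
Fixpoint gauss_tuple (R : realType) (sigma : R) (n : nat) :
    set (n.-tuple R) -> \bar R :=
  match n return set (n.-tuple R) -> \bar R with
  | 0 => fun A => \d_([tuple] : 0.-tuple R) A
  | n'.+1 => fun A =>
      (\int[normal_prob 0%R sigma]_v
         @gauss_tuple R sigma n' [set t : n'.-tuple R | A [tuple of v :: t]])%E
  end.

(* V is the Hilbert space, with scalar product ip; B is the Banach space;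
   iota : V -> B is the inclusion. The norm of V as a normedModType is only used
   for its topology, so that V can be H * H with the (equivalent) product norm
   while |.| is always sqrt (ip x x). *)
Section Wiener.
Context (R : realType) (V B : normedModType R).
Variables (ip : V -> V -> R) (iota : V -> B).

Definition hnorm (x : V) : R := Num.sqrt (ip x x).

Definition orthonormal_family (I : eqType) (w : I -> V) : Prop :=
  forall i j, ip (w i) (w j) = (i == j)%:R.

Definition fspan n (w : 'I_n -> V) : set V :=
  [set x | exists c : 'I_n -> R, x = \sum_(i < n) c i *: w i].

Definition infinite_dimensional : Prop :=
  forall n (w : 'I_n -> V), fspan w <> [set: V].

Definition hilbert_basis (I : choiceType) (e : I -> V) : Prop :=
  orthonormal_family e /\
  dense [set x | exists (A : {fset I}) (c : I -> R),
                   x = \sum_(i <- A) c i *: e i].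

(* Gross: for every eps > 0 there is a finite rank orthogonal projection P0 such
   that the cylindrical standard Gaussian measure of {N (P x) > eps} is < eps for
   every finite rank orthogonal projection P orthogonal to P0. Projections are
   given by orthonormal bases of their ranges. *)
Definition measurable_norm (N : V -> R) : Prop :=
  forall eps : R, 0 < eps ->
  exists (n0 : nat) (w0 : 'I_n0 -> V), orthonormal_family w0 /\
    forall (n : nat) (w : 'I_n -> V), orthonormal_family w ->
      (forall i j, ip (w i) (w0 j) = 0) ->
      (gauss_tuple 1 [set v : n.-tuple R |
                       (eps < N (\sum_(i < n) tnth v i *: w i))%R] < eps%:E)%E.

(* B' as a subset of V: the continuous linear form y on B is identified with the
   element a of V. *)
Definition dual_elt (y : {scalar B}) (a : V) : Prop :=
  continuous (y : B -> R) /\ forall x, y (iota x) = ip a x.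

Definition gaussian_measure (h : R) (mu : set B -> \bar R) : Prop :=
  forall n (y : 'I_n -> {scalar B}) (a : 'I_n -> V),
    (forall i, dual_elt (y i) (a i)) -> orthonormal_family a ->
    forall A : set (n.-tuple R), measurable A ->
      mu [set x | A [tuple y i x | i < n]] = gauss_tuple (Num.sqrt h) A.

(* g is a representative of ell_a in L^2(B, mu), i.e. of the value at a of the
   extension by continuity of y |-> y(.), defined on B'. *)
Definition is_ell (mu : {measure set (borel B) -> \bar R}) (a : V)
    (g : borel B -> R) : Prop :=
  [/\ measurable_fun [set: borel B] g, finite_norm mu 2%:E g &
   forall eps : R, 0 < eps -> exists2 delta : R, 0 < delta &
     forall (y : {scalar B}) (b : V), dual_elt y b -> hnorm (b - a) < delta ->
       (Lnorm mu 2%:E (EFin \o (fun x => (y x - g x)%R)) < eps%:E)%E].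

(* p is a representative of the map tilde pi_E : B -> E. *)
Definition is_tproj (mu : {measure set (borel B) -> \bar R}) (E : set V)
    (p : borel B -> V) : Prop :=
  exists (n : nat) (w : 'I_n -> V) (l : 'I_n -> borel B -> R),
    [/\ orthonormal_family w, E = fspan w, forall i, is_ell mu (w i) (l i) &
        forall x, p x = \sum_(i < n) l i x *: w i].

Definition stochastic_extension (mu : {measure set (borel B) -> \bar R}) (q : R)
    (f : V -> R[i]) (ft : borel B -> R[i]) : Prop :=
  [/\ cmeasurable (f : borel V -> R[i]), in_cLp mu q ft &
   forall (E : nat -> set V) (p : nat -> borel B -> V),
     (forall n, E n `<=` E n.+1) -> dense (\bigcup_n E n) ->
     (forall n, is_tproj mu (E n) (p n)) ->
     (forall n, in_cLp mu q (f \o p n)) /\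
     cLnorm mu q (fun x => f (p n x) - ft x) @[n --> \oo] --> 0%E].

Definition Nnorm (mu : {measure set (borel B) -> \bar R}) (s : nat)
    (G : borel B -> R[i]) : \bar R :=
  ereal_sup [set (cLnorm mu 1 (fun x : borel B => G ((x : B) + iota Y)%R) *
                  ((1 + hnorm Y) ^+ s)^-1%:E)%E | Y in [set: V]].

End Wiener.

Definition wiener_space (R : realType) (H B : completeNormedModType R)
    (dot : {dot H for idfun}) (iota : {linear H -> B}) : Prop :=
  [/\ forall x : H, `|x| = hnorm dot x,
      exists2 D : set H, countable D & dense D,
      infinite_dimensional H,
      injective iota /\ dense (range iota) &
      measurable_norm dot (fun x => `|iota x|)].

Definition ip2 (R : realType) (H : normedModType R) (ip : H -> H -> R) :
    (H * H)%type -> (H * H)%type -> R :=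
  fun X Y => ip X.1 Y.1 + ip X.2 Y.2.

Definition iota2 (R : realType) (H B : normedModType R) (iota : H -> B) :
    (H * H)%type -> (B * B)%type :=
  fun X => (iota X.1, iota X.2).

Section Symbols.
Context (R : realType) (H : normedModType R) (Gam : countType).
Variable (e : Gam -> H).

(* (j, false) is the index of u_j = w_j^0, (j, true) that of v_j = w_j^1. *)
Definition wdir (w : Gam * bool) : (H * H)%type :=
  if w.2 then (0, e w.1) else (e w.1, 0).

(* A pair of multi-indices (alpha, beta) is given by a finite list s of
   directions, alpha_j and beta_j being the multiplicities of u_j and v_j in s;
   thus the derivatives may be performed in any order. *)
Definition symbol_class_bound (m : nat) (M : R) (eps : Gam -> R)
    (F : (H * H)%type -> R[i]) : Prop :=
  [/\ exists C : R, forall X, cmod (F X) <= C,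
      ccontinuous F &
      forall s : seq (Gam * bool), (forall w, (count_mem w s <= m)%N) ->
        [/\ iter_cderivable (map wdir s) F,
            ccontinuous (iter_cderive (map wdir s) F) &
            forall X, cmod (iter_cderive (map wdir s) F X)
                      <= M * \prod_(w <- s) eps w.1]].

Definition symbol_class (m : nat) (eps : Gam -> R) (F : (H * H)%type -> R[i]) :
    Prop :=
  exists2 M : R, 0 <= M & symbol_class_bound m M eps F.

Definition symbol_norm (m : nat) (eps : Gam -> R) (F : (H * H)%type -> R[i]) : R :=
  inf [set M : R | 0 <= M /\ symbol_class_bound m M eps F].

Section Taylor.
Context (B : normedModType R).
Variables (iota : H -> B) (F : (H * H)%type -> R[i]).
(* ell w represents ell_(wdir w), and P the operator of stochastic extension. *)
Variables (ell : Gam * bool -> borel (B * B)%type -> R).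
Variables (P : ((H * H)%type -> R[i]) -> borel (B * B)%type -> R[i]).

Definition taylor_summand (i : nat) (X : (H * H)%type) (Y : borel (B * B)%type)
    (J : i.-tuple (Gam * bool)) : R[i] :=
  ((\prod_(w <- J) ell w Y)%:C)%C * iter_cderive (map wdir J) F X.

Definition taylor_term (i : nat) (X : (H * H)%type) (Y : borel (B * B)%type) :
    R[i] :=
  (((i`!%:R)^-1)%:C)%C * csum (@taylor_summand i X Y).

Definition rest_summand (k : nat) (X : (H * H)%type) (Y : borel (B * B)%type)
    (J : k.-tuple (Gam * bool)) : R[i] :=
  ((\prod_(w <- J) ell w Y)%:C)%C *
  cRintegral lebesgue_measure `[0%R, 1%R] (fun s : R =>
    (((1 - s) ^+ k.-1 / (k.-1)`!%:R)%:C)%C *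
    P (iter_cderive (map wdir J) F) (iota2 iota X + s *: (Y : (B * B)%type))).

Definition taylor_rest (k : nat) (X : (H * H)%type) (Y : borel (B * B)%type) :
    R[i] :=
  csum (@rest_summand k X Y).

End Taylor.

Definition taylor_bound (m : nat) (eps : Gam -> R) (F : (H * H)%type -> R[i])
    (h : R) (i : nat) : R :=
  (i`!%:R)^-1 * symbol_norm m eps F *
  (2 * Num.max 1 (Num.sqrt (h / 2)) *
   fine (\esum_(j in [set: Gam]) (eps j)%:E)) ^+ i *
  Rintegral (normal_prob 0 1 : probability _ R) [set: R]
    (fun v => (1 + `|v|) ^+ i).

End Symbols.

(* Main.v *)
(** Since the [e_j] lie in B', each [ell_w] is almost everywhere the linear form of a direction, of
    law N(0, h/2); under the translation by Y in H^2 it becomes [ell_w + <w, Y>] almost everywhere,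
    by quasi-invariance of the Gaussian measure (Cameron-Martin). The inequality of arithmetic and
    geometric means reduces the integral of a product of i such variables to one-dimensional
    moments, bounded by [(max(1, sqrt(h/2)) (1 + |Y|))^i] times the moment of [(1 + |v|)^i]. A
    derivative of F along J is at most [||F||] times the product of the [eps_j], and the sum over J
    of these products is at most [(2 sum eps_j)^i], which yields absolute summability and the bound
    for the Taylor terms. For the rest, [P(G)] inherits almost everywhere for every variance the
    bound of G; the law of [X + s Y] is absolutely continuous with respect to the Gaussian measure
    of variance [s^2 h/2], so by Tonelli the integral over s is almost everywhere at most
    [||F|| / k!] times the product of the [eps_j].

    The Gaussian measures are only given on cylinder sets, so quasi-invariance is first obtained
    there, with a constant independent of the dimension, and carried to null sets by approximation;
    that cylinders generate the Borel sets rests on the Hahn-Banach and Riesz theorems. *)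

From HB Require Import structures.
Require Import Defs.
From mathcomp Require Import all_boot all_order all_algebra.
From mathcomp Require Import finmap.
From mathcomp Require Import complex.
From mathcomp Require Import all_classical all_reals all_analysis.
From mathcomp Require Import measurable_realfun beta_distribution.
From mathcomp Require Import ring lra.
Import Order.TTheory GRing.Theory Num.Theory.
Import numFieldNormedType.Exports.
Local Open Scope classical_set_scope.
Local Open Scope ring_scope.

Set Implicit Arguments.
Unset Strict Implicit.
Unset Printing Implicit Defensive.

(** * Norming functionals and the Borel sets of a separable normed space *)

Section HahnBanach.
Context (R : realType) (V : normedModType R).

(** The measures are prescribed one variance at a time, on cylinders over orthonormal families of
    forms, and neither the continuity of [iota] nor a relation between distinct variances is given.
    So every fact about the law of X + sY must come out of finite-dimensional integrals, with a
    constant that survives the passage to all cylinders. That constant is the second moment of the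
    Cameron-Martin density, exp(|X|^2 / (s^2 t)) at variance t: Bessel's inequality bounds it
    uniformly, and a uniform bound in L^2 on the densities forces absolute continuity.

    Several variances are unavoidable: in infinite dimension, Gaussian measures of distinct
    variances are mutually singular, so an almost sure bound on P(G) at variance h/2 says nothing
    about P(G) at the points X + sY with s < 1. The bound is needed at each variance s^2 h/2, which
    is what the simultaneous extension provides.

    Unordered sums take a default value where they diverge, so their measurability rests on that of
    the set where they converge. *)

Definition sublinear (p : V -> R) :=
  (forall x y, p (x + y) <= p x + p y) /\
  (forall t x, 0 < t -> p (t *: x) <= t * p x).

Lemma sublinear0 p : sublinear p -> p 0 = 0.
Proof.
move=> [pD pZ]; apply/eqP; rewrite eq_le; apply/andP; split.
  by have := pZ 2^-1 0 ltac:(lra); rewrite scaler0; lra.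
by have := pD 0 0; rewrite addr0; lra.
Qed.

Lemma sublinear_ge p x : sublinear p -> - p (- x) <= p x.
Proof.
move=> ps; have := ps.1 x (- x); rewrite subrr (sublinear0 ps); lra.
Qed.

(* A minimal sublinear p equals all its decreases, hence is linear. *)
Definition sublinear_decrease (p : V -> R) (y x : V) : R :=
  inf [set p (x + t *: y) - t * p y | t in [set t | 0 <= t]].

Section Decrease.
Variables (p : V -> R) (y : V).
Hypothesis ps : sublinear p.
Let S x := [set p (x + t *: y) - t * p y | t in [set t | 0 <= t]].

Let S_ge x : lbound (S x) (- p (- x)).
Proof.
move=> _ [t /= t0 <-].
have [->|tn0] := eqVneq t 0.
  by rewrite scale0r addr0 mul0r subr0; exact: sublinear_ge.
have t1 : 0 < t by rewrite lt_neqAle eq_sym tn0.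
have := ps.1 (x + t *: y) (- x); rewrite addrAC subrr add0r => h1.
have h2 := ps.2 t^-1 (t *: y) ltac:(by rewrite invr_gt0).
rewrite scalerA mulVf// scale1r in h2.
have : t * p y <= p (t *: y) by rewrite mulrC -ler_pdivlMr// mulrC.
lra.
Qed.

Let S_lb x : has_lbound (S x).
Proof. by exists (- p (- x)); exact: S_ge. Qed.

Let S_n0 x : S x !=set0.
Proof. by exists (p (x + 0 *: y) - 0 * p y); exists 0 => //=. Qed.

Lemma sublinear_decrease_le x t : 0 <= t ->
  sublinear_decrease p y x <= p (x + t *: y) - t * p y.
Proof. by move=> t0; apply: ge_inf; [exact: S_lb|exists t]. Qed.

Lemma sublinear_decreaseS : sublinear (sublinear_decrease p y).
Proof.
split.
  move=> x1 x2; rewrite -lerBlDr; apply: lb_le_inf; [exact: S_n0|move=> _ [t1 /= t10 <-]].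
  rewrite lerBlDr -lerBlDl; apply: lb_le_inf; [exact: S_n0|move=> _ [t2 /= t20 <-]].
  rewrite lerBlDl.
  apply: (le_trans (sublinear_decrease_le (x1 + x2) (addr_ge0 t10 t20))).
  rewrite scalerDl addrACA; have := ps.1 (x1 + t1 *: y) (x2 + t2 *: y); lra.
move=> t x t0; rewrite mulrC -ler_pdivrMr//; apply: lb_le_inf; [exact: S_n0|move=> _ [s /= s0 <-]].
rewrite ler_pdivrMr//.
apply: (le_trans (sublinear_decrease_le _ (mulr_ge0 (ltW t0) s0))).
rewrite -scalerA -scalerDr; have := ps.2 t (x + s *: y) t0; lra.
Qed.

Lemma sublinear_decrease_le_id x : sublinear_decrease p y x <= p x.
Proof.
by have := sublinear_decrease_le x (lexx 0); rewrite scale0r addr0 mul0r subr0.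
Qed.

Lemma sublinear_decrease_opp : sublinear_decrease p y (- y) <= - p y.
Proof.
have := sublinear_decrease_le (- y) (@ler01 R).
by rewrite scale1r addNr (sublinear0 ps) mul1r add0r.
Qed.

End Decrease.

(** Zorn's lemma for the reversed pointwise order, so that a maximal element is a minimal function.
    The infimum of a chain is finite because every member is at least [- q (- x)] at [x], and
    subadditive because the smaller of two members serves both arguments; [q] itself bounds the
    empty chain. *)
Lemma minimal_sublinear (q : V -> R) : sublinear q ->
  exists2 p, sublinear p /\ (forall x, p x <= q x) &
    forall p', sublinear p' -> (forall x, p' x <= p x) -> p' = p.
Proof.
move=> qs.
pose T := {p : V -> R | sublinear p /\ forall x, p x <= q x}.
pose r (s t : T) := `[< forall x, sval t x <= sval s x >].
have [] := @Zorn T r.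
- by move=> t; apply/asboolP.
- by move=> a b c /asboolP ab /asboolP bc; apply/asboolP => x; exact: le_trans (bc x) (ab x).
- move=> [s hs] [t ht] /asboolP /= st /asboolP /= ts; apply: eq_exist => /=.
  by apply/funext => x; apply/eqP; rewrite eq_le st ts.
- move=> A tA; have [[a0 Aa0]|A0] := pselect (A !=set0); last first.
    by exists (exist _ q (conj qs (fun x => lexx _))) => s As; exfalso; apply: A0; exists s.
  pose E x := [set sval a x | a in A].
  have En0 x : E x !=set0 by exists (sval a0 x); exists a0.
  have Elb x : has_lbound (E x).
    exists (- q (- x)) => _ [[a [/= as_ aq]] _ <-] /=.
    by apply: le_trans (sublinear_ge x as_); rewrite lerN2.
  have Ele x a : A a -> inf (E x) <= sval a x by move=> Aa; apply: ge_inf => //; exists a.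
  have ms : sublinear (fun x => inf (E x)).
    split.
      move=> x1 x2; rewrite -lerBlDr; apply: lb_le_inf => // _ [a Aa <-].
      rewrite lerBlDr -lerBlDl; apply: lb_le_inf => // _ [b Ab <-].
      rewrite lerBlDl.
      have [/asboolP ab|/asboolP ba] := tA _ _ Aa Ab.
        apply: (le_trans (Ele _ _ Ab)); apply: (le_trans ((svalP b).1.1 x1 x2)).
        by rewrite lerD2r.
      apply: (le_trans (Ele _ _ Aa)); apply: (le_trans ((svalP a).1.1 x1 x2)).
      by rewrite lerD2l.
    move=> t x t0; rewrite mulrC -ler_pdivrMr//; apply: lb_le_inf => // _ [a Aa <-].
    rewrite ler_pdivrMr//; apply: (le_trans (Ele _ _ Aa)).
    by rewrite mulrC; exact: (svalP a).1.2.
  have mq x : inf (E x) <= q x.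
    by apply: (le_trans (Ele _ _ Aa0)); exact: (svalP a0).2.
  exists (exist _ (fun x => inf (E x)) (conj ms mq)) => s As.
  by apply/asboolP => x /=; exact: Ele.
move=> [p [ps pq]] pmin; exists p; first by [].
move=> p' p's p'p.
have p'q x : p' x <= q x by exact: le_trans (p'p x) (pq x).
have /(congr1 sval)//= := pmin (exist _ p' (conj p's p'q)) ltac:(by apply/asboolP).
Qed.

(** Hahn-Banach without extension from a subspace: the norm is first decreased along [d], which
    brings its value at [- d] down to at most -|d|. A linear form below this function is below the
    norm and is at least |d| at [d]. *)
Lemma norming_functional (d : V) :
  exists f : {scalar V}, f d = `|d| /\ forall x, `|f x| <= `|x|.
Proof.
pose nm (x : V) := `|x|.
have nms : sublinear nm.
  split; first by move=> x y; exact: ler_normD.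
  by move=> t x t0; rewrite /nm normrZ gtr0_norm.
have [p [ps pq] pmin] := minimal_sublinear (sublinear_decreaseS d nms).
have pN y : p (- y) = - p y.
  apply/eqP; rewrite eq_le; apply/andP; split; last first.
    by have := sublinear_ge (- y) ps; rewrite opprK.
  have h := sublinear_decrease_opp y ps.
  by rewrite (pmin _ (sublinear_decreaseS y ps) (sublinear_decrease_le_id y ps)) in h.
have pD x y : p (x + y) = p x + p y.
  apply/eqP; rewrite eq_le ps.1 /=.
  by have := ps.1 (x + y) (- y); rewrite addrK pN; lra.
have pZp t x : 0 < t -> p (t *: x) = t * p x.
  move=> t0; apply/eqP; rewrite eq_le ps.2//=.
  have h := ps.2 t^-1 (t *: x) ltac:(by rewrite invr_gt0).
  rewrite scalerA mulVf ?gt_eqF// scale1r in h.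
  by rewrite mulrC -ler_pdivlMr// mulrC.
have pZ t x : p (t *: x) = t * p x.
  have [t0|t0|->] := ltgtP t 0.
  - rewrite -[t *: x]opprK -scaleNr pN pZp; last by rewrite oppr_gt0.
    by rewrite mulNr opprK.
  - exact: pZp.
  - by rewrite scale0r mul0r (sublinear0 ps).
have pl : linear_for *%R p by move=> a u v; rewrite pD pZ.
pose fL := GRing.isLinear.Build R V R *%R p pl.
pose f : {scalar V} := HB.pack p fL.
have ple x : p x <= `|x|.
  exact: le_trans (pq x) (sublinear_decrease_le_id d nms x).
have pabs x : `|p x| <= `|x|.
  by rewrite ler_norml ple andbT lerNl -pN -[leRHS]normrN.
exists f; split => //; apply/eqP; rewrite eq_le.
rewrite (le_trans (ler_norm _) (pabs d))/=.
have := le_trans (pq (- d)) (sublinear_decrease_opp d nms).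
by rewrite pN lerN2.
Qed.

End HahnBanach.

Section BorelGeneration.
Context (R : realType) (W : normedModType R).

Lemma dense_seq (D : set W) : countable D -> dense D ->
  exists d : nat -> W, dense (range d).
Proof.
move=> /countable_injP[f finj] Dd.
have h n : exists y, forall x, D x -> f x = n -> y = x.
  have [[x [Dx fx]]|no] := pselect (exists x, D x /\ f x = n).
    by exists x => y Dy fy; apply: finj; rewrite ?inE// fx fy.
  by exists 0 => x Dx fx; exfalso; apply: no; exists x.
have [d hd] := choice h.
exists d => O O0 Oo; have [x [Ox Dx]] := Dd O O0 Oo.
by exists x; split => //; exists (f x) => //; exact: hd.
Qed.

Lemma dense_seq_ball (d : nat -> W) : dense (range d) ->
  forall x (r : R), 0 < r -> exists n, `|x - d n| < r.
Proof.
move=> dd x r r0.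
have [|y [xy [n _ yE]]] := dd (ball x r) _ (ball_open x r).
  by exists x; exact: (ballxx x r0).
by exists n; rewrite yE; move: xy; rewrite -ball_normE.
Qed.

Definition halfspaces : set (set W) :=
  [set A | exists2 f : {scalar W}, continuous (f : W -> R) &
     exists a, A = [set x | f x <= a]].

(** Forms norming the points of a dense sequence recover the norm of every point as a supremum, so a
    closed ball is a countable intersection of half-spaces. An open set is the union of the
    countably many closed balls of radius 1/(k+1) around the [d n] that it contains. *)
Lemma open_halfspaces (d : nat -> W) : dense (range d) ->
  @open W `<=` <<s halfspaces >>.
Proof.
move=> dd.
have [f hf] := choice (fun n => norming_functional (d n)).
have fc n : continuous (f n : W -> R).
  apply/linear_bounded_continuous; apply/linear_boundedP; near=> M => x.
  apply: (le_trans ((hf n).2 x)).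
  by rewrite ler_peMl.
(* [f n] is 1-Lipschitz with value |d n| at [d n], so [f n x] is at least |x| minus twice the
   distance from [x] to [d n]. *)
have norm_le x r : (forall n, f n x <= r) -> `|x| <= r.
  move=> h; apply/ler_addgt0Pr => e e0.
  have [n hn] := dense_seq_ball dd x (divr_gt0 e0 (@ltr0n R 2)).
  have h1 := (hf n).2 (d n - x); have h2 := h n.
  have h3 : `|x| <= `|x - d n| + `|d n| by rewrite -{1}(subrK (d n) x) ler_normD.
  rewrite linearB /= (hf n).1 (distrC (d n)) in h1.
  have := le_trans (ler_norm _) h1; lra.
pose S := g_sigma_algebraType halfspaces.
have mball c r : measurable ([set x | `|x - c| <= r] : set S).
  rewrite (_ : [set x | _] = \bigcap_n [set x | f n x <= r + f n c]).
    apply: bigcapT_measurable => n; apply: sub_sigma_algebra.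
    by exists (f n) => //; exists (r + f n c).
  apply/seteqP; split => x /= h.
    move=> n _ /=; rewrite -lerBlDr -linearB.
    exact: le_trans (ler_norm _) (le_trans ((hf n).2 _) h).
  by apply: norm_le => n; rewrite linearB /= lerBlDr; exact: h.
move=> U Uo.
pose I n k := `[< [set x | `|x - d n| <= k.+1%:R^-1] `<=` U >].
rewrite (_ : U = \bigcup_n \bigcup_k
    (if I n k then [set x | `|x - d n| <= k.+1%:R^-1] else set0)).
  change (measurable (\bigcup_n \bigcup_k
    (if I n k then [set x | `|x - d n| <= k.+1%:R^-1] else set0) : set S)).
  apply: bigcupT_measurable => n; apply: bigcupT_measurable => k.
  by case: ifP => // _; exact: mball.
apply/seteqP; split => x /=; last first.
  by move=> [n _ [k _]]; case: ifP => // /asboolP; exact.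
move=> Ux.
have /nbhs_ballP[r /= r0 rU] : nbhs x U by exact: open_nbhs_nbhs.
have r4 : 0 < r / 2 by rewrite divr_gt0.
have [k _ /(_ k (leqnn k)) hk] := near_infty_natSinv_lt (PosNum r4).
rewrite /= in hk.
have [n hn] := dense_seq_ball dd x (ltac:(by []) : 0 < (k.+1%:R : R)^-1).
exists n => //; exists k => //.
rewrite (_ : I n k = true)/=; first exact: ltW.
apply/asboolP => y /= hy; apply: rU; rewrite -ball_normE /=.
rewrite -(subrK (d n) x) -addrA.
apply: (le_lt_trans (ler_normD _ _)); rewrite (distrC _ y).
move: (k.+1%:R^-1) hk hn hy => z; lra.
Unshelve. all: by end_near. Qed.

End BorelGeneration.

(** * Inner products and the Riesz representation *)

Section InnerProduct.
Context (R : realType) (V : normedModType R).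
Implicit Types (ip : V -> V -> R) (x y z : V).

(** A predicate, so that the same lemmas serve [dot] on H and [ip2 dot] on H * H, where the norm of
    the normed module is not the one of the scalar product. *)
Definition inner_product ip :=
  [/\ forall x y, ip x y = ip y x,
      forall x y z, ip (x + y) z = ip x z + ip y z,
      forall a x y, ip (a *: x) y = a * ip x y &
      forall x, x != 0 -> 0 < ip x x].

Variable ip : V -> V -> R.
Hypothesis ipP : inner_product ip.

Lemma ipC x y : ip x y = ip y x. Proof. by have [] := ipP. Qed.
Lemma ipDl x y z : ip (x + y) z = ip x z + ip y z. Proof. by have [] := ipP. Qed.
Lemma ipZl a x y : ip (a *: x) y = a * ip x y. Proof. by have [] := ipP. Qed.
Lemma ip_gt0 x : x != 0 -> 0 < ip x x. Proof. by have [_ _ _] := ipP; exact. Qed.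
Lemma ipDr x y z : ip z (x + y) = ip z x + ip z y.
Proof. by rewrite ipC ipDl !(ipC z). Qed.
Lemma ipZr a x y : ip x (a *: y) = a * ip x y.
Proof. by rewrite ipC ipZl ipC. Qed.
Lemma ipNl x y : ip (- x) y = - ip x y.
Proof. by rewrite -scaleN1r ipZl mulN1r. Qed.
Lemma ipNr x y : ip x (- y) = - ip x y.
Proof. by rewrite ipC ipNl ipC. Qed.
Lemma ip0l x : ip 0 x = 0.
Proof. by rewrite -(scale0r x) ipZl mul0r. Qed.
Lemma ip0r x : ip x 0 = 0.
Proof. by rewrite ipC ip0l. Qed.
Lemma ip_ge0 x : 0 <= ip x x.
Proof. by have [->|/ip_gt0/ltW//] := eqVneq x 0; rewrite ip0l. Qed.
Lemma ip_suml (I : Type) (s : seq I) (f : I -> V) x :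
  ip (\sum_(i <- s) f i) x = \sum_(i <- s) ip (f i) x.
Proof.
by elim/big_rec2 : _ => [|i u v _ <-]; rewrite ?ip0l// ipDl.
Qed.
Lemma ip_sumr (I : Type) (s : seq I) (f : I -> V) x :
  ip x (\sum_(i <- s) f i) = \sum_(i <- s) ip x (f i).
Proof. by rewrite ipC ip_suml; apply: eq_bigr => i _; rewrite ipC. Qed.

Lemma hnorm_ge0 x : 0 <= hnorm ip x.
Proof. exact: sqrtr_ge0. Qed.

Lemma hnormE x : hnorm ip x ^+ 2 = ip x x.
Proof. by rewrite /hnorm sqr_sqrtr// ip_ge0. Qed.

Lemma hnorm_eq0 x : hnorm ip x = 0 -> x = 0.
Proof.
move=> x0; apply/eqP; apply: contraT => /ip_gt0.
by rewrite -hnormE x0 expr0n ltxx.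
Qed.

Section Orthonormal.
Variables (n : nat) (w : 'I_n -> V).
Hypothesis ow : orthonormal_family ip w.

Lemma ip_orthonormal_comb (c : 'I_n -> R) j :
  ip (\sum_(i < n) c i *: w i) (w j) = c j.
Proof.
rewrite ip_suml (bigD1 j)//= big1 ?addr0; last first.
  by move=> i ij; rewrite ipZl ow (negbTE ij) mulr0.
by rewrite ipZl ow eqxx mulr1.
Qed.

Lemma ip_residual x j : ip (x - \sum_(i < n) ip x (w i) *: w i) (w j) = 0.
Proof. by rewrite ipDl ipNl ip_orthonormal_comb subrr. Qed.

Lemma ip_split x :
  ip x x = \sum_(i < n) ip x (w i) ^+ 2 +
    ip (x - \sum_(i < n) ip x (w i) *: w i) (x - \sum_(i < n) ip x (w i) *: w i).
Proof.
set s := \sum_(i < n) ip x (w i) *: w i.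
have sr : ip s (x - s) = 0.
  rewrite /s ip_suml big1// => i _.
  by rewrite ipZl (ipC (w i)) ip_residual mulr0.
have ss : ip s s = \sum_(i < n) ip x (w i) ^+ 2.
  rewrite {2}/s ip_sumr; apply: eq_bigr => i _.
  by rewrite ipZr ip_orthonormal_comb expr2.
rewrite -ss -{1 2}(subrK s x); move: (x - s) sr => r sr.
by rewrite ipDl !ipDr sr (ipC r s) sr addr0 add0r addrC.
Qed.

Lemma bessel x : \sum_(i < n) ip x (w i) ^+ 2 <= ip x x.
Proof. by rewrite [leRHS]ip_split lerDl ip_ge0. Qed.

End Orthonormal.

Lemma ip_abs_le x y : ip y y = 1 -> `|ip x y| <= hnorm ip x.
Proof.
move=> y1; have h : orthonormal_family ip (fun _ : 'I_1 => y).
  by move=> i j; rewrite !ord1 eqxx y1.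
have := bessel h x; rewrite big_ord1 -hnormE => hb.
by rewrite -(@ler_pXn2r _ 2) ?nnegrE ?hnorm_ge0// real_normK ?num_real.
Qed.

End InnerProduct.

Section Dot.
Context (R : realType) (H : normedModType R) (dot : {dot H for idfun}).

Lemma dot_inner_product : inner_product dot.
Proof.
split.
- by move=> x y; rewrite hermC /= expr0 mul1r.
- by move=> x y z; rewrite linearDl.
- by move=> a x y; rewrite linearZl_LR.
- by move=> x /neq0_dnorm_gt0 => /(_ _ dot).
Qed.

Lemma ip2_inner_product : inner_product (ip2 dot).
Proof.
have dP := dot_inner_product; rewrite /ip2; split => /=.
- by move=> x y; rewrite (ipC dP x.1) (ipC dP x.2).
- by move=> x y z; rewrite !(ipDl dP) addrACA.
- by move=> a x y; rewrite !(ipZl dP) mulrDr.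
- move=> [x1 x2] /=; have [->|x10] := eqVneq x1 0.
    have [->|x20 _] := eqVneq x2 0; first by rewrite eqxx.
    by rewrite (ip0l dP) add0r (ip_gt0 dP).
  by move=> _; apply: ltr_wpDr; rewrite ?(ip_ge0 dP)// (ip_gt0 dP).
Qed.

End Dot.

Section Riesz.
Context (R : realType) (H : completeNormedModType R) (dot : {dot H for idfun}).
Hypothesis nE : forall x : H, `|x| = hnorm dot x.
Let dP := dot_inner_product dot.

(** Minimisation of |x|^2 - 2 g(x), which is bounded below because g is bounded. Completeness gives
    a minimiser [a], and the derivative there vanishes exactly when g is the scalar product with
    [a]. *)
Lemma riesz (g : {scalar H}) : continuous (g : H -> R) ->
  exists a, forall x, g x = dot a x.
Proof.
move=> gc.
have [C C0 gC] : exists2 C : R, 0 < C & forall x, `|g x| <= C * `|x|.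
  have /linear_bounded_continuous/linear_boundedP := gc.
  move=> [C [_ hC]]; exists (`|C| + 1); first by rewrite ltr_wpDl.
  by apply: hC; rewrite (le_lt_trans (ler_norm C))// ltrDl.
have gD x y : g (x + y) = g x + g y by rewrite linearD.
have gZ t x : g (t *: x) = t * g x by rewrite linearZ.
pose J x := dot x x - 2 * g x.
have xx x : dot x x = `|x| ^+ 2 by rewrite nE hnormE.
have J_ge x : - C ^+ 2 <= J x.
  have h := le_trans (ler_norm _) (gC x).
  by rewrite /J xx; have := sqr_ge0 (`|x| - C); nra.
have Jlb : has_lbound (range J) by exists (- C ^+ 2) => _ [x _ <-].
have Jn0 : range J !=set0 by exists (J 0); exists 0.
pose d := inf (range J).
have Jd x : d <= J x by apply: ge_inf => //; exists x.
(* The parallelogram identity: [J x + J y] exceeds twice the value of [J] at the midpoint by |x -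
   y|^2 / 2, and that value is at least [d]. *)
have J_mid x y : `|x - y| ^+ 2 <= 2 * (J x - d) + 2 * (J y - d).
  have := Jd (2^-1 *: (x + y)); rewrite /J gZ gD.
  rewrite (ipZl dP) (ipZr dP) !(ipDl dP, ipDr dP) -xx !(ipDl dP, ipDr dP).
  rewrite !(ipNl dP, ipNr dP) (ipC dP y x); lra.
have seq n : exists x, J x < d + (n.+1%:R)^-1.
  have [_ [x _ <-] hx] := inf_adherent (ltac:(by []) : 0 < (n.+1%:R : R)^-1) (conj Jn0 Jlb).
  by exists x.
have [u hu] := choice seq.
have Cu : cauchy (u x @[x --> \oo]).
  apply: cauchy_exP => e /= e0.
  have e2 : 0 < e ^+ 2 / 4 by rewrite divr_gt0// exprn_gt0.
  have [N _ hN] := near_infty_natSinv_lt (PosNum e2).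
  have NN n : (N <= n)%N -> J (u n) - d < e ^+ 2 / 4.
    by move=> Nn; have := hu n; have /= := hN n Nn; move: (n.+1%:R^-1) => z; lra.
  exists (u N), N => // n /= Nn; rewrite -ball_normE /=.
  rewrite -(@ltr_pXn2r _ 2) ?nnegrE ?(ltW e0)//.
  apply: le_lt_trans (J_mid _ _) _.
  have := NN _ Nn; have := NN _ (leqnn N); lra.
have /cauchy_cvgP/cvg_ex[a ua] := Cu.
have Jc : continuous J.
  move=> x; apply: cvgB; last by apply: cvgM; [exact: cvg_cst|exact: gc].
  under eq_fun do rewrite xx.
  rewrite xx; apply: cvgM; exact: norm_continuous.
have Ja : J a = d.
  apply/eqP; rewrite eq_le Jd andbT.
  have Jua : J (u n) @[n --> \oo] --> J a by apply: cvg_comp ua _; exact: Jc.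
  apply/ler_addgt0Pr => e e0.
  rewrite -(cvg_lim _ Jua)//; apply: limr_le; first by apply/cvg_ex; exists (J a).
  have [N _ hN] := near_infty_natSinv_lt (PosNum e0).
  exists N => // n /= Nn; have := hu n; have /= := hN n Nn; move: (n.+1%:R^-1) => z; lra.
exists a => x.
have key t : 0 <= 2 * t * (dot a x - g x) + t ^+ 2 * dot x x.
  have := Jd (a + t *: x); rewrite -Ja /J gD gZ.
  rewrite !(ipDl dP, ipDr dP) !(ipZl dP, ipZr dP) (ipC dP x a); nra.
apply/eqP; rewrite eq_sym -subr_eq0; set b := dot a x - g x in key *.
apply: contraT => b0.
have D0 : 0 < dot x x + 1 by rewrite ltr_wpDl// (ip_ge0 dP).
(* The quadratic in [t] is least at [- b / dot x x]; adding 1 to the denominator keeps it nonzero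
   for [x = 0] and still gives a negative value when [b] is nonzero. *)
have := key (- b / (dot x x + 1)).
have -> : 2 * (- b / (dot x x + 1)) * b + (- b / (dot x x + 1)) ^+ 2 * dot x x =
  - (b / (dot x x + 1)) ^+ 2 * (dot x x + 2) by field; rewrite gt_eqF.
have : 0 < (b / (dot x x + 1)) ^+ 2.
  by rewrite lt_neqAle sqr_ge0 andbT eq_sym sqrf_eq0 mulf_neq0// invr_eq0 gt_eqF.
nra.
Qed.

End Riesz.

(** * Affine changes of variable for Gaussian measures *)

Lemma image_measure d1 d2 (T1 : measurableType d1) (T2 : measurableType d2)
    (R : realType) (m : {measure set T1 -> \bar R}) (f : T1 -> T2) :
  measurable_fun [set: T1] f ->
  exists2 nu : {measure set T2 -> \bar R}, (forall A, nu A = m (f @^-1` A)) &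
    forall g : T2 -> \bar R, measurable_fun [set: T2] g -> (forall x, 0 <= g x)%E ->
      (\int[nu]_x g x = \int[m]_x g (f x))%E.
Proof.
move=> mf; unshelve eexists (pushforward m f : {measure set T2 -> \bar R}) => //.
move=> g mg g0; rewrite ge0_integral_pushforward//.
Qed.

Section Gauss1.
Context (R : realType).
Implicit Types (m s c : R).
Local Notation leb := (@lebesgue_measure R).

(** [normal_pdf] and the Radon-Nikodym derivative of [normal_prob] have the same integral over every
    measurable set, so they agree almost everywhere. *)
Lemma integral_normal_prob m s (f : measurableTypeR R -> \bar R) :
  measurable_fun [set: measurableTypeR R] f -> (forall x, 0 <= f x)%E ->
  (\int[normal_prob m s]_x f x = \int[leb]_x (f x * (normal_pdf m s x)%:E))%E.
Proof.
move=> mf f0.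
have dom := normal_prob_dominates m s.
rewrite -(Radon_Nikodym_SigmaFinite.change_of_variables dom)//.
have mpdf : measurable_fun [set: measurableTypeR R] (fun x => (normal_pdf m s x)%:E).
  by apply/measurable_EFinP; exact: measurable_normal_pdf.
have fi := Radon_Nikodym_SigmaFinite.f_integrable dom.
apply: ge0_ae_eq_integral => //.
- by apply: emeasurable_funM => //; exact: measurable_int fi.
- by apply: emeasurable_funM.
- by move=> x _; rewrite mule_ge0// Radon_Nikodym_SigmaFinite.f_ge0.
- by move=> x _; rewrite mule_ge0// lee_fin normal_pdf_ge0.
apply: ae_eqe_mul2l.
apply: integral_ae_eq => // E _ mE.
by rewrite -Radon_Nikodym_SigmaFinite.f_integral.
Qed.

Lemma normal_pdf_affine c s (sg v : R) : 0 < s -> 0 < sg ->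
  normal_pdf 0 sg v = normal_pdf c (s * sg) (c + s * v) * s.
Proof.
move=> s0 sg0; rewrite !normal_pdfE ?mulf_neq0 ?gt_eqF//.
rewrite /normal_fun (addrC c) addrK subr0 mulrAC; congr (_ * _).
  rewrite /normal_peak.
  have -> : (s * sg) ^+ 2 * pi *+ 2 = s ^+ 2 * (sg ^+ 2 * pi *+ 2) by ring.
  rewrite sqrtrM ?sqr_ge0// sqrtr_sqr gtr0_norm//.
  by rewrite invfM [RHS]mulrAC mulVf ?gt_eqF// mul1r.
by congr expR; field; rewrite !gt_eqF.
Qed.

(** Half-lines closed on the left generate the Borel sets and are stable under intersection; on them
    the identity is the substitution [u = c + s * v] in the density. *)
Lemma normal_prob_affine c s (sg : R) (A : set (measurableTypeR R)) :
  0 < s -> 0 < sg -> measurable A ->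
  normal_prob 0 sg [set v | A (c + s * v)] = normal_prob c (s * sg) A.
Proof.
move=> s0 sg0 mA; pose F (v : R) := c + s * v.
have mF : measurable_fun [set: measurableTypeR R] (F : _ -> measurableTypeR R).
  by apply: measurable_funD => //; apply: measurable_funM.
have [nu nuE _] := image_measure (normal_prob 0 sg) mF.
transitivity (nu A); first by rewrite nuE.
have cover : \bigcup_k `[(- k%:R : R), +oo[%classic = [set: R].
  apply/seteqP; split => // x _; exists (Num.bound `|x|) => //=.
  rewrite in_itv /= andbT lerNl (le_trans (ler_norm _))// normrN.
  exact/ltW/archi_boundP/normr_ge0.
have dF x : is_derive x (1 : R) F s.
  have -> : F = cst c + s \*: (@idfun R^o) by [].
  by apply: is_derive_eq; rewrite add0r /GRing.scale /= mulr1.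
have F'E : F^`()%classic = cst s.
  by apply/funext => x; rewrite derive1E; exact: derive_val.
have Fc : continuous F.
  by move=> x; apply: differentiable_continuous; apply/derivable1_diffP; exact: ex_derive.
refine (@measure_unique _ R (measurableTypeR R) (@RGenCInfty.G R)
  (fun k => `[(- k%:R : R), +oo[%classic) _ _ _ cover nu (normal_prob c (s * sg)) _ _ A mA) => //.
- exact: RGenCInfty.measurableE.
- move=> _ _ [x ->] [y ->]; exists (Num.max x y).
  by apply/seteqP; split => u /=; rewrite !in_itv/= !andbT ge_max => /andP.
- by move=> k; eexists.
- move=> _ [x ->]; rewrite nuE /normal_prob /=.
  rewrite (_ : _ @^-1` _ = `[(x - c) / s, +oo[%classic); last first.
    apply/seteqP; split=> v /=; rewrite !in_itv/= !andbT ler_pdivrMr// lerBlDl mulrC//.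
  rewrite [in RHS](_ : x = F ((x - c) / s)); last first.
    by rewrite /F mulrC divfK ?gt_eqF// addrC subrK.
  symmetry; etransitivity.
  apply: (@increasing_ge0_integration_by_substitutiony _ F (normal_pdf c (s * sg)) ((x - c) / s)); first last.
  + by move=> v _; exact: normal_pdf_ge0.
  + apply: continuous_subspaceT; apply: continuous_normal_pdf.
    by rewrite mulf_neq0 ?gt_eqF.
  + apply/cvgryPge => M; near=> v.
    rewrite /F -lerBlDl mulrC -ler_pdivrMr//; near: v.
  + split; first by move=> v _; have [] := dF v.
    exact: cvg_at_right_filter (Fc _).
  + by rewrite F'E; exact: is_cvg_cst.
  + by rewrite F'E; exact: is_cvg_cst.
  + by rewrite F'E => ? _; exact: cvg_cst.
  + by move=> u v _ _ uv; rewrite /F ltrD2l ltr_pM2l.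
  by apply: eq_integral => v _; rewrite F'E /= (normal_pdf_affine c v s0 sg0).
- move=> k; rewrite nuE; apply: le_lt_trans (probability_le1 _ _) (ltry _).
  by rewrite -[X in measurable X]setTI; apply: mF => //; exact: measurable_itv.
Unshelve. all: by end_near. Qed.

End Gauss1.

Section Gauss2.
Context (R : realType).
Implicit Types (m s c lam : R).
Local Notation leb := (@lebesgue_measure R).

Lemma integral_normal_affine c s (sg : R) (f : measurableTypeR R -> \bar R) :
  0 < s -> 0 < sg -> measurable_fun [set: measurableTypeR R] f ->
  (forall x, 0 <= f x)%E ->
  (\int[normal_prob 0%R sg]_v f (c + s * v)%R = \int[normal_prob c (s * sg)%R]_v f v)%E.
Proof.
move=> s0 sg0 mf f0; pose F (v : R) := c + s * v.
have mF : measurable_fun [set: measurableTypeR R] (F : _ -> measurableTypeR R).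
  by apply: measurable_funD => //; apply: measurable_funM.
have [nu nuE <-//] := image_measure (normal_prob 0 sg) mF.
apply: eq_measure_integral => A mA _; rewrite nuE.
exact: normal_prob_affine.
Qed.

(** The Cameron-Martin density: that of the law of mean [c] and standard deviation [t] relative to
    the centred one. *)
Definition gauss_tilt c (t : R) (u : R) : R := expR (c * u / t ^+ 2 - c ^+ 2 / (t ^+ 2 *+ 2)).

Lemma normal_pdf_tilt c (t u : R) : 0 < t ->
  normal_pdf c t u = gauss_tilt c t u * normal_pdf 0 t u.
Proof.
move=> t0; rewrite !normal_pdfE ?gt_eqF// mulrCA; congr (_ * _).
rewrite /normal_fun /gauss_tilt -expRD; congr expR.
by field; rewrite gt_eqF.
Qed.

(** Integrated over [u], the left side is the second moment of the density under the centred law. As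
    the tilt recentres the law at 2c, this moment is [expR (c ^+ 2 / t ^+ 2)], the source of the
    constant of quasi-invariance. *)
Lemma gauss_tilt_pdf c (t u : R) : 0 < t ->
  gauss_tilt c t u * normal_pdf c t u = expR (c ^+ 2 / t ^+ 2) * normal_pdf (c *+ 2) t u.
Proof.
move=> t0; rewrite !normal_pdfE ?gt_eqF// mulrCA [RHS]mulrCA; congr (_ * _).
rewrite /normal_fun /gauss_tilt -!expRD; congr expR.
by field; rewrite gt_eqF.
Qed.

(** The hypothesis is used at [u = c + s * v] with [mu] equal to [lam] divided by the tilt at [u].
    The first term then integrates to the second moment of the density; in the second the tilt
    cancels against the density of the shifted law, which leaves an integral under the centred
    law. *)
Lemma gauss_shift_step (a b : measurableTypeR R -> \bar R) (k c s sg lam : R) :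
  0 < s -> 0 < sg -> 0 < lam -> 0 <= k ->
  measurable_fun [set: measurableTypeR R] a ->
  measurable_fun [set: measurableTypeR R] b ->
  (forall v, 0 <= a v)%E -> (forall v, 0 <= b v)%E ->
  (forall (mu v : R), 0 < mu ->
     (2%:E * a v <= (k / mu)%:E + mu%:E * b (c + s * v)%R)%E) ->
  (2%:E * \int[normal_prob 0%R sg]_v a v <=
     (expR (c ^+ 2 / (s * sg) ^+ 2) * k / lam)%R%:E +
     lam%:E * \int[normal_prob 0%R (s * sg)%R]_v b v)%E.
Proof.
move=> s0 sg0 lam0 k0 ma mb a0 b0 hab.
set t := s * sg; have t0 : 0 < t by rewrite mulr_gt0.
pose rho := gauss_tilt c t.
have rho0 u : 0 < rho u by exact: expR_gt0.
have mrho0 : measurable_fun [set: measurableTypeR R]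
    (fun u => c * u / t ^+ 2 - c ^+ 2 / (t ^+ 2 *+ 2)).
  by apply: measurable_funB => //; do 2 apply: measurable_funM => //.
have mrho : measurable_fun [set: measurableTypeR R] rho.
  exact: measurableT_comp.
have mrhoV : measurable_fun [set: measurableTypeR R] (fun u => (rho u)^-1).
  under eq_fun do rewrite /rho /gauss_tilt -expRN.
  by apply: measurableT_comp => //; exact: measurableT_comp.
pose g1 (u : measurableTypeR R) := (k / lam * rho u)%:E.
pose g2 (u : measurableTypeR R) := (lam%:E * ((rho u)^-1%:E * b u))%E.
have mg1 : measurable_fun [set: measurableTypeR R] g1.
  by apply/measurable_EFinP; apply: measurable_funM.
have mg2 : measurable_fun [set: measurableTypeR R] g2.
  apply: emeasurable_funM => //; apply: emeasurable_funM => //.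
  exact/measurable_EFinP.
have g10 u : (0 <= g1 u)%E by rewrite lee_fin; apply: mulr_ge0; [apply: divr_ge0 => //|]; exact: ltW.
have g20 u : (0 <= g2 u)%E.
  by apply: mule_ge0; [|apply: mule_ge0 => //]; rewrite lee_fin ?invr_ge0; exact: ltW.
rewrite -ge0_integralZl//.
apply: (@le_trans _ _ (\int[normal_prob 0%R sg]_v (g1 (c + s * v)%R + g2 (c + s * v)%R))%E).
  apply: ge0_le_integral => //.
  - by move=> v _; rewrite mule_ge0// lee_fin.
  - by apply: emeasurable_funM.
  - apply: (@measurableT_comp _ _ _ _ _ _ (fun u => g1 u + g2 u)%E).
      exact: emeasurable_funD.
    by apply: measurable_funD => //; apply: measurable_funM.
  - move=> v _; set u := c + s * v.
    have := hab (lam / rho u) v (divr_gt0 lam0 (rho0 _)).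
    rewrite /g1 /g2 muleA -EFinM -/u.
    by rewrite (_ : k / (lam / rho u) = k / lam * rho u)// invf_div mulrA mulrAC.
rewrite (@integral_normal_affine c s sg (fun u => g1 u + g2 u)%E)//; last 2 first.
- exact: emeasurable_funD.
- by move=> u; rewrite adde_ge0.
rewrite -/t ge0_integralD//; apply: leeD.
  rewrite integral_normal_prob//.
  under eq_integral => u _ do
    rewrite /g1 -EFinM -(mulrA (k / lam)) /rho (gauss_tilt_pdf _ _ t0) mulrA EFinM.
  rewrite ge0_integralZl//; last 3 first.
  - by apply/measurable_EFinP; exact: measurable_normal_pdf.
  - by move=> u _; rewrite lee_fin normal_pdf_ge0.
  - by rewrite lee_fin mulr_ge0 ?divr_ge0 ?expR_ge0// ltW.
  by rewrite integral_normal_pdf mule1 lee_fin mulrC mulrA.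
rewrite integral_normal_prob// integral_normal_prob//.
rewrite -ge0_integralZl//; last 3 first.
- apply: emeasurable_funM => //; apply/measurable_EFinP; exact: measurable_normal_pdf.
- by move=> u _; apply: mule_ge0 => //; rewrite lee_fin normal_pdf_ge0.
- by rewrite lee_fin ltW.
rewrite le_eqVlt; apply/orP; left; apply/eqP; apply: eq_integral => u _.
rewrite /g2 (normal_pdf_tilt _ _ t0) -/(rho u) -!muleA; congr (_ * _)%E.
rewrite muleCA; congr (_ * _)%E; rewrite -EFinM mulrA mulVf ?mul1r//.
by rewrite gt_eqF.
Qed.

End Gauss2.

(** * Gaussian measures on tuples and their translates *)

Section GaussTuple.
Context (R : realType).

Lemma gauss_tuple_ge0 (sg : R) n A : (0 <= gauss_tuple sg (n := n) A)%E.
Proof.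
by elim: n A => [A|n IH A] /=; [exact: measure_ge0|exact: integral_ge0].
Qed.

(** The parameter space varies in the induction: the first coordinate of the tuple is absorbed into
    it, and Tonelli's theorem integrates it out again. *)
Lemma measurable_gauss_tuple (sg : R) n d (T : measurableType d)
    (A : set (T * n.-tuple R)) : measurable A ->
  measurable_fun [set: T] (fun x => gauss_tuple sg [set t | A (x, t)]).
Proof.
elim: n d T A => [|n IH] d T A mA /=.
  have -> : (fun x => \d_([tuple] : 0.-tuple R) [set t | A (x, t)]) =
    EFin \o (\1_[set x | A (x, [tuple])] : T -> R).
    by apply/funext => x /=; rewrite diracE indicE.
  apply/measurable_EFinP; apply: measurable_indic.
  rewrite -[X in measurable X]setTI.
  apply: (@measurable_fun_pair _ _ _ T T _ id (cst [tuple])) => //.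
pose B := [set z : (T * measurableTypeR R) * n.-tuple R |
           A (z.1.1, [tuple of z.1.2 :: z.2])].
have mB : measurable B.
  rewrite -[X in measurable X]setTI.
  apply: (@measurable_fun_pair _ _ _ _ _ _ (fun z : (T * measurableTypeR R) * n.-tuple R => z.1.1)
     (fun z => [tuple of z.1.2 :: z.2])) => //.
    exact: (measurableT_comp measurable_fst measurable_fst).
  apply: measurable_cons => //.
  exact: (measurableT_comp measurable_snd measurable_fst).
have h := IH _ _ B mB.
apply: (@measurable_fun_fubini_tonelli_F _ _ T (measurableTypeR R) R (normal_prob 0 sg)
  (fun z => gauss_tuple sg [set t | B (z, t)])) => //.
by move=> z; exact: gauss_tuple_ge0.
Qed.

Lemma gauss_tuple1 (sg : R) (A : set (1.-tuple R)) : measurable A ->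
  gauss_tuple sg A = normal_prob 0 sg [set v | A [tuple v]].
Proof.
move=> mA /=.
have mA' : measurable ([set v | A [tuple v]] : set (measurableTypeR R)).
  rewrite -[X in measurable X]setTI.
  have : measurable_fun [set: measurableTypeR R] (fun v : measurableTypeR R => [tuple v] : 1.-tuple R).
    by apply/measurable_fun_tnthP => i; rewrite (_ : _ \o _ = id)//; apply/funext => v /=; rewrite ord1.
  exact.
rewrite -[X in normal_prob _ _ X]setIT -(integral_indic (normal_prob 0 sg) measurableT)//.
Qed.

(* The optimal [lam] turns this into a Cauchy-Schwarz inequality; the form linear in [gauss_tuple]
   is what the induction on n integrates, with a [lam] depending on the first coordinate. *)
Lemma gauss_tuple_shift n (c : 'I_n -> R) (s sg lam : R) (A : set (n.-tuple R)) :
  0 < s -> 0 < sg -> 0 < lam -> measurable A ->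
  (2%:E * gauss_tuple sg [set t | A [tuple (c i + s * tnth t i)%R | i < n]] <=
    (expR ((\sum_(i < n) c i ^+ 2) / (s * sg) ^+ 2) / lam)%:E +
    lam%:E * gauss_tuple (s * sg) A)%E.
Proof.
move=> s0 sg0; elim: n c lam A => [|n IH] c lam A lam0 mA.
  rewrite (_ : [set t | _] = A); last first.
    by apply/funext => t /=; congr (A _); rewrite [LHS]tuple0 [RHS]tuple0.
  rewrite big_ord0 mul0r expR0 /= diracE.
  case: (_ \in A) => /=; rewrite ?mule0 ?mule1 ?adde0.
    rewrite -EFinD lee_fin div1r -subr_ge0.
    rewrite (_ : _ - _ = (lam - 1) ^+ 2 / lam); last by field; rewrite gt_eqF.
    by rewrite divr_ge0 ?sqr_ge0// ltW.
  by rewrite lee_fin divr_ge0// ltW.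
pose c' (i : 'I_n) := c (lift ord0 i).
pose b v := gauss_tuple (s * sg) [set t : n.-tuple R | A [tuple of v :: t]].
pose a v := gauss_tuple sg [set t : n.-tuple R |
   A [tuple of (c ord0 + s * v) :: [tuple c' i + s * tnth t i | i < n]]].
have mcons : measurable_fun [set: measurableTypeR R * n.-tuple R]
    (fun z : measurableTypeR R * n.-tuple R => [tuple of z.1 :: z.2]).
  by apply: measurable_cons.
have mAc v : measurable [set t : n.-tuple R | A [tuple of v :: t]].
  rewrite -[X in measurable X]setTI.
  by apply: (@measurable_cons _ _ _ _ (cst v) n id).
have mb : measurable_fun [set: measurableTypeR R] b.
  apply: (@measurable_gauss_tuple (s * sg) n _ (measurableTypeR R)
    (fun z => A [tuple of z.1 :: z.2])).
  by rewrite -[X in measurable X]setTI; exact: mcons.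
have ma : measurable_fun [set: measurableTypeR R] a.
  apply: (@measurable_gauss_tuple sg n _ (measurableTypeR R)
    (fun z => A [tuple of (c ord0 + s * z.1) :: [tuple c' i + s * tnth z.2 i | i < n]])).
  rewrite -[X in measurable X]setTI.
  have : measurable_fun [set: measurableTypeR R * n.-tuple R]
    (fun z : measurableTypeR R * n.-tuple R =>
      [tuple of (c ord0 + s * z.1) :: [tuple c' i + s * tnth z.2 i | i < n]]).
    apply: measurable_cons.
      by apply: measurable_funD => //; apply: measurable_funM => //; exact: measurable_fst.
    apply/measurable_fun_tnthP => i.
    rewrite (_ : _ \o _ = (fun z => c' i + s * tnth z.2 i)); last first.
      by apply/funext => z /=; rewrite tnth_mktuple.
    apply: measurable_funD => //; apply: measurable_funM => //.
    apply: (measurableT_comp (measurable_tnth i)); exact: measurable_snd.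
  exact.
have consE v (t : n.-tuple R) :
    [tuple c i + s * tnth [tuple of v :: t] i | i < n.+1] =
    [tuple of (c ord0 + s * v) :: [tuple c' i + s * tnth t i | i < n]].
  apply: eq_from_tnth => i; rewrite tnth_mktuple.
  have [j ->|->] := unliftP ord0 i; last by rewrite !tnth0.
  by rewrite !tnthS tnth_mktuple.
have -> : gauss_tuple sg [set t | A [tuple (c i + s * tnth t i) | i < n.+1]] =
  (\int[normal_prob 0%R sg]_v a v)%E.
  apply: eq_integral => v _; congr gauss_tuple.
  by apply/seteqP; split => t /=; rewrite consE.
have -> : (\sum_(i < n.+1) c i ^+ 2) / (s * sg) ^+ 2 =
    c ord0 ^+ 2 / (s * sg) ^+ 2 + (\sum_(i < n) c' i ^+ 2) / (s * sg) ^+ 2.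
  by rewrite big_ord_recl mulrDl.
rewrite expRD; apply: gauss_shift_step => //.
- by move=> v; exact: gauss_tuple_ge0.
- by move=> v; exact: gauss_tuple_ge0.
- by move=> mu v mu0; exact: IH.
Qed.

End GaussTuple.

(** * Moments and tail of the standard Gaussian law *)

Section GaussMoments.
Context (R : realType).

Lemma measurable_gt_fun d (T : measurableType d) (f : T -> R) a :
  measurable_fun [set: T] f -> measurable [set x | a < f x].
Proof.
move=> mf; rewrite (_ : [set x | _] = f @^-1` `]a, +oo[%classic).
  by rewrite -[X in measurable X]setTI; apply: mf => //; exact: measurable_itv.
by apply/seteqP; split => v /=; rewrite in_itv/= andbT.
Qed.

Lemma gauss_moment_lty n :
  (\int[normal_prob (0 : R) 1]_v (((1 + `|v|) ^+ n)%R)%:E < +oo)%E.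
Proof.
have mf : measurable_fun [set: measurableTypeR R] (fun v => (1 + `|v|) ^+ n).
  by apply: measurable_funX; apply: measurable_funD => //; exact: measurableT_comp.
have mfE : measurable_fun [set: measurableTypeR R] (fun v => ((1 + `|v|) ^+ n)%:E).
  exact/measurable_EFinP.
have f0 (v : R) : (0 <= ((1 + `|v|) ^+ n)%:E)%E by rewrite lee_fin exprn_ge0// addr_ge0.
rewrite integral_normal_prob//.
(* Comparison with the density of standard deviation 2: (1 + |v|)^n <= exp(n|v|), and n|v| <= 2n^2 +
   v^2/8, so after subtracting v^2/2 the exponent is at most 2n^2 - v^2/8. [K] is exp(2n^2) times
   the ratio of the peaks. *)
pose K : R := expR (2 * n%:R ^+ 2) * normal_peak 1 / normal_peak 2.
have p2 : 0 < normal_peak 2 :> R by exact: normal_peak_gt0.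
apply: (@le_lt_trans _ _ (\int[lebesgue_measure]_v (K%:E * (normal_pdf 0 2 v)%:E))%E).
  apply: ge0_le_integral => //.
  - by move=> v _; rewrite -EFinM lee_fin mulr_ge0 ?normal_pdf_ge0// exprn_ge0// addr_ge0.
  - apply: emeasurable_funM; first exact/measurable_EFinP.
    by apply/measurable_EFinP; exact: measurable_normal_pdf.
  - by apply: emeasurable_funM => //; apply/measurable_EFinP; exact: measurable_normal_pdf.
  - move=> v _; rewrite -!EFinM lee_fin !normal_pdfE// /K.
    rewrite [leRHS]mulrA divfK ?gt_eqF// mulrCA (mulrC (expR _)) -[leRHS]mulrA.
    apply: ler_wpM2l; first exact: normal_peak_ge0.
    have h1 : (1 + `|v|) ^+ n <= expR (n%:R * `|v|).
      by rewrite expRM_natl; apply: lerXn2r; rewrite ?nnegrE ?expR_ge0 ?addr_ge0//; exact: expR_ge1Dx.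
    apply: (le_trans (ler_wpM2r (normal_fun_ge0 _ _ _) h1)).
    rewrite /normal_fun -!expRD ler_expR !subr0 expr1n.
    have := sqr_ge0 (`|v| - 4 * n%:R); have := real_normK (num_real v).
    have := sqr_ge0 v; move: `|v| (n%:R : R) => w N; lra.
rewrite ge0_integralZl//; last 3 first.
- by apply/measurable_EFinP; exact: measurable_normal_pdf.
- by move=> v _; rewrite lee_fin normal_pdf_ge0.
- by rewrite lee_fin !mulr_ge0// ?expR_ge0 ?normal_peak_ge0// invr_ge0 ltW.
by rewrite integral_normal_pdf mule1 ltry.
Qed.

(** This probability is the [eps] to which Gross's condition is applied in [wiener_bounded]. *)
Lemma normal_prob_tail_gt0 :
  (0 < normal_prob (0 : R) 1 [set v | (1 < `|v|)%R])%E.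
Proof.
have mA : measurable ([set v | 1 < `|v|] : set (measurableTypeR R)).
  by apply: measurable_gt_fun.
apply: (@lt_le_trans _ _ (normal_prob (0 : R) 1 `]1, 2]%classic)); last first.
  apply: le_measure; rewrite ?inE//.
  by move=> v /=; rewrite in_itv/= => /andP[v1 _]; rewrite gtr0_norm// (lt_trans _ v1).
rewrite /normal_prob.
apply: (@lt_le_trans _ _ (\int[lebesgue_measure]_(x in `]1%R, 2%R]) (normal_pdf (0 : R) 1 2)%:E)%E).
  rewrite integral_cst//= lebesgue_measure_itv/= lte_fin ltr1n.
  rewrite -EFinB -EFinM lte_fin mulr_gt0//.
  by rewrite normal_pdfE// mulr_gt0 ?normal_peak_gt0// expR_gt0.
apply: ge0_le_integral => //=.
- by move=> x _; rewrite lee_fin normal_pdf_ge0.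
- by apply/measurable_EFinP; apply: measurable_funTS; exact: measurable_normal_pdf.
- move=> x; rewrite in_itv/= => /andP[x1 x2].
  rewrite lee_fin !normal_pdfE// ler_wpM2l ?normal_peak_ge0//.
  by rewrite /normal_fun ler_expR !subr0 expr1n; nra.
Qed.

End GaussMoments.

(** * Null sets of Gaussian measures under affine maps *)

Section Approximation.
Context d (T : measurableType d) (R : realType).
Variables (C : set (set T)).
Hypotheses (C0 : C set0) (CC : forall A, C A -> C (~` A))
  (CU : forall A B, C A -> C B -> C (A `|` B)) (Cm : C `<=` measurable).

Let C_bigsetU n (F : nat -> set T) : (forall i, C (F i)) ->
  C (\big[setU/set0]_(i < n) F i).
Proof.
by move=> CF; elim: n => [|n IH]; rewrite ?big_ord0// big_ord_recr/=; exact: CU.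
Qed.

(** The sets that members of [C] approximate in [ka] form a sigma-algebra: a countable union is
    truncated, by finiteness of [ka], and each of the finitely many sets left is replaced by a
    member of [C]. *)
Lemma algebra_approx (ka : {measure set T -> \bar R}) A : (ka setT < +oo)%E ->
  <<s C >> A -> measurable A /\ forall e : R, 0 < e ->
    exists2 B, C B & (ka (A `\` B) <= e%:E)%E /\ (ka (B `\` A) <= e%:E)%E.
Proof.
move=> kaT.
pose D := [set A | measurable A /\ forall e : R, 0 < e ->
    exists2 B, C B & (ka (A `\` B) <= e%:E)%E /\ (ka (B `\` A) <= e%:E)%E].
suff : <<s C >> `<=` D by apply.
apply: smallest_sub; last first.
  move=> B CB; split; first exact: Cm.
  by move=> e e0; exists B => //; rewrite setDv measure0 lee_fin ltW.
split.
- split => // e e0; exists set0 => //; rewrite setDv measure0 lee_fin ltW//.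
- move=> B [mB hB]; split; first exact: measurableD.
  move=> e e0; have [B' CB' [h1 h2]] := hB e e0.
  exists (~` B'); first exact: CC.
  rewrite setTD; split; [apply: le_trans _ h2|apply: le_trans _ h1].
    by rewrite !setDE setCK setIC.
  by rewrite !setDE setCK setIC.
- move=> F DF; have mF i : measurable (F i) := (DF i).1.
  have mU : measurable (\bigcup_i F i) by exact: bigcupT_measurable.
  split => // e e0; have e2 : 0 < e / 2 by rewrite divr_gt0.
  pose G n := \big[setU/set0]_(i < n) F i.
  have mG n : measurable (G n) by exact: bigsetU_measurable.
  have GU n : G n `<=` \bigcup_i F i.
    by rewrite /G -bigcup_mkord; apply: bigcup_sub => i _; exact: bigcup_sup.
  have [N hN] : exists N, (ka ((\bigcup_i F i) `\` G N) <= (e / 2)%:E)%E.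
    have mF' n : measurable ((\bigcup_i F i) `\` G n) by exact: measurableD.
    have cap0 : \bigcap_n ((\bigcup_i F i) `\` G n) = set0.
      apply/seteqP; split => // x h; have [[i _ Fix] _] := h 0%N Logic.I.
      have [_ []] := h i.+1 Logic.I; rewrite /G -bigcup_mkord; exists i => //=.
    have cG : ka ((\bigcup_i F i) `\` G n) @[n --> \oo] --> 0%E.
      rewrite -(measure0 ka) -cap0; apply: nonincreasing_cvg_mu => //.
      - by apply: le_lt_trans kaT; apply: le_measure; rewrite ?inE.
      - by rewrite cap0.
      - move=> n m nm; apply/subsetPset; apply: setDS; rewrite /G -!bigcup_mkord.
        by apply: bigcup_subset => i /= /leq_trans; exact.
    have hn : nbhs (0%E : \bar R) [set y | (y < (e / 2)%:E)%E].
      by apply: open_nbhs_nbhs; split; [exact: open_ereal_lt_ereal|rewrite /= lte_fin].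
    have [N _ hN] := cG _ hn.
    by exists N; apply: ltW; apply: hN => /=.
  (* [N] errors of size [e'] add up to at most [e / 2]; the successor keeps the denominator nonzero
     when [N = 0]. *)
  pose e' := e / (2 * N.+1%:R).
  have e'0 : 0 < e' by rewrite divr_gt0// mulr_gt0.
  have exB i : exists B, C B /\ ((ka (F i `\` B) <= e'%:E)%E /\ (ka (B `\` F i) <= e'%:E)%E).
    by have [B CB hB] := (DF i).2 e' e'0; exists B.
  have [B hB] := choice exB.
  have CB i : C (B i) by case: (hB i).
  have mB i : measurable (B i) by apply: Cm.
  have hB1 i : (ka (F i `\` B i) <= e'%:E)%E by case: (hB i) => _ [].
  have hB2 i : (ka (B i `\` F i) <= e'%:E)%E by case: (hB i) => _ [].
  pose H := \big[setU/set0]_(i < N) B i.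
  have mH : measurable H by exact: bigsetU_measurable.
  have sum_le (a : nat -> \bar R) : (forall i, (a i <= e'%:E)%E) ->
      (\sum_(i < N) a i <= (e / 2)%:E)%E.
    move=> ha; apply: (@le_trans _ _ (\sum_(i < N) e'%:E)%E).
      by apply: lee_sum => i _.
    rewrite sumEFin sumr_const card_ord lee_fin.
    rewrite (_ : e / 2 = e' *+ N.+1); last by rewrite -[RHS]mulr_natr /e' invfM mulrA mulfVK // pnatr_eq0.
    by rewrite mulrS lerDr ltW.
  exists H; first exact: C_bigsetU.
  split.
    apply: (@le_trans _ _ (ka (((\bigcup_i F i) `\` G N) `|`
                              \big[setU/set0]_(i < N) (F i `\` B i)))).
      apply: le_measure; rewrite ?inE//; first exact: measurableD.
        apply: measurableU; first exact: measurableD.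
        by apply: bigsetU_measurable => i _; exact: measurableD.
      move=> x [Ux nHx]; have [Gx|] := pselect (G N x); last by left.
      right; rewrite -(bigcup_mkord N (fun i => F i `\` B i)).
      move: Gx nHx; rewrite /G /H -!bigcup_mkord => -[i iN Fx] nHx.
      by exists i => //; split => // Bx; apply: nHx; exists i.
    apply: le_trans (measureU2 _ _ _) _; first exact: measurableD.
      by apply: bigsetU_measurable => i _; exact: measurableD.
    rewrite [e in (_ <= e%:E)%E](splitr e) EFinD; apply: leeD => //.
    apply: (le_trans (@le_mu_bigsetU _ _ _ ka (fun i => F i `\` B i) N _));
      first by move=> i _; exact: measurableD.
    exact: (sum_le (fun i => ka (F i `\` B i)) hB1).
  apply: (@le_trans _ _ (ka (\big[setU/set0]_(i < N) (B i `\` F i)))).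
    apply: le_measure; rewrite ?inE//; first exact: measurableD.
      by apply: bigsetU_measurable => i _; exact: measurableD.
    rewrite -(bigcup_mkord N (fun i => B i `\` F i)).
    move=> x []; rewrite /H -!bigcup_mkord => -[i iN Bx] nFx.
    by exists i => //; split => // Fx; apply: nFx; exists i.
  apply: (le_trans (@le_mu_bigsetU _ _ _ ka (fun i => B i `\` F i) N _));
      first by move=> i _; exact: measurableD.
  apply: (le_trans (sum_le (fun i => ka (B i `\` F i)) hB2)); rewrite lee_fin ler_pdivrMr//.
  by rewrite mulr_natr mulr2n lerDl ltW.
Qed.

(* The inequality is only needed on a generating algebra: such an algebra approximates a null set
   by its members of small measure. *)
Lemma null_of_algebra (mu nu : {measure set T -> \bar R}) (K : R) A :
  fin_num_fun mu -> fin_num_fun nu -> 0 <= K ->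
  (forall B (lam : R), C B -> 0 < lam ->
    (2%:E * nu B <= (K / lam)%:E + lam%:E * mu B)%E) ->
  <<s C >> A -> mu A = 0%E -> nu A = 0%E.
Proof.
move=> muf nuf K0 hK sA muA.
(* Approximation in the sum of the two measures gives one set [B] good for both, before any relation
   between their null sets is known. *)
pose ka : {measure set T -> \bar R} := measure_add mu nu.
have kaE B : ka B = (mu B + nu B)%E by exact: measure_addE.
have kaT : (ka setT < +oo)%E.
  by rewrite kaE lte_add_pinfty// ltey_eq ?muf ?nuf.
have [mA happ] := algebra_approx kaT sA.
have nuAf : nu A \is a fin_num by first [exact: nuf | exact: muf].
rewrite -(fineK nuAf); congr (_%:E); apply/eqP; rewrite eq_le fine_ge0// andbT.
apply/ler_addgt0Pl => e e0; rewrite addr0.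
(* With these values 2 nu(A) <= 2 nu(B) + 2 del <= K / lam + lam * del + 2 del <= 2e, since
   [K / lam <= e] and [(lam + 2) * del = e]. *)
pose lam := K / e + 1; have lam0 : 0 < lam by rewrite ltr_wpDl// divr_ge0// ltW.
pose del := e / (lam + 2).
have del0 : 0 < del by rewrite divr_gt0// addr_gt0.
have [B CB [h1 h2]] := happ del del0.
have mB := Cm CB.
have mD : measurable (A `\` B) by exact: measurableD.
have mD' : measurable (B `\` A) by exact: measurableD.
have nu1 : (nu (A `\` B) <= del%:E)%E.
  by apply: le_trans h1; rewrite /= kaE leeDr.
have mu2 : (mu (B `\` A) <= del%:E)%E.
  by apply: le_trans h2; rewrite /= kaE leeDl.
have muB : (mu B <= del%:E)%E.
  apply: (@le_trans _ _ (mu (A `|` (B `\` A)))).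
    apply: le_measure; rewrite ?inE//; first exact: measurableU.
    by move=> x Bx; have [Ax|nAx] := pselect (A x); [left|right].
  apply: (@le_trans _ _ (mu A + mu (B `\` A))%E); first exact: measureU2.
  by rewrite muA add0e.
have nuA : (nu A <= nu B + del%:E)%E.
  apply: (@le_trans _ _ (nu (B `|` (A `\` B)))).
    apply: le_measure; rewrite ?inE//; first exact: measurableU.
    by move=> x Bx; have [Ax|nAx] := pselect (B x); [left|right].
  apply: (@le_trans _ _ (nu B + nu (A `\` B))%E); first exact: measureU2.
  exact: leeD2l.
have := hK B lam CB lam0.
have nuBf : nu B \is a fin_num by first [exact: nuf | exact: muf].
have muBf : mu B \is a fin_num by first [exact: nuf | exact: muf].
move: nuA muB; rewrite -(fineK nuAf) -(fineK nuBf) -(fineK muBf).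
rewrite -!EFinM -!EFinD !lee_fin /=.
move: (fine (nu A)) (fine (nu B)) (fine (mu B)) => a b m ha hm hb.
have hd : (lam + 2) * del = e by rewrite /del mulrC divfK// gt_eqF// addr_gt0.
have hKl : K / lam <= e.
  rewrite ler_pdivrMr// /lam mulrDr mulr1 mulrC divfK ?gt_eqF//.
  by rewrite lerDl ltW.
have : lam * m <= lam * del by rewrite ler_wpM2l// ltW.
nra.
Qed.
End Approximation.

Section BorelMaps.
Context (R : realType).

Lemma continuous_borel (S T : normedModType R) (f : S -> T) : continuous f ->
  measurable_fun [set: borel S] (f : borel S -> borel T).
Proof.
move=> cf; apply: (@measurability _ _ (borel S) (borel T) setT _ (@open T)) => //.
move=> _ [B oB <-]; rewrite setTI; apply: sub_sigma_algebra.
by move/continuousP : cf; exact.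
Qed.

Lemma continuous_borel_real (S : normedModType R) (f : S -> R) : continuous f ->
  measurable_fun [set: borel S] (f : borel S -> R).
Proof.
move=> cf; apply: (@measurability _ _ (borel S) R setT _ (@RGenCInfty.G R)).
  exact: RGenCInfty.measurableE.
move=> _ [B [x ->] <-]; rewrite setTI -[X in measurable X]setCK.
apply: measurableC; apply: sub_sigma_algebra; rewrite preimage_setC.
move/continuousP : cf; apply; apply: closed_openC; exact: interval_closed.
Qed.

Lemma scalar_of_fun (W : normedModType R) (f : W -> R) : linear_for *%R f ->
  exists g : {scalar W}, forall x, g x = f x.
Proof.
move=> lf; pose fL := GRing.isLinear.Build R W R *%R f lf.
by pose g : {scalar W} := HB.pack f fL; exists g.
Qed.

Lemma continuous_sum (T : topologicalType) (I : Type) (r : seq I) (F : I -> T -> R) :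
  (forall i, continuous (F i)) -> continuous (fun x => \sum_(i <- r) F i x).
Proof.
move=> cF; elim: r => [|i r IH] x.
  by under eq_fun do rewrite big_nil; exact: cvg_cst.
under eq_fun do rewrite big_cons.
by apply: cvgD; [exact: cF|exact: IH].
Qed.

End BorelMaps.

(** * Cylinder sets and quasi-invariance of Gaussian measures *)

Section Cylinders.
Context (R : realType) (V W : normedModType R).
Variables (ip : V -> V -> R) (iot : V -> W).
Hypotheses (ipP : inner_product ip) (iotd : dense (range iot)).

(** The form vanishes on the dense range of [iot]; hence an element of [V] determines the form that
    it represents. *)
Lemma dual_elt0 (f : {scalar W}) : dual_elt ip iot f 0 -> forall x, f x = 0.
Proof.
move=> [fc f0] x; apply/eqP; apply: contraT => fx.
have [] := iotd (O := f @^-1` (~` [set 0])).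
- by exists x => /= /eqP; rewrite (negbTE fx).
- by move/continuousP : fc; apply; apply: closed_openC; exact: closed_eq.
by move=> y [/= fy [v _ vy]]; exfalso; apply: fy; rewrite -vy f0 ip0l.
Qed.

Definition dual_orthonormal n (y : 'I_n -> {scalar W}) (a : 'I_n -> V) :=
  (forall i, dual_elt ip iot (y i) (a i)) /\ orthonormal_family ip a.

Definition in_dual_span n (y : 'I_n -> {scalar W}) (f : {scalar W}) :=
  exists c : 'I_n -> R, forall x, f x = \sum_(i < n) c i * y i x.

Lemma in_dual_span_trans n p (y : 'I_n -> {scalar W}) (z : 'I_p -> {scalar W}) f :
  (forall i, in_dual_span z (y i)) -> in_dual_span y f -> in_dual_span z f.
Proof.
move=> /choice[c hc] [d hd]; exists (fun j => \sum_(i < n) d i * c i j) => x.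
rewrite hd; under eq_bigr do rewrite hc mulr_sumr.
rewrite exchange_big; apply: eq_bigr => j _ /=.
by rewrite mulr_suml; apply: eq_bigr => i _; rewrite mulrA.
Qed.

Lemma in_dual_span_id n (y : 'I_n -> {scalar W}) i : in_dual_span y (y i).
Proof.
exists (fun j => (j == i)%:R) => x.
rewrite (bigD1 i)//= eqxx mul1r big1 ?addr0// => j ji.
by rewrite (negbTE ji) mul0r.
Qed.

(** [gaussian_measure] speaks of orthonormal families only, so arbitrary continuous forms must be
    expressed through such families. If the residual of [b] vanishes, density of the range puts [g]
    in the span on all of [W], not merely on the image of [V]. *)
Lemma gram_schmidt_step n (y : 'I_n -> {scalar W}) (a : 'I_n -> V) g b :
  dual_orthonormal y a -> dual_elt ip iot g b ->
  exists p (z : 'I_p -> {scalar W}) a', [/\ dual_orthonormal z a',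
    forall i, in_dual_span z (y i) & in_dual_span z g].
Proof.
move=> [da oa] [gc gb].
pose r := b - \sum_(i < n) ip b (a i) *: a i.
pose c := (hnorm ip r)^-1.
have [|h hE] := @scalar_of_fun _ W (fun x => c * (g x - \sum_(i < n) ip b (a i) * y i x)).
  move=> t u v; rewrite linearP; under eq_bigr do rewrite linearP mulrDr mulrCA.
  by rewrite big_split /= -mulr_sumr; ring.
have hc : continuous (h : W -> R).
  rewrite (_ : (h : W -> R) = fun x => c * (g x - \sum_(i < n) ip b (a i) * y i x)); last first.
    exact/funext.
  move=> x; apply: cvgM; first exact: cvg_cst.
  apply: cvgB; first exact: gc.
  apply: (@continuous_sum R W 'I_n) => i u'; apply: cvgM; first exact: cvg_cst.
  exact: (da i).1.
have hd : dual_elt ip iot h (c *: r).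
  split => // x; rewrite hE gb (ipZl ipP) /r (ipDl ipP) (ipNl ipP) (ip_suml ipP).
  congr (_ * (_ - _)); apply: eq_bigr => i _.
  by rewrite (da i).2 (ipZl ipP).
have [r0|r0] := eqVneq (hnorm ip r) 0.
  exists n, y, a; split => //; first exact: in_dual_span_id.
  exists (fun i => ip b (a i)) => x.
  (* [c] is the inverse of 0 here, so the residual form is rebuilt without the normalising
     factor. *)
  have [|k kE] := @scalar_of_fun _ W (fun x => (g x - \sum_(i < n) ip b (a i) * y i x)).
    move=> t u v; rewrite linearP; under eq_bigr do rewrite linearP mulrDr mulrCA.
    by rewrite big_split /= -mulr_sumr; ring.
  have kc : continuous (k : W -> R).
    rewrite (_ : (k : W -> R) = fun x => (g x - \sum_(i < n) ip b (a i) * y i x)); last first.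
      exact/funext.
    move=> u; apply: cvgB; first exact: gc.
    apply: (@continuous_sum R W 'I_n) => i u'; apply: cvgM; first exact: cvg_cst.
    exact: (da i).1.
  have kd : dual_elt ip iot k 0.
    split => // u; rewrite -(hnorm_eq0 ipP r0) kE gb /r (ipDl ipP) (ipNl ipP) (ip_suml ipP).
    congr (_ - _); apply: eq_bigr => i _.
    by rewrite (da i).2 (ipZl ipP).
  by have := dual_elt0 kd x; rewrite kE => /eqP; rewrite subr_eq0 => /eqP.
pose ext (T : Type) (u : 'I_n -> T) (v : T) (i : 'I_n.+1) :=
  if unlift ord0 i is Some j then u j else v.
have ext0 T u v : @ext T u v ord0 = v by rewrite /ext unlift_none.
have extS T u v j : @ext T u v (lift ord0 j) = u j by rewrite /ext liftK.
exists n.+1, (ext _ y h), (ext _ a (c *: r)); split.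
- split.
    by move=> i; have [j ->|->] := unliftP ord0 i; rewrite ?ext0 ?extS.
  have orth j : ip (c *: r) (a j) = 0 by rewrite (ipZl ipP) ip_residual// mulr0.
  move=> i j; have [i' ->|->] := unliftP ord0 i; have [j' ->|->] := unliftP ord0 j;
    rewrite ?ext0 ?extS.
  + by rewrite oa (inj_eq lift_inj).
  + by rewrite (ipC ipP) orth eq_sym (negbTE (neq_lift _ _)).
  + by rewrite orth (negbTE (neq_lift _ _)).
  + by rewrite eqxx (ipZl ipP) (ipZr ipP) -(hnormE ipP) /c mulrA -expr2 -exprMn mulVf// expr1n.
- by move=> i; rewrite -(extS _ y h); exact: in_dual_span_id.
- exists (ext _ (fun i => ip b (a i)) (hnorm ip r)) => x.
  rewrite big_ord_recl !ext0 hE /c mulrA divff// mul1r.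
  under [X in _ + X]eq_bigr do rewrite !extS.
  by rewrite subrK.
Qed.

Lemma gram_schmidt n (y : 'I_n -> {scalar W}) (a : 'I_n -> V) k
    (f : 'I_k -> {scalar W}) :
  dual_orthonormal y a -> (forall j, exists b, dual_elt ip iot (f j) b) ->
  exists p (z : 'I_p -> {scalar W}) a', [/\ dual_orthonormal z a',
    forall i, in_dual_span z (y i) & forall j, in_dual_span z (f j)].
Proof.
elim: k f => [|k IH] f dy df.
  exists n, y, a; split => //; first exact: in_dual_span_id.
  by case.
have [p [z [a' [dz zy zf]]]] := IH (fun j => f (lift ord0 j)) dy (fun j => df _).
have [b fb] := df ord0.
have [q [u [a'' [du uz uf]]]] := gram_schmidt_step dz fb.
exists q, u, a''; split => //.
  by move=> i; exact: in_dual_span_trans (zy i).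
move=> j; have [j' ->|->//] := unliftP ord0 j.
exact: in_dual_span_trans (zf j').
Qed.

Definition cylinders : set (set W) := [set C |
  exists n (y : 'I_n -> {scalar W}) (a : 'I_n -> V) (A : set (n.-tuple R)),
    [/\ dual_orthonormal y a, measurable A & C = [set x | A [tuple y i x | i < n]]]].

Lemma cylinder_change n (y : 'I_n -> {scalar W}) p (z : 'I_p -> {scalar W})
    (A : set (n.-tuple R)) : measurable A -> (forall i, in_dual_span z (y i)) ->
  exists2 A' : set (p.-tuple R), measurable A' &
    [set x | A [tuple y i x | i < n]] = [set x | A' [tuple z i x | i < p]].
Proof.
move=> mA /choice[c hc].
pose L (t : p.-tuple R) := [tuple \sum_(j < p) c i j * tnth t j | i < n].
have mL : measurable_fun [set: p.-tuple R] L.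
  apply/measurable_fun_tnthP => i.
  rewrite (_ : _ \o _ = fun t => \sum_(j < p) c i j * tnth t j); last first.
    by apply/funext => t /=; rewrite tnth_mktuple.
  apply: measurable_sum => j; apply: measurable_funM => //; exact: measurable_tnth.
exists (L @^-1` A); first by rewrite -[X in measurable X]setTI; exact: mL.
apply/seteqP; split => x /=; congr A; apply: eq_from_tnth => i;
  rewrite !tnth_mktuple hc; apply: eq_bigr => j _; by rewrite tnth_mktuple.
Qed.

Lemma cylinders0 : cylinders set0.
Proof.
have [|f fE] := @scalar_of_fun _ W (fun=> 0).
  by move=> t u v; rewrite mulr0 addr0.
exists 0%N, (fun=> f), (fun=> 0), set0; split => //.
by split => [[]|[]//].
Qed.

Lemma cylindersC C : cylinders C -> cylinders (~` C).
Proof.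
move=> [n [y [a [A [dy mA ->]]]]]; exists n, y, a, (~` A); split => //.
exact: measurableC.
Qed.

(** Both cylinders are first rewritten over one orthonormal family whose span contains the two given
    ones. *)
Lemma cylindersU C D : cylinders C -> cylinders D -> cylinders (C `|` D).
Proof.
move=> [n [y [a [A [dy mA ->]]]]] [n' [y' [a' [A' [dy' mA' ->]]]]].
have [p [z [b [dz zy zy']]]] := gram_schmidt dy (fun j => ex_intro _ (a' j) (dy'.1 j)).
have [A1 mA1 ->] := cylinder_change mA zy.
have [A2 mA2 ->] := cylinder_change mA' zy'.
by exists p, z, b, (A1 `|` A2); split => //; exact: measurableU.
Qed.

Lemma measurable_cylinders : cylinders `<=` (@measurable _ (borel W)).
Proof.
move=> _ [n [y [a [A [dy mA ->]]]]].
have : measurable_fun [set: borel W] (fun x : borel W => [tuple y i x | i < n]).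
  apply/measurable_fun_tnthP => i.
  rewrite (_ : _ \o _ = y i); last by apply/funext => x /=; rewrite tnth_mktuple.
  exact: continuous_borel_real (dy.1 i).1.
by move=> my; rewrite -[X in measurable X]setTI; exact: my.
Qed.

Hypothesis dualW : forall f : {scalar W}, continuous (f : W -> R) ->
  exists a, dual_elt ip iot f a.

Lemma halfspaces_cylinders : @halfspaces R W `<=` cylinders.
Proof.
move=> _ [f fc [a0 ->]]; have [b fb] := dualW fc.
have d0 : @dual_orthonormal 0 (fun=> f) (fun=> b) by split => [[]|[]//].
have [p [z [a [dz _ zf]]]] := gram_schmidt (f := fun _ : 'I_1 => f) d0 (fun=> ex_intro _ b fb).
have mA : measurable [set t : 1.-tuple R | tnth t ord0 <= a0].
  have := @measurable_tnth _ R 1 ord0 measurableT `]-oo, a0]%classic (measurable_itv _).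
  rewrite setTI (_ : _ @^-1` _ = [set t : 1.-tuple R | tnth t ord0 <= a0])//.
have [A' mA' E] := cylinder_change mA zf.
exists p, z, a, A'; split => //; rewrite -E.
by apply/seteqP; split => x /=; rewrite tnth_mktuple.
Qed.

Hypothesis genW : @open W `<=` <<s @halfspaces R W >>.

Lemma borel_cylinders A : @measurable _ (borel W) A -> <<s cylinders >> A.
Proof.
apply: smallest_sub; first exact: smallest_sigma_algebra.
apply: (subset_trans genW); apply: sub_smallest2r.
  exact: smallest_sigma_algebra.
exact: halfspaces_cylinders.
Qed.

Variable mu : R -> probability (borel W) R.
Hypothesis gmu : forall t : R, 0 < t -> gaussian_measure ip iot t (mu t).

(* The Cameron-Martin theorem (s = 1) and the scaling of Gaussian measures. *)
Lemma gaussian_affine_null (t s : R) (X : V) (A : set (borel W)) :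
  0 < t -> 0 < s -> measurable A -> mu (s ^+ 2 * t) A = 0%E ->
  mu t [set Y : borel W | A (iot X + s *: (Y : W))] = 0%E.
Proof.
move=> t0 s0 mA muA.
have s2t : 0 < s ^+ 2 * t by rewrite mulr_gt0// exprn_gt0.
pose Phi (Y : borel W) : borel W := iot X + s *: (Y : W).
have mPhi : measurable_fun [set: borel W] Phi.
  apply: (@continuous_borel R W W Phi) => Y.
  by apply: cvgD; [exact: cvg_cst|apply: cvgZ; [exact: cvg_cst|exact: cvg_id]].
have [nu nuE _] := image_measure (mu t) mPhi.
have nufin : fin_num_fun nu.
  move=> B mB; rewrite nuE; apply: fin_num_measure.
  by rewrite -[X in measurable X]setTI; exact: mPhi.
have <- : nu A = mu t [set Y : borel W | A (iot X + s *: (Y : W))] by exact: nuE.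
(* By Bessel's inequality the squared coordinates of [X] along any orthonormal family sum to at most
   |X|^2, so this one [K] serves all cylinders. *)
pose K := expR (hnorm ip X ^+ 2 / (s * Num.sqrt t) ^+ 2).
apply: (@null_of_algebra _ (borel W) R cylinders
  cylinders0 cylindersC cylindersU measurable_cylinders (mu (s ^+ 2 * t)) nu K A) => //.
- exact: expR_ge0.
- move=> _ lam [n [y [a [D [dy mD ->]]]]] lam0.
  have sq : Num.sqrt (s ^+ 2 * t) = s * Num.sqrt t.
    by rewrite sqrtrM ?sqr_ge0// sqrtr_sqr gtr0_norm.
  have E1 : mu (s ^+ 2 * t) [set x | D [tuple y i x | i < n]] = gauss_tuple (s * Num.sqrt t) D.
    by rewrite -sq; apply: gmu => //; [exact: dy.1|exact: dy.2].
  pose c i := ip (a i) X.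
  have E2 : nu [set x | D [tuple y i x | i < n]] =
      gauss_tuple (Num.sqrt t) [set u | D [tuple c i + s * tnth u i | i < n]].
    rewrite -(gmu t0 dy.1 dy.2) /=; last first.
      have : measurable_fun [set: n.-tuple R] (fun u => [tuple c i + s * tnth u i | i < n]).
        apply/measurable_fun_tnthP => i.
        rewrite (_ : _ \o _ = fun u => c i + s * tnth u i); last first.
          by apply/funext => u /=; rewrite tnth_mktuple.
        apply: measurable_funD => //; apply: measurable_funM => //.
        exact: measurable_tnth.
      by move=> mc; rewrite -[X in measurable X]setTI; exact: mc.
    rewrite nuE; congr (mu t _); apply/seteqP; split => Y /=; congr D; apply: eq_from_tnth => i;
    by rewrite !tnth_mktuple linearD linearZ /= (dy.1 i).2.
  rewrite [X in (2%:E * X)%E]E2.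
  apply: (@le_trans _ _ ((K / lam)%:E + lam%:E * gauss_tuple (s * Num.sqrt t) D)%E); last by apply: leeD => //; rewrite -E1.
  apply: (le_trans (gauss_tuple_shift c s0 _ lam0 mD)); first by rewrite sqrtr_gt0.
  apply: leeD => //; rewrite lee_fin; apply: ler_wpM2r; first by rewrite invr_ge0 ltW.
  rewrite ler_expR.
  rewrite ler_wpM2r ?invr_ge0 ?sqr_ge0// (hnormE ipP).
  under eq_bigr do rewrite /c (ipC ipP).
  exact: (bessel ipP dy.2).
- exact: borel_cylinders.
Qed.

End Cylinders.

Section DenseProduct.
Context (T U : topologicalType).

Lemma dense_setX (A : set T) (B : set U) : dense A -> dense B -> dense (A `*` B).
Proof.
move=> dA dB O [[x y] Oxy] Oo.
have : nbhs (x, y) O by exact: open_nbhs_nbhs.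
case=> -[P Q] [/= Px Qy] PQ.
have [a [Pa Aa]] := dA P^° (ex_intro _ x Px) (@open_interior _ P).
have [b [Qb Bb]] := dB Q^° (ex_intro _ y Qy) (@open_interior _ Q).
by exists (a, b); split => //; apply: PQ; split; exact: interior_subset.
Qed.

End DenseProduct.

(** * Continuity of the inclusion, separability and duality in a Wiener space *)

Section WienerSpace.
Context (R : realType) (H B : completeNormedModType R).
Variables (dot : {dot H for idfun}) (iota : {linear H -> B}).
Hypothesis hW : wiener_space dot iota.

Let dP := dot_inner_product dot.
Let nE : forall x : H, `|x| = hnorm dot x. Proof. by have [] := hW. Qed.

(** Gross's condition tested on lines. If a unit vector [w] orthogonal to the exceptional subspace
    had |iota w| > p, the Gaussian measure of the [v] with |v| |iota w| > p would be at least that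
    of |v| > 1, which is [p] itself, against the strict bound. On the exceptional subspace, of
    finite dimension, coordinates give the bound. *)
Lemma wiener_bounded : exists C, forall x, `|iota x| <= C * `|x|.
Proof.
have [_ _ _ _ mn] := hW.
pose p := fine (normal_prob (0 : R) 1 [set v | 1 < `|v|]).
have mtail : measurable ([set v | 1 < `|v|] : set (measurableTypeR R)).
  by apply: measurable_gt_fun.
have pE : p%:E = normal_prob (0 : R) 1 [set v | 1 < `|v|].
  by rewrite fineK// fin_num_measure.
have p0 : 0 < p by rewrite -lte_fin pE normal_prob_tail_gt0.
have [n [w0 [ow h]]] := mn p p0.
have unit_le w : (forall j, dot w (w0 j) = 0) -> dot w w = 1 -> `|iota w| <= p.
  move=> wo w1; rewrite leNgt; apply/negP => pw.
  have ow1 : orthonormal_family dot (fun _ : 'I_1 => w) by move=> i j; rewrite !ord1 eqxx.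
  have := h 1%N (fun=> w) ow1 (fun _ j => wo j).
  rewrite (_ : [set v | _] = [set v : 1.-tuple R | p < `|tnth v ord0| * `|iota w|]); last first.
    by apply/seteqP; split => v /=; rewrite big_ord1 linearZ normrZ.
  rewrite gauss_tuple1; last first.
    apply: measurable_gt_fun; apply: measurable_funM => //.
    by apply: measurableT_comp => //; exact: measurable_tnth.
  rewrite pE ltNge => /negP; apply.
  apply: le_measure; rewrite ?inE//.
    apply: measurable_gt_fun; apply: measurable_funM => //.
    rewrite (_ : (fun x => _) = (fun u : R => `|u|)); last by apply/funext.
    exact: measurableT_comp.
  by move=> v /= v1; rewrite (tnth_nth 0) /= (lt_le_trans pw)// ler_peMl// ltW.
exists (\sum_(i < n) `|iota (w0 i)| + p) => x.
pose s := \sum_(i < n) dot x (w0 i) *: w0 i.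
rewrite -{1}(subrK s x) linearD mulrDl addrC.
apply: (le_trans (ler_normD _ _)); apply: lerD.
  rewrite linear_sum /= mulr_suml.
  apply: (le_trans (ler_norm_sum _ _ _)); apply: ler_sum => i _.
  rewrite linearZ normrZ mulrC ler_wpM2l// nE.
  by apply: (ip_abs_le dP); rewrite ow eqxx.
pose r := x - s; rewrite -/r.
have rx : `|r| <= `|x|.
  rewrite !nE -(@ler_pXn2r _ 2) ?nnegrE ?hnorm_ge0// !(hnormE dP).
  rewrite [leRHS](ip_split dP ow) lerDr; apply: sumr_ge0 => i _; exact: sqr_ge0.
have [->|r0] := eqVneq r 0; first by rewrite linear0 normr0 mulr_ge0// ltW.
apply: (@le_trans _ _ (p * `|r|)); last by rewrite ler_wpM2l// ltW.
have nr0 : 0 < `|r| by rewrite normr_gt0.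
rewrite -ler_pdivrMr// mulrC.
have <- : `|iota (`|r|^-1 *: r)| = `|r|^-1 * `|iota r|.
  by rewrite linearZ normrZ normfV normr_id.
apply: unit_le; first by move=> j; rewrite (ipZl dP) (ip_residual dP ow) mulr0.
rewrite (ipZl dP) (ipZr dP) -(hnormE dP) -nE mulrA -expr2 -exprMn mulVf ?expr1n//.
by rewrite gt_eqF.
Qed.

Lemma wiener_continuous : continuous iota.
Proof.
have [C hC] := wiener_bounded.
apply/linear_bounded_continuous/linear_boundedP; near=> M => x.
apply: (le_trans (hC x)); rewrite ler_wpM2r//.
Unshelve. all: by end_near. Qed.

Lemma wiener2_dense : dense (range (iota2 iota)).
Proof.
have [_ _ _ [_ di] _] := hW.
have -> : range (iota2 iota) = range iota `*` range iota.
  apply/seteqP; split => [_ [x _ <-]|[a b] /= [[x _ <-] [y _ <-]]].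
    by split; [exists x.1|exists x.2].
  by exists (x, y).
exact: dense_setX.
Qed.

Lemma wiener2_dense_seq : exists d : nat -> (B * B)%type, dense (range d).
Proof.
have [_ [D Dc Dd] _ [_ di] _] := hW.
have dD : dense (iota @` D).
  move=> O [y Oy] Oo; have [b [Ob [x _ xb]]] := di O (ex_intro _ y Oy) Oo.
  have Ox : O (iota x) by rewrite xb.
  have Oi : open (iota @^-1` O) by move/continuousP : wiener_continuous; exact.
  have [z [Oz Dz]] := Dd _ (ex_intro _ x Ox) Oi.
  by exists (iota z); split => //; exists z.
apply: (@dense_seq R (B * B)%type ((iota @` D) `*` (iota @` D))).
  by apply: countableX; apply: (sub_countable (card_image_le _ _)).
exact: dense_setX.
Qed.

(** [riesz] requires the norm to come from the scalar product, which fails for the norm of H * H; it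
    is applied to the restriction of [f] to each factor. *)
Lemma wiener2_dual (f : {scalar (B * B)%type}) : continuous (f : (B * B)%type -> R) ->
  exists a, dual_elt (ip2 dot) (iota2 iota) f a.
Proof.
move=> fc.
have half (g : H -> (B * B)%type) : linear g -> continuous g ->
    exists a, forall x, f (g x) = dot a x.
  move=> gl gc; have [|k kE] := @scalar_of_fun R H (f \o g).
    by move=> t u v; rewrite /= gl linearP.
  have [|a ha] := riesz nE (g := k).
    rewrite (_ : (k : H -> R) = f \o g); last exact/funext.
    by move=> x; apply: continuous_comp; [exact: gc|exact: fc].
  by exists a => x; rewrite -ha kE.
have [||a1 h1] := half (fun x => (iota x, 0)).
- by move=> t u v; rewrite linearP; congr (_, _); rewrite /= scaler0 addr0.
- by move=> x; apply: cvg_pair; [exact: wiener_continuous|exact: cvg_cst].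
have [||a2 h2] := half (fun x => (0, iota x)).
- by move=> t u v; rewrite linearP; congr (_, _); rewrite /= scaler0 addr0.
- by move=> x; apply: cvg_pair; [exact: cvg_cst|exact: wiener_continuous].
exists (a1, a2); split => // x; rewrite (ipC (ip2_inner_product dot)) /ip2 /=.
rewrite (ipC dP x.1) (ipC dP x.2) -h1 -h2 -linearD /iota2; congr (f (_, _)) => /=.
  by rewrite addr0.
by rewrite add0r.
Qed.

End WienerSpace.

(** * Unordered sums *)

Section ComplexModulus.
Context (R : realType).
Implicit Types z : R[i].

Lemma cmod_ge0 z : 0 <= cmod z.
Proof. by case: z => a b; exact: sqrtr_ge0. Qed.

Lemma cmodD z z' : cmod (z + z') <= cmod z + cmod z'.
Proof. exact: (@le_normcD R z z'). Qed.

Lemma cmodN z : cmod (- z) = cmod z.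
Proof. exact: (@normcN R z). Qed.

Lemma Re_le_cmod z : `|cRe z| <= cmod z.
Proof.
by case: z => a b /=; rewrite -sqrtr_sqr ler_wsqrtr// lerDl sqr_ge0.
Qed.

Lemma Im_le_cmod z : `|cIm z| <= cmod z.
Proof.
by case: z => a b /=; rewrite -sqrtr_sqr ler_wsqrtr// lerDr sqr_ge0.
Qed.

Lemma cmod_le_ReIm z : cmod z <= `|cRe z| + `|cIm z|.
Proof.
case: z => a b /=; rewrite -(@ler_pXn2r _ 2) ?nnegrE ?sqrtr_ge0 ?addr_ge0//.
rewrite sqr_sqrtr ?addr_ge0 ?sqr_ge0// -(real_normK (num_real a)) -(real_normK (num_real b)).
by rewrite sqrrD lerD2r lerDl mulrn_wge0// mulr_ge0.
Qed.

Lemma Re_sum (I : Type) (s : seq I) (f : I -> R[i]) :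
  cRe (\sum_(i <- s) f i) = \sum_(i <- s) cRe (f i).
Proof.
elim: s => [|i s IH]; rewrite ?big_nil// !big_cons -IH.
by case: (f i) (\sum_(j <- s) f j) => [a b] [c d].
Qed.

Lemma Im_sum (I : Type) (s : seq I) (f : I -> R[i]) :
  cIm (\sum_(i <- s) f i) = \sum_(i <- s) cIm (f i).
Proof.
elim: s => [|i s IH]; rewrite ?big_nil// !big_cons -IH.
by case: (f i) (\sum_(j <- s) f j) => [a b] [c d].
Qed.

Lemma ReB z z' : cRe (z - z') = cRe z - cRe z'.
Proof. by case: z z' => [a b] [c d]. Qed.

Lemma ImB z z' : cIm (z - z') = cIm z - cIm z'.
Proof. by case: z z' => [a b] [c d]. Qed.

Lemma cmod_real (a : R) : 0 <= a -> cmod (a%:C)%C = a.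
Proof. by move=> a0; rewrite /= expr0n addr0 sqrtr_sqr ger0_norm. Qed.

Lemma cmod_sum_le (I : Type) (s : seq I) (f : I -> R[i]) :
  cmod (\sum_(i <- s) f i) <= \sum_(i <- s) cmod (f i).
Proof.
elim: s => [|i s IH]; rewrite ?big_nil ?big_cons ?ComplexField.Normc.normc0//.
by apply: (le_trans (cmodD _ _)); rewrite lerD2l.
Qed.

End ComplexModulus.

Section UnorderedSums.
Context (R : realType) (I : countType).
Implicit Types (f : I -> R[i]) (g : I -> R) (A : {fset I}).

Definition has_rsum g (l : R) := forall eps : R, 0 < eps ->
  exists A, forall A', (A `<=` A')%fset -> `|\sum_(i <- A') g i - l| < eps.

Lemma fset_sum_le g A A' : (forall i, 0 <= g i) -> (A `<=` A')%fset ->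
  \sum_(i <- A) g i <= \sum_(i <- A') g i.
Proof.
move=> g0 AA'; rewrite [leRHS](big_fsetID _ (mem A))/= -[leLHS]addr0; apply: lerD.
  rewrite le_eqVlt; apply/orP; left; apply/eqP; apply: eq_fbigl => i.
  by rewrite !inE /=; apply/idP/idP => [iA|/andP[]//]; rewrite iA (fsubsetP AA').
by apply: sumr_ge0.
Qed.

Lemma fset_sumU g A C : [disjoint C & A]%fset ->
  \sum_(i <- (A `|` C)%fset) g i = \sum_(i <- A) g i + \sum_(i <- C) g i.
Proof.
move=> /fdisjointP CA; rewrite (big_fsetID _ (mem A))/=; congr (_ + _);
  apply: eq_fbigl => i; rewrite !inE /=.
  by case: (i \in A); rewrite ?andbT ?andbF.
by have := CA i; case: (i \in C) => [/(_ isT) /negbTE ->|_]; rewrite ?orbF ?andbN.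
Qed.

Lemma has_rsum_ge0 g K : (forall i, 0 <= g i) -> (forall A, \sum_(i <- A) g i <= K) ->
  exists l, has_rsum g l.
Proof.
move=> g0 gK; pose S := range (fun A => \sum_(i <- A) g i).
have hS : has_sup S.
  by split; [exists (\sum_(i <- fset0) g i); exists fset0|exists K => _ [A _ <-]].
exists (sup S) => e e0.
have [_ [A _ <-] hA] := sup_adherent e0 hS.
exists A => A' AA'.
have h1 : \sum_(i <- A') g i <= sup S by apply: ub_le_sup; [exact: hS.2|exists A'].
by have h2 := fset_sum_le g0 AA'; rewrite ler0_norm ?subr_le0//; lra.
Qed.

Lemma has_rsumB g g' l l' : has_rsum g l -> has_rsum g' l' ->
  has_rsum (fun i => g i - g' i) (l - l').
Proof.
move=> h h' e e0; have e2 : 0 < e / 2 by rewrite divr_gt0.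
have [A hA] := h _ e2; have [A' hA'] := h' _ e2.
exists (A `|` A')%fset => C AC.
have := hA C (fsubset_trans (fsubsetUl _ _) AC).
have := hA' C (fsubset_trans (fsubsetUr _ _) AC).
rewrite sumrB; move: (\sum_(i <- C) g i) (\sum_(i <- C) g' i) => a b h1 h2.
rewrite (_ : _ - _ = (a - l) - (b - l')); last by ring.
by apply: (le_lt_trans (ler_normB _ _)); lra.
Qed.

(** [g] is the difference of the nonnegative families |g| and |g| - g, with finite sums bounded by
    [K] and [K + K]. *)
Lemma has_rsum_abs g K : (forall A, \sum_(i <- A) `|g i| <= K) ->
  exists l, has_rsum g l.
Proof.
move=> gK; have [l1 h1] := has_rsum_ge0 (fun i => normr_ge0 (g i)) gK.
have [||l2 h2] := @has_rsum_ge0 (fun i => `|g i| - g i) (K + K).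
- by move=> i; rewrite subr_ge0 ler_norm.
- move=> A; apply: le_trans (lerD (gK A) (gK A)); rewrite -big_split /=.
  apply: ler_sum => i _; rewrite lerD2l -normrN; exact: ler_norm.
exists (l1 - l2); have := has_rsumB h1 h2.
by congr has_rsum; apply/funext => i; rewrite subKr.
Qed.

Definition abs_summable f := exists K : R, forall A, \sum_(i <- A) cmod (f i) <= K.

Lemma abs_summable_csum f : abs_summable f -> exists l, has_csum f l.
Proof.
move=> [K hK].
have [A|a ha] := @has_rsum_abs (fun i => cRe (f i)) K.
  by apply: le_trans (hK A); apply: ler_sum => i _; exact: Re_le_cmod.
have [A|b hb] := @has_rsum_abs (fun i => cIm (f i)) K.
  by apply: le_trans (hK A); apply: ler_sum => i _; exact: Im_le_cmod.
exists (Complex a b) => e e0; have e2 : 0 < e / 2 by rewrite divr_gt0.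
have [A hA] := ha _ e2; have [A' hA'] := hb _ e2.
exists (A `|` A')%fset => C AC.
have := hA C (fsubset_trans (fsubsetUl _ _) AC).
have := hA' C (fsubset_trans (fsubsetUr _ _) AC).
rewrite -Re_sum -Im_sum => h1 h2.
apply: (le_lt_trans (cmod_le_ReIm _)); rewrite ReB ImB /=; lra.
Qed.

(** By the Cauchy criterion a finite set disjoint from [A] has a partial sum of modulus below 2.
    Splitting it by sign bounds the absolute values of the real parts by 4, likewise of the
    imaginary parts, whence the 8. Summability thus becomes a condition on moduli alone. *)
Lemma has_csum_abs f l : has_csum f l -> abs_summable f.
Proof.
move=> h; have [A hA] := h 1 ltr01.
have small (h' : R[i] -> R) : (forall z, `|h' z| <= cmod z) ->
    (forall z z', h' (z - z') = h' z - h' z') ->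
    (forall (s : seq I), h' (\sum_(i <- s) f i) = \sum_(i <- s) h' (f i)) ->
    forall C, [disjoint C & A]%fset -> `|\sum_(i <- C) h' (f i)| <= 2.
  move=> hle hB hs C CA.
  have h1 := hA A (fsubset_refl _).
  have h2 := hA (A `|` C)%fset (fsubsetUl _ _).
  have E : \sum_(i <- (A `|` C)%fset) h' (f i) = \sum_(i <- A) h' (f i) + \sum_(i <- C) h' (f i).
    exact: fset_sumU.
  rewrite -!hs in E.
  have h3 := hle (\sum_(i <- A) f i - l).
  have h4 := hle (\sum_(i <- (A `|` C)%fset) f i - l).
  rewrite hB in h3; rewrite hB in h4; rewrite -hs.
  rewrite (_ : h' _ = (h' (\sum_(i <- (A `|` C)%fset) f i) - h' l) -
    (h' (\sum_(i <- A) f i) - h' l)); last by rewrite E; ring.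
  by apply: (le_trans (ler_normB _ _)); lra.
have small2 (g : I -> R) : (forall C, [disjoint C & A]%fset -> `|\sum_(i <- C) g i| <= 2) ->
    forall C, [disjoint C & A]%fset -> \sum_(i <- C) `|g i| <= 4.
  move=> hg C CA.
  pose C1 := [fset i in C | 0 <= g i]%fset; pose C2 := [fset i in C | ~~ (0 <= g i)]%fset.
  have C1A : [disjoint C1 & A]%fset.
    by apply: fdisjointWl CA; apply/fsubsetP => i; rewrite !inE => /andP[].
  have C2A : [disjoint C2 & A]%fset.
    by apply: fdisjointWl CA; apply/fsubsetP => i; rewrite !inE => /andP[].
  rewrite (big_fsetID _ (fun i => 0 <= g i))/=.
  have -> : \sum_(i <- C1) `|g i| = \sum_(i <- C1) g i.
    by apply: eq_big_seq => i; rewrite !inE => /andP[_ ?]; rewrite ger0_norm.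
  have -> : \sum_(i <- C2) `|g i| = - \sum_(i <- C2) g i.
    rewrite -sumrN; apply: eq_big_seq => i; rewrite !inE -ltNge => /andP[_ ?].
    by rewrite ltr0_norm.
  have := le_trans (ler_norm _) (hg _ C1A).
  have := hg _ C2A; rewrite -normrN => /(le_trans (ler_norm _)); lra.
exists (\sum_(i <- A) cmod (f i) + 8) => C.
apply: (@le_trans _ _ (\sum_(i <- (A `|` C `\` A)%fset) cmod (f i))).
  apply: fset_sum_le; first by move=> i; exact: cmod_ge0.
  by apply/fsubsetP => i; rewrite !inE => ->; case: (i \in A).
have dis : [disjoint C `\` A & A]%fset.
  by apply/fdisjointP => i; rewrite !inE => /andP[].
rewrite fset_sumU//.
rewrite lerD2l; apply: (@le_trans _ _ (\sum_(i <- (C `\` A)%fset) (`|cRe (f i)| + `|cIm (f i)|))).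
  by apply: ler_sum => i _; exact: cmod_le_ReIm.
rewrite big_split /=.
have := small2 _ (small _ (@Re_le_cmod R) (@ReB R) (fun s => Re_sum s f)) _ dis.
have := small2 _ (small _ (@Im_le_cmod R) (@ImB R) (fun s => Im_sum s f)) _ dis.
lra.
Qed.

Lemma has_csum_unique f l l' : has_csum f l -> has_csum f l' -> l = l'.
Proof.
move=> h h'; apply/eqP; rewrite -subr_eq0; apply/eqP.
apply: ComplexField.Normc.eq0_normc; apply/eqP; rewrite eq_le cmod_ge0 andbT.
apply/ler_addgt0Pl => e e0; rewrite addr0; have e2 : 0 < e / 2 by rewrite divr_gt0.
have [A hA] := h _ e2; have [A' hA'] := h' _ e2.
have := hA _ (fsubsetUl A A'); have := hA' _ (fsubsetUr A A').
move: (\sum_(i <- _) _) => s h1 h2.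
rewrite (_ : l - l' = - (s - l) + (s - l')); last by rewrite opprB addrA subrK.
by apply: (le_trans (cmodD _ _)); rewrite cmodN; lra.
Qed.

Lemma csumE f l : has_csum f l -> csum f = l.
Proof.
by move=> h; apply: (@has_csum_unique f) => //; exact: (xgetPex _ (ex_intro _ l h)).
Qed.

Lemma csum_default f : ~ abs_summable f -> csum f = 0.
Proof.
by move=> nf; apply: xgetPN => l h; apply: nf; exact: has_csum_abs h.
Qed.

(** An increasing sequence cofinal among the finite sets, which reduces the net of partial sums to a
    sequence. *)
Definition fset_lt n : {fset I} := [fset i in pmap (@pickle_inv I) (iota 0 n)]%fset.

Lemma mem_fset_lt n i : (choice.pickle i < n)%N -> i \in fset_lt n.
Proof.
move=> hi; rewrite !inE mem_pmap; apply/mapP; exists (choice.pickle i).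
  by rewrite mem_iota.
by rewrite pickleK_inv.
Qed.

Lemma fset_lt_homo n m : (n <= m)%N -> (fset_lt n `<=` fset_lt m)%fset.
Proof.
move=> nm; apply/fsubsetP => i; rewrite !inE !mem_pmap => /mapP[j jn ->].
apply/mapP; exists j => //; move: jn; rewrite !mem_iota !add0n /= => jn.
exact: leq_trans nm.
Qed.

Lemma fset_lt_sup A : exists n, (A `<=` fset_lt n)%fset.
Proof.
exists (\max_(i <- A) (choice.pickle i).+1); apply/fsubsetP => i iA.
by apply: mem_fset_lt; exact: (@leq_bigmax_seq I (enum_fset A) xpredT
  (fun i => (choice.pickle i).+1) i iA isT).
Qed.

Lemma csum_cvg f l : has_csum f l -> forall e : R, 0 < e ->
  \forall n \near \oo, cmod (\sum_(i <- fset_lt n) f i - l) < e.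
Proof.
move=> h e e0; have [A hA] := h e e0; have [N AN] := fset_lt_sup A.
exists N => // n /= Nn; apply: hA; exact: fsubset_trans AN (fset_lt_homo Nn).
Qed.

Lemma cmod_csum_le f l K : has_csum f l -> (forall n, \sum_(i <- fset_lt n) cmod (f i) <= K) ->
  cmod l <= K.
Proof.
move=> h hK; apply/ler_addgt0Pr => e e0; have [N _ /(_ N (leqnn N)) hN] := csum_cvg h e0.
rewrite (_ : l = \sum_(i <- fset_lt N) f i - (\sum_(i <- fset_lt N) f i - l)); last first.
  by rewrite opprB addrC subrK.
apply: (le_trans (cmodD _ _)); rewrite cmodN; apply: lerD.
  exact: le_trans (cmod_sum_le _ _) (hK N).
exact: ltW.
Qed.

(** An integer bound and a sequence of partial sums make summability a countable condition, hence a
    measurable one when [f] depends on a parameter. *)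
Lemma abs_summableP f : abs_summable f <->
  exists K : nat, forall n, \sum_(i <- fset_lt n) cmod (f i) <= K%:R.
Proof.
split=> [[K hK]|[K hK]].
  exists (Num.bound `|K|) => n; apply: (le_trans (hK _)); apply: (le_trans (ler_norm _)).
  exact/ltW/archi_boundP/normr_ge0.
exists K%:R => A; have [n An] := fset_lt_sup A; apply: le_trans (hK n).
by apply: fset_sum_le => // i; exact: cmod_ge0.
Qed.

End UnorderedSums.

Section UnorderedSumsL1.
Context (R : realType) (I : countType) d (T : measurableType d).

Lemma measurable_cmod (f : T -> R[i]) : cmeasurable f ->
  measurable_fun [set: T] (fun x => cmod (f x)).
Proof.
move=> [mr mi].
rewrite (_ : (fun x => cmod (f x)) = (fun x => Num.sqrt ((cRe \o f) x ^+ 2 + (cIm \o f) x ^+ 2))).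
  apply: (measurableT_comp (continuous_measurable_fun (@sqrt_continuous R))).
  by apply: measurable_funD; exact: measurable_funX.
by apply/funext => x /=; case: (f x).
Qed.

Variable f : I -> T -> R[i].
Hypothesis mf : forall i, cmeasurable (f i).

Let S n x := \sum_(i <- fset_lt I n) cmod (f i x).

Let mS n : measurable_fun [set: T] (S n).
Proof. by apply: measurable_sum => i; exact: measurable_cmod. Qed.

Let S_homo n m x : (n <= m)%N -> S n x <= S m x.
Proof.
by move=> nm; apply: fset_sum_le (fset_lt_homo I nm) => i; exact: cmod_ge0.
Qed.

Let E := [set x | abs_summable (fun i => f i x)].

Let mE : measurable E.
Proof.
rewrite (_ : E = \bigcup_(K : nat) \bigcap_n [set x | S n x <= K%:R]).
  apply: bigcupT_measurable => K; apply: bigcapT_measurable => n.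
  rewrite (_ : [set x | _] = S n @^-1` `]-oo, K%:R]%classic).
    by rewrite -[X in measurable X]setTI; apply: mS => //; exact: measurable_itv.
  by apply/seteqP; split => x /=; rewrite in_itv.
apply/seteqP; split => x /=.
  by move=> /abs_summableP[K hK]; exists K => // n _; exact: hK.
by move=> [K _ hK]; apply/abs_summableP; exists K => n; exact: hK.
Qed.

(** Off the set [E] of summability [csum] has the default value 0, so everywhere it is the limit of
    the partial sums multiplied by the indicator of [E]. *)
Lemma cmeasurable_csum : cmeasurable (fun x => csum (fun i => f i x)).
Proof.
have part (h : R[i] -> R) : (forall z, `|h z| <= cmod z) ->
    (forall z z', h (z - z') = h z - h z') -> h 0 = 0 ->
    (forall (s : seq I) (g : I -> R[i]), h (\sum_(i <- s) g i) = \sum_(i <- s) h (g i)) ->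
    (forall i, measurable_fun [set: T] (h \o f i)) ->
    measurable_fun [set: T] (fun x => h (csum (fun i => f i x))).
  move=> hle hB h0 hs mh.
  apply: (@measurable_fun_cvg _ _ _ _ (fun n x => \1_E x * \sum_(i <- fset_lt I n) h (f i x))).
    move=> n; apply: measurable_funM; first exact: measurable_indic.
    by apply: measurable_sum => i; exact: mh.
  move=> x _; rewrite indicE; have [xE|xE] := boolP (x \in E); last first.
    rewrite csum_default; last by move=> H; move/negP: xE; apply; rewrite inE.
    by rewrite h0; under eq_fun do rewrite mul0r; exact: cvg_cst.
  move: xE; rewrite inE => /abs_summable_csum[l hl].
  rewrite (csumE hl); under eq_fun do rewrite mul1r.
  apply/cvgrPdist_lt => e e0; near=> n; rewrite distrC -hs -hB.
  apply: (le_lt_trans (hle _)); near: n; exact: csum_cvg.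
split.
- apply: (part cRe) => //; [exact: Re_le_cmod|exact: ReB|move=> s g; exact: Re_sum|].
  by move=> i; exact: (mf i).1.
- apply: (part cIm) => //; [exact: Im_le_cmod|exact: ImB|move=> s g; exact: Im_sum|].
  by move=> i; exact: (mf i).2.
Unshelve. all: by end_near. Qed.

Variable mu : {measure set T -> \bar R}.
Variable K : R.
Hypothesis hK : forall A : {fset I},
  (\sum_(i <- A) \int[mu]_x (cmod (f i x))%:E <= K%:E)%E.

Let SE n x := (S n x)%:E.

Let mSE n : measurable_fun [set: T] (SE n).
Proof. exact/measurable_EFinP. Qed.

Let SE_ge0 n x : (0 <= SE n x)%E.
Proof. by rewrite lee_fin; apply: sumr_ge0 => i _; exact: cmod_ge0. Qed.

Let intS n : (\int[mu]_x SE n x <= K%:E)%E.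
Proof.
apply: le_trans (hK (fset_lt I n)); rewrite le_eqVlt; apply/orP; left; apply/eqP.
under eq_integral do rewrite /SE /S -sumEFin.
rewrite ge0_integral_sum// => [i|i x _].
  by apply/measurable_EFinP; exact: measurable_cmod.
by rewrite lee_fin; exact: cmod_ge0.
Qed.

Let L x := limn (SE ^~ x).

Let cvgS x : SE n x @[n --> \oo] --> L x.
Proof.
apply: ereal_nondecreasing_is_cvgn => n m nm; rewrite lee_fin; exact: S_homo.
Qed.

Let S_le_L n x : (SE n x <= L x)%E.
Proof.
rewrite /L (cvg_lim _ (@ereal_nondecreasing_cvgn _ (SE ^~ x) _))//; last first.
  by move=> m p mp; rewrite lee_fin; exact: S_homo.
by apply: ereal_sup_ubound; exists n.
Qed.

Let mL : measurable_fun [set: T] L.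
Proof.
by apply: (@emeasurable_fun_cvg _ _ _ _ SE) => // x _; exact: cvgS.
Qed.

Let intL : (\int[mu]_x L x <= K%:E)%E.
Proof.
rewrite /L monotone_convergence//; last first.
  by move=> x _ n m nm; rewrite lee_fin; exact: S_homo.
apply: lime_le; last by apply: nearW.
apply: ereal_nondecreasing_is_cvgn => n m nm; apply: ge0_le_integral => //.
by move=> x _; rewrite lee_fin; exact: S_homo.
Qed.

Let L_ge0 x : (0 <= L x)%E.
Proof. exact: le_trans (SE_ge0 0 x) (S_le_L 0 x). Qed.

Let L_fin_summable x : (L x < +oo)%E -> abs_summable (fun i => f i x).
Proof.
move=> Lx; have Lf : L x \is a fin_num by rewrite ge0_fin_numE.
exists (fine (L x)) => A; have [n An] := fset_lt_sup A.
apply: (@le_trans _ _ (S n x)).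
  by apply: fset_sum_le An => i; exact: cmod_ge0.
by rewrite -lee_fin fineK//; exact: S_le_L.
Qed.

Lemma ae_has_csum : {ae mu, forall x, exists l, has_csum (fun i => f i x) l}.
Proof.
have Li : mu.-integrable [set: T] L.
  apply/integrableP; split => //; under eq_integral do rewrite gee0_abs//.
  exact: le_lt_trans intL (ltry _).
have := integrable_ae measurableT Li; apply: filterS => x /(_ Logic.I) Lx.
by apply: abs_summable_csum; apply: L_fin_summable; rewrite ltey_eq Lx.
Qed.

(** The limit [L] of the sums of moduli dominates at every point: where it is infinite trivially,
    elsewhere because the sum converges. *)
Lemma integral_csum_le : (\int[mu]_x (cmod (csum (fun i => f i x)))%:E <= K%:E)%E.
Proof.
apply: le_trans intL; apply: ge0_le_integral => //.
- by move=> x _; rewrite lee_fin; exact: cmod_ge0.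
- by apply/measurable_EFinP; apply: measurable_cmod; exact: cmeasurable_csum.
move=> x _; have [Lx|Lx] := boolP (L x < +oo)%E; last first.
  by move: Lx; rewrite -leNgt leye_eq => /eqP ->; exact: leey.
have Lf : L x \is a fin_num by rewrite ge0_fin_numE.
have [l hl] := abs_summable_csum (L_fin_summable Lx).
rewrite (csumE hl) -(fineK Lf) lee_fin; apply: cmod_csum_le hl _ => n.
by rewrite -lee_fin fineK//; exact: S_le_L.
Qed.

End UnorderedSumsL1.

(** * The L1 bound for a family dominated by products of Gaussian variables *)

Section SumBounds.
Context (R : realType).

Lemma ler_sum_sub_uniq (T : eqType) (F : T -> R) (s t : seq T) :
  (forall x, 0 <= F x) -> uniq s -> {subset s <= t} ->
  \sum_(x <- s) F x <= \sum_(x <- t) F x.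
Proof.
move=> F0; elim: s t => [|x s IH] t /=; first by rewrite big_nil sumr_ge0.
move=> /andP[xs us] st; rewrite big_cons [leRHS](big_rem x) /=; last by rewrite st ?mem_head.
rewrite lerD2l; apply: IH => // y ys; apply: rem_mem; last by rewrite st// in_cons ys orbT.
by apply: contra xs => /eqP <-.
Qed.

(** The tuples of the finite set [A] use finitely many letters [W], and the sum over all tuples on
    [W], listed by [allt], factors as a power. *)
Lemma sum_tuple_prod_le (T : choiceType) (g : T -> R) (S : R) n (A : {fset n.-tuple T}) :
  (forall w, 0 <= g w) -> (forall s : seq T, uniq s -> \sum_(w <- s) g w <= S) ->
  \sum_(J <- A) \prod_(w <- J) g w <= S ^+ n.
Proof.
move=> g0 gS.
pose W := undup (flatten [seq val J | J <- A]).
pose fix allt n : seq (n.-tuple T) := match n with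
  | 0 => [:: [tuple]]
  | n'.+1 => [seq [tuple of p.1 :: p.2] | p : T * n'.-tuple T <- [seq (w, J) | w <- W, J <- allt n']] end.
have allt_sum k : \sum_(J <- allt k) \prod_(w <- J) g w = (\sum_(w <- W) g w) ^+ k.
  elim: k => [|k IH] /=; first by rewrite big_seq1 big_nil.
  rewrite big_map big_allpairs_dep /= exprS -IH mulr_suml; apply: eq_bigr => w _.
  by rewrite mulr_sumr; apply: eq_bigr => J _; rewrite big_cons.
have allt_mem k (J : k.-tuple T) : {subset J <= W} -> J \in allt k.
  elim: k J => [|k IH] J JW /=; first by rewrite tuple0 mem_seq1.
  case/tupleP: J JW => w J JW; apply/mapP; exists (w, J) => //=.
  apply/allpairsP; exists (w, J) => /=; split=> //; first by apply: JW; rewrite mem_head.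
  by apply: IH => v vJ; apply: JW; rewrite in_cons vJ orbT.
have p0 (J : n.-tuple T) : 0 <= \prod_(w <- J) g w by apply: prodr_ge0.
apply: (@le_trans _ _ (\sum_(J <- allt n) \prod_(w <- J) g w)).
  apply: ler_sum_sub_uniq => // J JA; apply: allt_mem => w wJ.
  by rewrite mem_undup; apply/flattenP; exists (val J) => //; apply: map_f.
rewrite allt_sum; apply: lerXn2r; rewrite ?nnegrE.
- by apply: sumr_ge0.
- by have := gS [::] isT; rewrite big_nil.
- by apply: gS; exact: undup_uniq.
Qed.

(** The factor 2 counts the directions u_j and v_j attached to each index. *)
Lemma sum_bool_le (Gam : choiceType) (eps : Gam -> R) : (forall j, 0 <= eps j) ->
  summable [set: Gam] (fun j => (eps j)%:E) ->
  forall s : seq (Gam * bool), uniq s ->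
    \sum_(w <- s) eps w.1 <= 2 * fine (\esum_(j in [set: Gam]) (eps j)%:E).
Proof.
move=> e0 es s us; set E := \esum_(j in _) _.
have Efin : E \is a fin_num.
  rewrite ge0_fin_numE ?esum_ge0// => [|j _]; last by rewrite lee_fin.
  have := es; rewrite /summable /E; congr (_ < _)%E; apply: eq_esum => j _.
  by rewrite gee0_abs// lee_fin.
pose U := undup [seq w.1 | w <- s].
apply: (@le_trans _ _ (\sum_(w <- [seq (j, b) | j <- U, b <- [:: false; true]]) eps w.1)).
  apply: ler_sum_sub_uniq => // -[j b] jb; apply/allpairsP; exists (j, b) => /=; split => //.
    by rewrite mem_undup; apply/mapP; exists (j, b).
  by case: b {jb}.
rewrite big_allpairs_dep /=.
under eq_bigr do rewrite big_cons big_seq1 /= -mulr2n -mulr_natl.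
rewrite -mulr_sumr ler_wpM2l// -lee_fin fineK// -sumEFin.
apply: esum_ge; exists [set` U]; first by split => //; exact: finite_seq.
by rewrite fsbig_seq// undup_uniq.
Qed.

(** Indices of a tuple may repeat, so the integral of the product of the [ell] does not factor; a
    mean of powers has the same bound for every pattern of repetition. *)
Lemma prod_le_mean_pow n (a : 'I_n.+1 -> R) : (forall i, 0 <= a i) ->
  \prod_(i < n.+1) a i <= n.+1%:R^-1 * \sum_(i < n.+1) a i ^+ n.+1.
Proof.
move=> a0; rewrite -(@ler_pXn2r _ n.+1)// ?nnegrE; last 2 first.
- by apply: prodr_ge0.
- by rewrite mulr_ge0 ?invr_ge0//; apply: sumr_ge0 => i _; exact: exprn_ge0.
rewrite -prodrXl.
have [+ _] := @leif_AGM R 'I_n.+1 predT (fun i => a i ^+ n.+1) (fun i _ => exprn_ge0 _ (a0 i)).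
by rewrite cardT size_enum_ord mulrC.
Qed.

End SumBounds.

(** * Laws and moments of continuous linear forms *)

Section GaussianForms.
Context (R : realType) (V W : normedModType R).
Variables (ip : V -> V -> R) (iot : V -> W).
Hypothesis ipP : inner_product ip.
Variables (mu : probability (borel W) R) (t : R).
Hypotheses (t0 : 0 < t) (gmu : gaussian_measure ip iot t mu).

Lemma measurable_dual (y : {scalar W}) : continuous (y : W -> R) ->
  measurable_fun [set: borel W] (y : borel W -> R).
Proof. exact: continuous_borel_real. Qed.

Lemma integral_dual (y : {scalar W}) (a : V) (f : measurableTypeR R -> \bar R) :
  dual_elt ip iot y a -> ip a a = 1 ->
  measurable_fun [set: measurableTypeR R] f -> (forall v, 0 <= f v)%E ->
  (\int[mu]_x f (y (x : W)) = \int[normal_prob 0%R (Num.sqrt t)]_v f v)%E.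
Proof.
move=> dy a1 mf f0.
have my : measurable_fun [set: borel W] ((y : W -> R) : borel W -> measurableTypeR R).
  exact: measurable_dual dy.1.
have [nu nuE <-//] := image_measure (mu) my.
apply: eq_measure_integral => A mA _; rewrite nuE.
have ow : orthonormal_family ip (fun _ : 'I_1 => a) by move=> i j; rewrite !ord1 eqxx.
have mA' : measurable [set u : 1.-tuple R | A (tnth u ord0)].
  by rewrite -[X in measurable X]setTI; apply: (@measurable_tnth _ R 1 ord0).
have E := gmu (y := fun _ : 'I_1 => y) (fun=> dy) ow mA'.
rewrite gauss_tuple1// in E; apply: etrans E; congr (mu _).
by apply/seteqP; split => x /=; rewrite tnth_mktuple.
Qed.

(** With sd the square root of [t] and [M] the maximum of 1 and sd, sd |v| + r <= M (1 + r) (1 +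
    |v|): [M] has to dominate sd for the term in |v| and 1 for the term [r]. *)
Lemma dual_moment_le (r c : R) n (y : {scalar W}) (a : V) :
  dual_elt ip iot y a -> ip a a = 1 -> `|c| <= r ->
  (\int[mu]_x ((`|y (x : W) + c| ^+ n)%R)%:E <=
   (((Num.max 1 (Num.sqrt t) * (1 + r)) ^+ n)%R)%:E *
     \int[normal_prob 0%R 1%R]_v (((1 + `|v|) ^+ n)%R)%:E)%E.
Proof.
move=> dy a1 cr; set M := Num.max 1 (Num.sqrt t).
have r0 : 0 <= r by exact: le_trans (normr_ge0 c) cr.
have st0 : 0 < Num.sqrt t by rewrite sqrtr_gt0.
have M1 : 1 <= M by rewrite le_max lexx.
have Ms : Num.sqrt t <= M by rewrite le_max lexx orbT.
have mfc : measurable_fun [set: measurableTypeR R] (fun v : R => (`|v + c| ^+ n)%:E).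
  apply/measurable_EFinP; apply: measurable_funX.
  apply: (@measurableT_comp _ _ _ _ _ _ (fun u : R => `|u|)) => //.
  exact: measurable_funD.
have fc0 (v : R) : (0 <= (`|v + c| ^+ n)%:E)%E by rewrite lee_fin exprn_ge0.
rewrite (@integral_dual y a (fun v => (`|v + c| ^+ n)%:E))//.
have := @integral_normal_affine R 0 (Num.sqrt t) 1 _ st0 ltr01 mfc fc0.
rewrite mulr1 => <-.
have mg : measurable_fun [set: measurableTypeR R] (fun v : R => ((1 + `|v|) ^+ n)%:E).
  apply/measurable_EFinP; apply: measurable_funX; apply: measurable_funD => //.
have g0 (v : R) : (0 <= ((1 + `|v|) ^+ n)%:E)%E by rewrite lee_fin exprn_ge0// addr_ge0.
rewrite -ge0_integralZl//; last first.
  by rewrite lee_fin exprn_ge0// mulr_ge0 ?addr_ge0// (le_trans _ M1).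
apply: ge0_le_integral => //.
- apply: (@measurableT_comp _ _ _ _ _ _ (fun v : measurableTypeR R => (`|v + c| ^+ n)%:E)) => //.
  by apply: measurable_funD => //; apply: measurable_funM.
- exact: emeasurable_funM.
move=> v _; rewrite -EFinM lee_fin -exprMn; apply: lerXn2r; rewrite ?nnegrE//.
  by rewrite !mulr_ge0 ?addr_ge0// (le_trans _ M1).
rewrite add0r; apply: (le_trans (ler_normD _ _)); rewrite normrM (gtr0_norm st0).
have h1 : Num.sqrt t * `|v| <= M * `|v| by rewrite ler_wpM2r.
have h2 : r <= M * r by rewrite ler_peMl.
have h3 : 0 <= M * (r * `|v|) by rewrite !mulr_ge0// (le_trans _ M1).
nra.
Qed.

(** In the clause on extension by continuity the element [a] itself is an admissible [b], at
    distance 0, so the L2 norm of [y - g] is below every positive number. *)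
Lemma is_ell_ae (a : V) (y : {scalar W}) (g : borel W -> R) :
  is_ell ip iot (mu) a g -> dual_elt ip iot y a ->
  {ae mu, forall x, g x = y (x : W)}.
Proof.
move=> [mg _ hg] dy.
have my : measurable_fun [set: borel W] ((y : W -> R) : borel W -> R).
  exact: measurable_dual dy.1.
have N0 : Lnorm (mu) 2%:E (EFin \o (fun x : borel W => (y x - g x)%R)) = 0%E.
  apply/eqP; rewrite eq_le Lnorm_ge0 andbT; apply/lee_addgt0Pr => e e0.
  have [d d0 hd] := hg e e0; rewrite add0e; apply: ltW; apply: (hd y a dy).
  by rewrite subrr /hnorm (ip0l ipP) sqrtr0.
have := Lnorm_eq0_eq0 _ _ N0; case.
- apply/measurable_EFinP; exact: measurable_funB.
- by rewrite lte_fin.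
move=> A [mA A0 hA]; exists A; split => // x nx; apply: hA => /= E; apply: nx.
by have := E Logic.I => -[] /eqP; rewrite subr_eq0 => /eqP.
Qed.

End GaussianForms.

Section L1Bounds.
Context (R : realType) (V W : normedModType R).
Variables (ip : V -> V -> R) (iot : V -> W).
Hypotheses (ipP : inner_product ip) (iot0 : iot 0 = 0) (iotd : dense (range iot)).
Hypothesis dualW : forall f : {scalar W}, continuous (f : W -> R) ->
  exists a, dual_elt ip iot f a.
Hypothesis genW : @open W `<=` <<s @halfspaces R W >>.
Variable mu : R -> probability (borel W) R.
Hypothesis gmu : forall t : R, 0 < t -> gaussian_measure ip iot t (mu t).

Lemma ae_gaussian_affine (t s : R) (X : V) (Q : borel W -> Prop) : 0 < t -> 0 < s ->
  {ae mu (s ^+ 2 * t), forall x, Q x} ->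
  {ae mu t, forall Y : borel W, Q (iot X + s *: (Y : W))}.
Proof.
move=> t0 s0 [A [mA A0 QA]].
exists [set Y : borel W | A (iot X + s *: (Y : W))]; split.
- have mPhi : measurable_fun [set: borel W] (fun Y : borel W => (iot X + s *: (Y : W) : borel W)).
    apply: (@continuous_borel R W W (fun Y => iot X + s *: Y)) => Y.
    by apply: cvgD; [exact: cvg_cst|apply: cvgZ; [exact: cvg_cst|exact: cvg_id]].
  by rewrite -[X in measurable X]setTI; exact: mPhi.
- exact: (gaussian_affine_null ipP iotd dualW genW gmu).
- by move=> Y nQ; apply: QA.
Qed.

Lemma ae_gaussian_shift (t : R) (X : V) (Q : borel W -> Prop) : 0 < t ->
  {ae mu t, forall x, Q x} -> {ae mu t, forall Y : borel W, Q ((Y : W) + iot X)}.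
Proof.
move=> t0 h; have : {ae mu (1 ^+ 2 * t), forall x, Q x} by rewrite expr1n mul1r.
move=> /(ae_gaussian_affine X t0 ltr01); apply: filterS => Y.
by rewrite scale1r addrC.
Qed.

Section Family.
Variables (T : countType) (dir : T -> V) (ell : T -> borel W -> R) (eps : T -> R).
Variables (t S : R).
Hypotheses (t0 : 0 < t) (dir1 : forall w, ip (dir w) (dir w) = 1)
  (dird : forall w, exists y : {scalar W}, dual_elt ip iot y (dir w))
  (hell : forall w, is_ell ip iot (mu t) (dir w) (ell w))
  (eps0 : forall w, 0 <= eps w)
  (hS : forall s : seq T, uniq s -> \sum_(w <- s) eps w <= S).

Let S0 : 0 <= S. Proof. by have := hS (isT : uniq [::]); rewrite big_nil. Qed.

Let I n := (\int[normal_prob 0%R 1%R]_v (((1 + `|v| : R) ^+ n)%R)%:E)%E.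
Let M := Num.max 1 (Num.sqrt t).

Let mell w : measurable_fun [set: borel W] (ell w).
Proof. by have [] := hell w. Qed.

Let mshift (Y : V) : measurable_fun [set: borel W] (fun x : borel W => ((x : W) + iot Y : borel W)).
Proof.
apply: (@continuous_borel R W W (fun x => x + iot Y)) => x.
by apply: cvgD; [exact: cvg_id|exact: cvg_cst].
Qed.

Lemma ell_moment_le n w (Y : V) :
  (\int[mu t]_x ((`|ell w ((x : W) + iot Y)| ^+ n)%R)%:E <=
   (((M * (1 + hnorm ip Y)) ^+ n)%R)%:E * I n)%E.
Proof.
have [y dy] := dird w.
apply: le_trans (dual_moment_le t0 (gmu t0) n dy (dir1 w) (_ : `|ip (dir w) Y| <= hnorm ip Y)); last first.
  by rewrite (ipC ipP); apply: ip_abs_le.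
have m1 : measurable_fun [set: borel W] (fun x : borel W => (`|ell w ((x : W) + iot Y)| ^+ n)%:E).
  apply/measurable_EFinP; apply: measurable_funX; apply: measurableT_comp => //.
  exact: (measurableT_comp (mell w) (mshift Y)).
have m2 : measurable_fun [set: borel W] (fun x : borel W => (`|y (x : W) + ip (dir w) Y| ^+ n)%:E).
  apply/measurable_EFinP; apply: measurable_funX; apply: measurableT_comp => //.
  by apply: measurable_funD => //; exact: measurable_dual dy.1.
rewrite le_eqVlt; apply/orP; left; apply/eqP; apply: ge0_ae_eq_integral => //.
have := ae_gaussian_shift Y t0 (is_ell_ae ipP (hell w) dy).
apply: filterS => x E _; rewrite E linearD /=; congr ((`|_ + _| ^+ n)%:E).
exact: dy.2.
Qed.

Lemma ell_prod_le n (J : n.+1.-tuple T) (Y : V) :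
  (\int[mu t]_x ((\prod_(w <- J) `|ell w ((x : W) + iot Y)|)%R)%:E <=
   (((M * (1 + hnorm ip Y)) ^+ n.+1)%R)%:E * I n.+1)%E.
Proof.
set K := (_ * _)%E.
have mp w : measurable_fun [set: borel W] (fun x : borel W => `|ell w ((x : W) + iot Y)|).
  by apply: measurableT_comp => //; exact: (measurableT_comp (mell w) (mshift Y)).
have mX w : measurable_fun [set: borel W] (fun x : borel W => (`|ell w ((x : W) + iot Y)| ^+ n.+1)%:E).
  by apply/measurable_EFinP; apply: measurable_funX.
apply: (@le_trans _ _ (\int[mu t]_x ((n.+1%:R^-1)%:E *
    \sum_(i < n.+1) (`|ell (tnth J i) ((x : W) + iot Y)| ^+ n.+1)%:E))%E).
  apply: ge0_le_integral => //.
  - by move=> x _; rewrite lee_fin; apply: prodr_ge0.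
  - by apply/measurable_EFinP; apply: measurable_prod => w _.
  - by apply: emeasurable_funM => //; apply: emeasurable_sum.
  move=> x _; rewrite sumEFin -EFinM lee_fin big_tuple.
  by apply: (@prod_le_mean_pow R n (fun i => `|ell (tnth J i) ((x : W) + iot Y)|)).
rewrite ge0_integralZl//; last 2 first.
- by apply: emeasurable_sum.
- by move=> x _; apply: sume_ge0 => i _; rewrite lee_fin exprn_ge0.
rewrite ge0_integral_sum//.
apply: (@le_trans _ _ ((n.+1%:R^-1)%:E * \sum_(i < n.+1) K)%E).
  apply: lee_wpmul2l; first by rewrite lee_fin.
  by apply: lee_sum => i _; exact: ell_moment_le.
have KI : I n.+1 \is a fin_num.
  rewrite ge0_fin_numE; first exact: gauss_moment_lty.
  by apply: integral_ge0 => v _; rewrite lee_fin exprn_ge0// addr_ge0.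
rewrite /K -(fineK KI) -EFinM sumEFin sumr_const card_ord -EFinM.
move: (_ * fine _) => k.
by rewrite -(mulr_natl k) mulrA mulVf ?mul1r ?pnatr_eq0.
Qed.

Variables (n : nat) (f : n.+1.-tuple T -> borel W -> R[i]) (C : R).
Hypotheses (C0 : 0 <= C) (mf : forall J, cmeasurable (f J))
  (hf : forall J, {ae mu t, forall Z, cmod (f J Z) <=
    C * \prod_(w <- J) eps w * \prod_(w <- J) `|ell w Z|}).

Let K (Y : V) := C * S ^+ n.+1 * ((M * (1 + hnorm ip Y)) ^+ n.+1 * fine (I n.+1)).

Let cmshift J Y : cmeasurable (fun x : borel W => f J ((x : W) + iot Y)).
Proof.
by have [m1 m2] := mf J; split; [exact: (measurableT_comp m1 (mshift Y))|
  exact: (measurableT_comp m2 (mshift Y))].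
Qed.

Lemma sum_integral_le (Y : V) (A : {fset n.+1.-tuple T}) :
  (\sum_(J <- A) \int[mu t]_x (cmod (f J ((x : W) + iot Y)))%:E <= (K Y)%:E)%E.
Proof.
have KI : I n.+1 \is a fin_num.
  rewrite ge0_fin_numE; first exact: gauss_moment_lty.
  by apply: integral_ge0 => v _; rewrite lee_fin exprn_ge0// addr_ge0.
have I0 : 0 <= fine (I n.+1).
  by apply: fine_ge0; apply: integral_ge0 => v _; rewrite lee_fin exprn_ge0// addr_ge0.
have M0 : 0 <= M * (1 + hnorm ip Y).
  by rewrite mulr_ge0 ?addr_ge0 ?hnorm_ge0// le_max ler01.
set k := (M * (1 + hnorm ip Y)) ^+ n.+1 * fine (I n.+1).
have kE : (k%:E = ((M * (1 + hnorm ip Y)) ^+ n.+1)%:E * I n.+1)%E.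
  by rewrite /k EFinM fineK.
have k0 : 0 <= k by rewrite mulr_ge0// exprn_ge0.
have e0 (J : n.+1.-tuple T) : 0 <= C * \prod_(w <- J) eps w by rewrite mulr_ge0// prodr_ge0.
apply: (@le_trans _ _ (\sum_(J <- A) (C * \prod_(w <- J) eps w * k)%:E)%E).
  apply: lee_sum => J _.
  have mp : measurable_fun [set: borel W]
      (fun x : borel W => (\prod_(w <- J) `|ell w ((x : W) + iot Y)|)%:E).
    apply/measurable_EFinP; apply: measurable_prod => w _; apply: measurableT_comp => //.
    exact: (measurableT_comp (mell w) (mshift Y)).
  have p0 (x : borel W) : (0 <= (\prod_(w <- J) `|ell w ((x : W) + iot Y)|)%:E)%E.
    by rewrite lee_fin prodr_ge0.
  rewrite EFinM kE.
  apply: (@le_trans _ _ ((C * \prod_(w <- J) eps w)%:E *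
      \int[mu t]_x (\prod_(w <- J) `|ell w ((x : W) + iot Y)|)%:E)%E); last first.
    by apply: lee_wpmul2l; rewrite ?lee_fin//; exact: ell_prod_le.
  rewrite -ge0_integralZl//; last by rewrite lee_fin.
  apply: ae_ge0_le_integral => //.
  - by move=> x _; rewrite lee_fin; exact: cmod_ge0.
  - by apply/measurable_EFinP; apply: measurable_cmod.
  - by move=> x _; apply: mule_ge0 => //; rewrite lee_fin.
  - exact: emeasurable_funM.
  have := ae_gaussian_shift Y t0 (hf J); apply: filterS => x h _.
  by rewrite -EFinM lee_fin.
rewrite sumEFin lee_fin -mulr_suml -mulr_sumr /K -/k.
apply: ler_wpM2r => //; apply: ler_wpM2l => //.
exact: sum_tuple_prod_le.
Qed.

(** Common to the Taylor terms, with the factorial in [c], and to the rest, with the factorial in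
    [C]. Tuples have length [n.+1] because both orders are at least 1. *)
Lemma csum_family (c : R) : 0 <= c ->
  [/\ {ae mu t, forall Z, exists l, has_csum (fun J => f J Z) l},
      in_cLp (mu t) 1 (fun Z => (c%:C)%C * csum (fun J => f J Z)) &
      (Nnorm ip iot (mu t) n.+1 (fun Z => ((c%:C)%C * csum (fun J => f J Z))%R)
        <= (c * C * S ^+ n.+1 * M ^+ n.+1 * fine (I n.+1))%:E)%E].
Proof.
move=> c0.
pose G Z := (c%:C)%C * csum (fun J => f J Z).
have mG : cmeasurable G.
  have [m1 m2] := cmeasurable_csum mf.
  split.
    rewrite (_ : cRe \o G = fun Z => c * cRe (csum (fun J => f J Z))).
      exact: measurable_funM.
    by apply/funext => Z; rewrite /G /=; case: (csum _) => a b /=; rewrite mul0r subr0.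
  rewrite (_ : cIm \o G = fun Z => c * cIm (csum (fun J => f J Z))).
    exact: measurable_funM.
  by apply/funext => Z; rewrite /G /=; case: (csum _) => a b /=; rewrite mul0r addr0.
have GL Y : (cLnorm (mu t) 1 (fun x : borel W => G ((x : W) + iot Y)%R) <= (c * K Y)%:E)%E.
  rewrite /cLnorm Lnorm1.
  have := @integral_csum_le R _ _ (borel W) _ (cmshift^~ Y) (mu t) (K Y) (sum_integral_le Y).
  have mc : measurable_fun [set: borel W]
      (fun x : borel W => (cmod (csum (fun J => f J ((x : W) + iot Y))))%:E).
    apply/measurable_EFinP; apply: measurable_cmod.
    exact: (cmeasurable_csum (cmshift^~ Y)).
  move=> h; rewrite EFinM; apply: le_trans (lee_wpmul2l _ h); last by rewrite lee_fin.
  rewrite -ge0_integralZl//; last by move=> x _; rewrite lee_fin; exact: cmod_ge0.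
  rewrite le_eqVlt; apply/orP; left; apply/eqP; apply: eq_integral => x _.
  rewrite /= -EFinM; congr (_%:E); rewrite ger0_norm; last exact: cmod_ge0.
  by rewrite /G ComplexField.Normc.normcM cmod_real.
(* Summability and integrability without translation are the case of translation by 0. *)
have [Y0 Y0E] : exists Y0 : V, iot Y0 = 0 by exists 0.
have f0 J (Z : borel W) : f J ((Z : W) + iot Y0) = f J Z by rewrite Y0E addr0.
split.
- have := @ae_has_csum R _ _ (borel W) _ (cmshift^~ Y0) (mu t) (K Y0) (sum_integral_le Y0).
  apply: filterS => Z [l hl]; exists l.
  by move: hl; congr has_csum; apply/funext => J; exact: f0.
- split => //; apply: le_lt_trans (ltry (c * K Y0)).
  apply: le_trans (GL Y0); rewrite le_eqVlt; apply/orP; left; apply/eqP.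
  by congr cLnorm; apply/funext => x; rewrite Y0E addr0.
apply: ub_ereal_sup => _ [Y _ <-].
have nY : 0 < 1 + hnorm ip Y by rewrite ltr_wpDr// hnorm_ge0.
apply: (@le_trans _ _ ((c * K Y)%:E * ((1 + hnorm ip Y) ^+ n.+1)^-1%:E)%E).
  by apply: lee_wpmul2r; [rewrite lee_fin invr_ge0 exprn_ge0// ltW|exact: GL].
(* [K Y] depends on [Y] only through the power of [1 + hnorm ip Y] that the weight of the norm
   divides out. *)
rewrite -EFinM lee_fin /K exprMn.
rewrite le_eqVlt; apply/orP; left; apply/eqP; field.
by rewrite expf_neq0 ?gt_eqF.
Qed.

End Family.
End L1Bounds.

(** * Bounds for stochastic extensions and for the rest integral *)

Section StochasticExtension.
Context (R : realType) (V W : normedModType R).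
Variables (ip : V -> V -> R) (iot : V -> W).
Hypotheses (ipP : inner_product ip) (iotd : dense (range iot)).
Variable mu : probability (borel W) R.
Variable t : R.
Hypotheses (t0 : 0 < t) (gmu : gaussian_measure ip iot t mu).

(** Divided by |a|, the form has a law that does not depend on it, so one second moment bounds all.
    When |a| = 0 the form vanishes by density. *)
Lemma Lnorm2_dual_le : exists2 K : R, 0 <= K &
  forall (y : {scalar W}) (a : V), dual_elt ip iot y a ->
    (Lnorm mu 2%:E (EFin \o (fun x : borel W => y (x : W))) <= (hnorm ip a * K)%:E)%E.
Proof.
pose I2 := (\int[normal_prob 0%R 1%R]_v (((1 + `|v| : R) ^+ 2)%R)%:E)%E.
pose M := (Num.max 1 (Num.sqrt t) * (1 + 0)) ^+ 2.
have I20 : (0 <= I2)%E by apply: integral_ge0 => v _; rewrite lee_fin exprn_ge0// addr_ge0.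
have I2f : I2 \is a fin_num by rewrite ge0_fin_numE//; exact: gauss_moment_lty.
have M0 : 0 <= M by rewrite exprn_ge0// addr0 mulr1 le_max ler01.
pose K := Num.sqrt (M * fine I2).
exists K; first exact: sqrtr_ge0.
move=> y a dy.
have my : measurable_fun [set: borel W] ((y : W -> R) : borel W -> R).
  exact: continuous_borel_real dy.1.
have [a0|a0] := eqVneq (hnorm ip a) 0.
  rewrite a0 mul0r; move: dy; rewrite (hnorm_eq0 ipP a0) => /(dual_elt0 ipP iotd) y0.
  rewrite (_ : EFin \o _ = cst 0%E) ?Lnorm0 ?lexx//.
  by apply/funext => x /=; rewrite y0.
have [|z zE] := @scalar_of_fun _ W (fun x => (hnorm ip a)^-1 * y x).
  by move=> c u v; rewrite linearP mulrDr mulrCA.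
have dz : dual_elt ip iot z ((hnorm ip a)^-1 *: a).
  split; last by move=> x; rewrite zE dy.2 (ipZl ipP).
  rewrite (_ : (z : W -> R) = fun x => (hnorm ip a)^-1 * y x); last exact/funext.
  by move=> x; apply: cvgM; [exact: cvg_cst|exact: dy.1].
have z1 : ip ((hnorm ip a)^-1 *: a) ((hnorm ip a)^-1 *: a) = 1.
  by rewrite (ipZl ipP) (ipZr ipP) -(hnormE ipP) mulrA -expr2 -exprMn mulVf// expr1n.
have hz : (\int[mu]_x ((`|z (x : W)| ^+ 2)%R)%:E <= (K ^+ 2)%:E)%E.
  have := dual_moment_le t0 gmu 2 dz z1 (_ : `|0| <= 0); rewrite normr0 => /(_ (lexx _)).
  rewrite -/I2 -/M -(fineK I2f) -EFinM /K sqr_sqrtr; last by rewrite mulr_ge0// fine_ge0.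
  by under eq_integral do rewrite addr0.
have c0 : 0 <= hnorm ip a * K by rewrite mulr_ge0 ?hnorm_ge0 ?sqrtr_ge0.
rewrite unlock.
have -> : ((hnorm ip a * K)%:E = ((hnorm ip a * K) ^+ 2)%:E `^ 2^-1)%E.
  rewrite poweR12_sqrt ?lee_fin ?sqr_ge0//= sqrtr_sqr ger0_norm//.
apply: gt0_ler_poweR; rewrite ?in_itv/= ?invr_ge0//.
- by rewrite integral_ge0//= ?leey// => x _; exact: poweR_ge0.
- by rewrite lee_fin sqr_ge0 leey.
have -> : (\int[mu]_x (`|(y (x : W))%:E| `^ 2) =
    \int[mu]_x ((hnorm ip a ^+ 2)%:E * (`|z (x : W)| ^+ 2)%:E))%E.
  apply: eq_integral => x _; rewrite /= -EFinM; congr (_%:E).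
  have -> : y x = hnorm ip a * z x by rewrite zE mulrA mulfV// mul1r.
  by rewrite powR_mulrn// normrM exprMn (ger0_norm (hnorm_ge0 _ _)).
have mz : measurable_fun [set: borel W] ((z : W -> R) : borel W -> R).
  exact: continuous_borel_real dz.1.
have mz2 : measurable_fun [set: borel W] (fun x : borel W => (`|z (x : W)| ^+ 2)%:E).
  by apply/measurable_EFinP; apply: measurable_funX; exact: measurableT_comp.
have z20 (x : borel W) : (0 <= (`|z (x : W)| ^+ 2)%:E)%E by rewrite lee_fin exprn_ge0.
have a20 : (0 <= (hnorm ip a ^+ 2)%:E)%E by rewrite lee_fin sqr_ge0.
rewrite ge0_integralZl//.
by rewrite exprMn [leRHS]EFinM; apply: lee_wpmul2l.
Qed.

(** Supplies representatives of the [ell] at every variance, whereas those of the theorem belong to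
    variance h/2. *)
Lemma is_ell_dual (y : {scalar W}) (a : V) : dual_elt ip iot y a ->
  is_ell ip iot mu a (fun x : borel W => y (x : W)).
Proof.
move=> dy; have [K K0 hK] := Lnorm2_dual_le; split.
- exact: continuous_borel_real dy.1.
- exact: le_lt_trans (hK _ _ dy) (ltry _).
move=> e e0; exists (e / (K + 1)); first by rewrite divr_gt0// ltr_wpDl.
move=> y' b dy' hab.
have [|z zE] := @scalar_of_fun _ W (fun x => y' x - y x).
  by move=> c u v; rewrite (linearP y) (linearP y') /=; ring.
have dz : dual_elt ip iot z (b - a).
  split; last by move=> x; rewrite zE dy.2 dy'.2 (ipDl ipP) (ipNl ipP).
  rewrite (_ : (z : W -> R) = fun x => y' x - y x); last exact/funext.
  by move=> x; apply: cvgB; [exact: dy'.1|exact: dy.1].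
rewrite (_ : EFin \o _ = EFin \o (fun x : borel W => z (x : W))); last first.
  by apply/funext => x /=; rewrite zE.
apply: (le_lt_trans (hK _ _ dz)); rewrite lte_fin.
apply: (@le_lt_trans _ _ (hnorm ip (b - a) * (K + 1))).
  by rewrite ler_wpM2l ?hnorm_ge0// lerDl.
by rewrite -ltr_pdivlMr// ltr_wpDl.
Qed.

Variables (T : countType) (dir : T -> V).
Hypotheses (odir : orthonormal_family ip dir)
  (dird : forall w, exists y : {scalar W}, dual_elt ip iot y (dir w))
  (dird_dense : dense [set x | exists (A : {fset T}) (c : T -> R),
      x = \sum_(w <- A) c w *: dir w]).

Let E n : set V := [set x | exists c : T -> R, x = \sum_(w <- fset_lt T n) c w *: dir w].

Lemma fspan_fset (A : {fset T}) :
  fspan (fun i : 'I_(size (enum_fset A)) => dir (tnth (in_tuple (enum_fset A)) i)) =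
  [set x | exists c : T -> R, x = \sum_(w <- A) c w *: dir w].
Proof.
apply/seteqP; split => [x [c ->]|x [c ->]]; last first.
  by exists (fun i => c (tnth (in_tuple (enum_fset A)) i)); rewrite big_tnth.
set s := in_tuple (enum_fset A).
exists (fun w => \sum_(i | tnth s i == w) c i); rewrite [RHS]big_tnth -/s.
apply: eq_bigr => i _; congr (_ *: _); rewrite (big_pred1 i)// => j.
by rewrite /= -(inj_eq (tuple_uniqP s (fset_uniq A))).
Qed.

Lemma sub_span (A A' : {fset T}) (c : T -> R) : (A `<=` A')%fset ->
  \sum_(w <- A) c w *: dir w =
  \sum_(w <- A') (if w \in A then c w else 0) *: dir w.
Proof.
move=> AA'; rewrite -(big_fset_incl _ AA') => [|w _ /negbTE ->]; last by rewrite scale0r.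
by apply: eq_big_seq => w ->.
Qed.

(** The convergence clause of [stochastic_extension] has content only along an existing sequence of
    projections; finite parts of the orthonormal family give one. *)
Lemma exhausting_tproj : exists (F : nat -> set V) (p : nat -> borel W -> V),
  [/\ forall n, F n `<=` F n.+1, dense (\bigcup_n F n) &
      forall n, is_tproj ip iot mu (F n) (p n)].
Proof.
have [y dy] := choice dird.
exists E, (fun n x => \sum_(i < size (enum_fset (fset_lt T n)))
   y (tnth (in_tuple (enum_fset (fset_lt T n))) i) (x : W) *:
   dir (tnth (in_tuple (enum_fset (fset_lt T n))) i)); split.
- move=> n x [c ->]; eexists; apply: sub_span; exact: fset_lt_homo.
- move=> O O0 Oo; have [x [Ox [A [c xE]]]] := dird_dense O0 Oo.
  exists x; split => //; have [n An] := fset_lt_sup A.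
  by exists n => //; rewrite xE; eexists; apply: sub_span.
move=> n; set s := in_tuple (enum_fset (fset_lt T n)).
exists _, (fun i => dir (tnth s i)), (fun i (x : borel W) => y (tnth s i) (x : W)); split => //.
- by move=> i j; rewrite odir (inj_eq (tuple_uniqP s (fset_uniq _))).
- by rewrite fspan_fset.
- by move=> i; exact: is_ell_dual.
Qed.

(** As |G| <= C, the excess of |Gt| over [C] is at most |G(p n) - Gt| at every point, so its
    integral is below an L1 distance tending to 0; no almost surely convergent subsequence is
    extracted. *)
Lemma stochastic_extension_bounded (G : V -> R[i]) (Gt : borel W -> R[i]) (C : R) :
  stochastic_extension ip iot mu 1 G Gt -> (forall X, cmod (G X) <= C) ->
  {ae mu, forall Z, cmod (Gt Z) <= C}.
Proof.
move=> [mG [mGt _] hG] GC.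
have [F [p [F1 F2 F3]]] := exhausting_tproj.
have [hp hl] := hG F p F1 F2 F3.
pose phi Z := (Num.max (cmod (Gt Z) - C) 0)%:E.
have mphi : measurable_fun [set: borel W] phi.
  apply/measurable_EFinP; apply: measurable_maxr => //.
  by apply: measurable_funB => //; exact: measurable_cmod.
have phi0 Z : (0 <= phi Z)%E by rewrite lee_fin le_max lexx orbT.
have mD n : cmeasurable (fun x => G (p n x) - Gt x).
  have [m1 m2] := (hp n).1; have [m3 m4] := mGt; split.
    rewrite (_ : cRe \o _ = (cRe \o (G \o p n)) \- (cRe \o Gt)).
      exact: measurable_funB.
    by apply/funext => x /=; rewrite ReB.
  rewrite (_ : cIm \o _ = (cIm \o (G \o p n)) \- (cIm \o Gt)).
    exact: measurable_funB.
  by apply/funext => x /=; rewrite ImB.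
have le n : (\int[mu]_Z phi Z <= cLnorm mu 1 (fun x => G (p n x) - Gt x)%R)%E.
  rewrite /cLnorm Lnorm1; apply: ge0_le_integral => //.
    by apply: measurableT_comp => //; apply/measurable_EFinP; exact: measurable_cmod.
  move=> Z _; rewrite /phi /= lee_fin ger0_norm ?cmod_ge0// ge_max cmod_ge0 andbT lerBlDl.
  have := cmodD (G (p n Z)) (- (G (p n Z) - Gt Z)); rewrite cmodN opprB addrC subrK.
  by move=> h; apply: (le_trans h); rewrite lerD2r.
have int0 : (\int[mu]_Z phi Z = 0)%E.
  apply/eqP; rewrite eq_le integral_ge0// andbT.
  rewrite -(cvg_lim _ hl)//; apply: lime_ge; first by apply/cvg_ex; exists 0%E.
  exact: nearW.
have /(ae_eq_integral_abs mu measurableT mphi) : (\int[mu]_Z `|phi Z| = 0)%E.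
  by under eq_integral do rewrite gee0_abs//.
apply: filterS => Z /(_ Logic.I) [] h; rewrite -subr_le0 -h le_max lexx//.
Qed.

End StochasticExtension.

(** * Integrals over a real parameter *)

Section ParametricIntegral.
Context (R : realType).
Local Notation leb := (@lebesgue_measure R).

(** [Rintegral] is the [fine] of a difference of two integrals that are measurable by Tonelli, so
    parameters at which the integral is not finite need no separate treatment. *)
Lemma measurable_Rintegral_param d (T : measurableType d) (g : T * measurableTypeR R -> R)
    (D : set (measurableTypeR R)) : measurable D -> measurable_fun setT g ->
  measurable_fun [set: T] (fun y => Rintegral leb D (fun s => g (y, s))).
Proof.
move=> mD mg; rewrite /Rintegral.
apply: (@measurableT_comp _ _ _ _ _ _ fine); first exact: fine_measurable.
pose G z := (g z * \1_D z.2)%:E.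
have mG : measurable_fun setT G.
  apply/measurable_EFinP; apply: measurable_funM => //.
  apply: (@measurableT_comp _ _ _ _ _ _ (\1_D : measurableTypeR R -> R) _ snd) => //.
rewrite (_ : (fun y => _) = fun y => (\int[leb]_s (fun s => G (y, s))^\+ s -
    \int[leb]_s (fun s => G (y, s))^\- s)%E); last first.
  apply/funext => y; rewrite -integralE integral_mkcond; apply: eq_integral => s _.
  rewrite patchE /G /= indicE; case: ifP => sD; first by rewrite mulr1.
  by rewrite mulr0.
apply: emeasurable_funB.
- rewrite (_ : (fun y => _) = fubini_F leb (G^\+)%E); last first.
    by apply/funext => y; apply: eq_integral => s _; rewrite !funeposE.
  by apply: measurable_fun_fubini_tonelli_F; [exact: measurable_funepos|move=> z; exact: funepos_ge0].
- rewrite (_ : (fun y => _) = fubini_F leb (G^\-)%E); last first.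
    by apply/funext => y; apply: eq_integral => s _; rewrite !funenegE.
  by apply: measurable_fun_fubini_tonelli_F; [exact: measurable_funeneg|move=> z; exact: funeneg_ge0].
Qed.

Lemma ae_sections_null d (T : measurableType d) (m : probability T R)
    (A : set (measurableTypeR R * T)) : measurable A ->
  (forall s, m [set y | A (s, y)] = 0%E) ->
  {ae m, forall y, leb [set s | A (s, y)] = 0%E}.
Proof.
move=> mA hA.
have mf : measurable_fun setT (fun z => (\1_A z)%:E : \bar R).
  by apply/measurable_EFinP; exact: measurable_indic.
have f0 z : (0 <= (\1_A z)%:E :> \bar R)%E by rewrite lee_fin.
have E := @fubini_tonelli _ _ _ _ R leb m (fun z => (\1_A z)%:E) mf f0.
have msec1 s : measurable [set y | A (s, y)].
  rewrite -[X in measurable X]setTI.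
  by apply: (@measurable_fun_pair _ _ _ T (measurableTypeR R) T (cst s) id) => //.
have msec2 y : measurable ([set s | A (s, y)] : set (measurableTypeR R)).
  rewrite -[X in measurable X]setTI.
  by apply: (@measurable_fun_pair _ _ _ (measurableTypeR R) (measurableTypeR R) T id (cst y)) => //.
have L0 : (\int[leb]_s \int[m]_y (\1_A (s, y))%:E = 0)%E.
  rewrite -[RHS](integral0 leb setT); apply: eq_integral => s _.
  rewrite (_ : (fun y => _) = fun y => (\1_[set y | A (s, y)] y)%:E); last first.
    by apply/funext => y; rewrite !indicE.
  by rewrite integral_indic// setIT; exact: hA.
rewrite L0 in E.
have mG : measurable_fun [set: T] (fun y => \int[leb]_s (\1_A (s, y))%:E)%E.
  exact: (@measurable_fun_fubini_tonelli_G _ _ (measurableTypeR R) T R leb (fun z => (\1_A z)%:E)).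
have /(ae_eq_integral_abs m measurableT mG) : (\int[m]_y `| \int[leb]_s (\1_A (s, y))%:E | = 0)%E.
  under eq_integral do rewrite gee0_abs ?integral_ge0//.
  by rewrite -E.
apply: filterS => y /(_ Logic.I) /=.
rewrite (_ : (fun s => _) = fun s => (\1_[set s | A (s, y)] s)%:E); last first.
  by apply/funext => s; rewrite !indicE.
by rewrite integral_indic// setIT.
Qed.

Lemma cauchy_schwarz2 (a b x y : R) :
  `|a * x + b * y| <= Num.sqrt (a ^+ 2 + b ^+ 2) * Num.sqrt (x ^+ 2 + y ^+ 2).
Proof.
rewrite -sqrtrM ?addr_ge0 ?sqr_ge0// -sqrtr_sqr ler_wsqrtr//.
by have := sqr_ge0 (a * y - b * x); nra.
Qed.

(** Real and imaginary parts are integrated separately, and bounding each would lose a constant.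
    Instead, with z the modulus of the integral a + ib, z^2 is the integral of a Re f + b Im f,
    hence at most z times the integral of [w] by Cauchy-Schwarz; then z is divided out. *)
Lemma cmod_cRintegral_le (D : set (measurableTypeR R)) (f : measurableTypeR R -> R[i])
    (w : measurableTypeR R -> R) :
  measurable D -> cmeasurable f -> leb.-integrable D (EFin \o w) ->
  (forall s, D s -> 0 <= w s) ->
  {ae leb, forall s, D s -> cmod (f s) <= w s} ->
  cmod (cRintegral leb D f) <= Rintegral leb D w.
Proof.
move=> mD [mr mi] iw w0 hf.
have intg (u : measurableTypeR R -> R) : measurable_fun setT u ->
    {ae leb, forall s, D s -> `|u s| <= w s} -> leb.-integrable D (EFin \o u).
  move=> mu hu; apply/integrableP; split.
    by apply/measurable_EFinP; exact: measurable_funTS.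
  have /integrableP[mw] := iw; apply: le_lt_trans.
  apply: ae_ge0_le_integral => //.
  - apply: measurableT_comp => //; apply/measurable_EFinP; exact: measurable_funTS.
  - by apply: measurableT_comp.
  apply: filterS hu => s h Ds; rewrite /= lee_fin.
  exact: le_trans (h Ds) (ler_norm _).
have ir : leb.-integrable D (EFin \o (cRe \o f)).
  by apply: intg => //; apply: filterS hf => s h Ds; exact: le_trans (Re_le_cmod _) (h Ds).
have ii : leb.-integrable D (EFin \o (cIm \o f)).
  by apply: intg => //; apply: filterS hf => s h Ds; exact: le_trans (Im_le_cmod _) (h Ds).
rewrite /cRintegral; set a := Rintegral _ _ _; set b := Rintegral _ _ _.
pose z := cmod (Complex a b).
have zE : z ^+ 2 = a ^+ 2 + b ^+ 2 by rewrite /z /= sqr_sqrtr// addr_ge0// sqr_ge0.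
have z0 : 0 <= z by exact: cmod_ge0.
have iza : leb.-integrable D (EFin \o (fun s => a * cRe (f s))).
  by have := integrableZl mD a ir; apply: eq_integrable.
have izb : leb.-integrable D (EFin \o (fun s => b * cIm (f s))).
  by have := integrableZl mD b ii; apply: eq_integrable.
have izw : leb.-integrable D (EFin \o (fun s => z * w s)).
  by have := integrableZl mD z iw; apply: eq_integrable.
have iu : leb.-integrable D (EFin \o (fun s => a * cRe (f s) + b * cIm (f s))).
  by have := integrableD mD iza izb; apply: eq_integrable.
have iau := integrable_norm iu.
have key : z ^+ 2 <= z * Rintegral leb D w.
  have -> : z ^+ 2 = Rintegral leb D (fun s => a * cRe (f s) + b * cIm (f s)).
    by rewrite RintegralD// !RintegralZl// zE !expr2.
  rewrite -RintegralZl//.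
  apply: (@le_trans _ _ (Rintegral leb D (fun s => `|a * cRe (f s) + b * cIm (f s)|))).
    by apply: le_Rintegral => // s _; exact: ler_norm.
  apply: fine_le; [exact: integrable_fin_num|exact: integrable_fin_num|].
  apply: ae_ge0_le_integral => //.
  - exact: measurable_int iau.
  - by move=> s Ds; rewrite lee_fin mulr_ge0// w0.
  - exact: measurable_int izw.
  apply: filterS hf => s h Ds; rewrite lee_fin.
  apply: le_trans (cauchy_schwarz2 _ _ _ _) _.
  have -> : Num.sqrt (cRe (f s) ^+ 2 + cIm (f s) ^+ 2) = cmod (f s) by case: (f s).
  by apply: ler_wpM2l => //; exact: h.
have [z00|z00] := eqVneq z 0.
  rewrite -/z z00; apply: fine_ge0; apply: integral_ge0 => s Ds.
  by rewrite lee_fin w0.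
by rewrite -(@ler_pM2l _ z) -?expr2// lt_neqAle eq_sym z00.
Qed.

Lemma integral_taylor_weight n (C : R) :
  Rintegral leb `[0, 1] (fun s => C * ((1 - s) ^+ n / n`!%:R)) = C / (n.+1)`!%:R.
Proof.
have iw : leb.-integrable `[0, 1] (EFin \o (fun s : R => (1 - s) ^+ n)).
  apply: continuous_compact_integrable; first exact: segment_compact.
  by apply: continuous_subspaceT => x; exact: (@continuous_onemXn R n x).
rewrite (_ : (fun s => _) = fun s => (C / n`!%:R) * (1 - s) ^+ n); last first.
  by apply/funext => s; ring.
rewrite RintegralZl// (Rintegral_onemXn n) factS natrM invfM; ring.
Qed.

End ParametricIntegral.

Section RestIntegral.
Context (R : realType) (V W : normedModType R).
Variables (ip : V -> V -> R) (iot : V -> W).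
Hypotheses (ipP : inner_product ip) (iotd : dense (range iot)).
Hypothesis dualW : forall f : {scalar W}, continuous (f : W -> R) ->
  exists a, dual_elt ip iot f a.
Hypothesis genW : @open W `<=` <<s @halfspaces R W >>.
Variable mu : R -> probability (borel W) R.
Hypothesis gmu : forall t : R, 0 < t -> gaussian_measure ip iot t (mu t).
Local Notation leb := (@lebesgue_measure R).

(** The source carries the product sigma-algebra, for which continuity is not a criterion.
    Half-spaces generate the Borel sets of [W], and on them the condition reads
    [f x0 + s * f Y <= a], measurable in the pair. *)
Lemma measurable_affine_joint (x0 : W) :
  measurable_fun [set: measurableTypeR R * borel W]
    (fun z : measurableTypeR R * borel W => (x0 + z.1 *: (z.2 : W) : borel W)).
Proof.
have mhs : @measurable _ (borel W) = <<s @halfspaces R W >>.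
  apply/seteqP; split.
    by apply: smallest_sub => //; exact: smallest_sigma_algebra.
  apply: smallest_sub; first exact: sigma_algebra_measurable.
  move=> _ [f fc [a ->]].
  have := continuous_borel_real fc measurableT (measurable_itv `]-oo, a]).
  by rewrite setTI; congr (measurable _); apply/seteqP; split => x /=; rewrite in_itv.
apply: (measurability _ mhs) => _ [_ [f fc [a ->]] <-]; rewrite setTI.
rewrite (_ : _ @^-1` _ =
   (fun z : measurableTypeR R * borel W => f x0 + z.1 * f (z.2 : W)) @^-1` `]-oo, a]%classic).
  rewrite -[X in measurable X]setTI.
  have : measurable_fun setT (fun z : measurableTypeR R * borel W => f x0 + z.1 * f (z.2 : W)).
    apply: measurable_funD => //; apply: measurable_funM; first exact: measurable_fst.
    exact: (measurableT_comp (continuous_borel_real fc) measurable_snd).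
  by apply => //; exact: measurable_itv.
by apply/seteqP; split => z /=; rewrite in_itv /= linearD linearZ.
Qed.

Variables (X : V) (Gt : borel W -> R[i]) (n : nat).
Hypothesis mGt : cmeasurable Gt.

Definition rest_integral (Y : borel W) : R[i] :=
  cRintegral leb `[0%R, 1%R] (fun s : R =>
    (((1 - s) ^+ n / n`!%:R)%:C)%C * Gt (iot X + s *: (Y : W))).

Let wt (s : R) := (1 - s) ^+ n / n`!%:R.

Let cReM (a : R) (z : R[i]) : cRe ((a%:C)%C * z) = a * cRe z.
Proof. by case: z => b c /=; rewrite mul0r subr0. Qed.
Let cImM (a : R) (z : R[i]) : cIm ((a%:C)%C * z) = a * cIm z.
Proof. by case: z => b c /=; rewrite mul0r addr0. Qed.

Let mwt : measurable_fun [set: measurableTypeR R] wt.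
Proof.
by apply: measurable_funM => //; apply: measurable_funX; exact: measurable_funB.
Qed.

Lemma cmeasurable_rest_integral : cmeasurable rest_integral.
Proof.
have m01 : measurable (`[0, 1]%classic : set (measurableTypeR R)) by exact: measurable_itv.
have mswap : measurable_fun [set: borel W * measurableTypeR R]
    (fun z : borel W * measurableTypeR R => (iot X + z.2 *: (z.1 : W) : borel W)).
  have := measurableT_comp (measurable_affine_joint (iot X))
    (measurable_swap (T1 := borel W) (T2 := measurableTypeR R)).
  exact.
have mw2 : measurable_fun [set: borel W * measurableTypeR R] (fun z : borel W * measurableTypeR R => wt z.2).
  exact: (measurableT_comp mwt measurable_snd).
pose gr (z : borel W * measurableTypeR R) := wt z.2 * (cRe \o Gt) (iot X + z.2 *: (z.1 : W)).
pose gi (z : borel W * measurableTypeR R) := wt z.2 * (cIm \o Gt) (iot X + z.2 *: (z.1 : W)).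
have mgr : measurable_fun setT gr.
  by apply: measurable_funM => //; exact: (measurableT_comp mGt.1 mswap).
have mgi : measurable_fun setT gi.
  by apply: measurable_funM => //; exact: (measurableT_comp mGt.2 mswap).
split.
  rewrite (_ : cRe \o _ = fun Y => Rintegral leb `[0, 1] (fun s => gr (Y, s))).
    exact: (@measurable_Rintegral_param R _ (borel W) gr _ m01 mgr).
  by apply/funext => Y /=; congr Rintegral; apply/funext => s /=; rewrite cReM.
rewrite (_ : cIm \o _ = fun Y => Rintegral leb `[0, 1] (fun s => gi (Y, s))).
  exact: (@measurable_Rintegral_param R _ (borel W) gi _ m01 mgi).
by apply/funext => Y /=; congr Rintegral; apply/funext => s /=; rewrite cImM.
Qed.

Variables (t C : R).
Hypotheses (t0 : 0 < t) (C0 : 0 <= C)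
  (hC : forall t', 0 < t' -> t' <= t -> {ae mu t', forall Z, cmod (Gt Z) <= C}).

Lemma ae_rest_integral_le :
  {ae mu t, forall Y, cmod (rest_integral Y) <= C / (n.+1)`!%:R}.
Proof.
pose A : set (borel W) := [set Z | C < cmod (Gt Z)].
have mA : measurable A by apply: measurable_gt_fun; exact: measurable_cmod.
(* [s = 0] is left out: there the map is constant and its law is a point mass, on which an almost
   sure bound has no hold. The point returns below as a Lebesgue-null set. *)
pose A2 : set (measurableTypeR R * borel W) :=
  [set z | (0 < z.1 <= 1) /\ A (iot X + z.1 *: (z.2 : W))].
have mA2 : measurable A2.
  rewrite (_ : A2 = (fst @^-1` `]0, 1]%classic) `&`
      ((fun z : measurableTypeR R * borel W => (iot X + z.1 *: (z.2 : W) : borel W)) @^-1` A)).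
    apply: measurableI.
      rewrite -[X in measurable X]setTI.
      have mf := @measurable_fst _ _ (measurableTypeR R) (borel W).
      exact: (mf measurableT _ (measurable_itv `]0, 1])).
    by rewrite -[X in measurable X]setTI; exact: measurable_affine_joint.
  by apply/seteqP; split => z /=; rewrite in_itv.
have hA2 s : mu t [set Y | A2 (s, Y)] = 0%E.
  have [/andP[s0 s1]|hs] := boolP (0 < s <= 1); last first.
    by rewrite (_ : [set Y | _] = set0) ?measure0//; apply/seteqP; split => // Y [] /= h; rewrite h in hs.
  have s2 : s ^+ 2 * t <= t by apply: ler_piMl; [exact: ltW|rewrite expr_le1// ltW].
  have muA : mu (s ^+ 2 * t) A = 0%E.
    have [B [mB B0 AB]] := hC (mulr_gt0 (exprn_gt0 2 s0) t0) s2.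
    apply/eqP; rewrite eq_le measure_ge0 andbT -B0; apply: le_measure; rewrite ?inE//.
    by move=> Z AZ; apply: AB => /=; apply/negP; rewrite -ltNge.
  rewrite (_ : [set Y | _] = [set Y : borel W | A (iot X + s *: (Y : W))]).
    exact: (gaussian_affine_null ipP iotd dualW genW gmu).
  by apply/seteqP; split => Y /=; [case|split => //; rewrite s0 s1].
have := ae_sections_null mA2 hA2; apply: filterS => Y hY.
have m01 : measurable (`[0, 1]%classic : set (measurableTypeR R)) by exact: measurable_itv.
have wt0 s : (`[0, 1]%classic : set R) s -> 0 <= C * wt s.
  by rewrite /= in_itv/= => /andP[_ s1]; rewrite mulr_ge0// divr_ge0// exprn_ge0// subr_ge0.
rewrite -(integral_taylor_weight n C); apply: cmod_cRintegral_le => //.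
- have mY : measurable_fun [set: measurableTypeR R]
      (fun s : measurableTypeR R => (iot X + s *: (Y : W) : borel W)).
    have mp : measurable_fun [set: measurableTypeR R] (fun s : measurableTypeR R => (s, Y)).
      exact: measurable_fun_pair.
    exact: (measurableT_comp (measurable_affine_joint (iot X)) mp).
  split.
    rewrite (_ : cRe \o _ = fun s => wt s * (cRe \o Gt) (iot X + s *: (Y : W))).
      by apply: measurable_funM => //; exact: (measurableT_comp mGt.1 mY).
    by apply/funext => s /=; rewrite cReM.
  rewrite (_ : cIm \o _ = fun s => wt s * (cIm \o Gt) (iot X + s *: (Y : W))).
    by apply: measurable_funM => //; exact: (measurableT_comp mGt.2 mY).
  by apply/funext => s /=; rewrite cImM.
- apply: continuous_compact_integrable; first exact: segment_compact.
  apply: continuous_subspaceT => s.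
  apply: cvgM; first exact: cvg_cst.
  apply: cvgM; last exact: cvg_cst.
  exact: (@beta_distribution.continuous_onemXn R n s).
have m2 : measurable ([set s | A2 (s, Y)] : set (measurableTypeR R)).
  rewrite -[X in measurable X]setTI.
  by apply: (@measurable_fun_pair _ _ _ (measurableTypeR R) (measurableTypeR R) (borel W) id (cst Y)) => //.
exists ([set s | A2 (s, Y)] `|` [set 0]); split.
- by apply: measurableU => //; exact: measurable_set1.
- apply/eqP; rewrite eq_le measure_ge0 andbT.
  apply: (@le_trans _ _ (leb [set s | A2 (s, Y)] + leb [set 0%R])%E).
    by apply: measureU2 => //; exact: measurable_set1.
  by rewrite hY lebesgue_measure_set1 adde0.
move=> s /= /not_implyP[]; rewrite in_itv/= => /andP[s0 s1] /negP; rewrite -ltNge => hs.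
have [->|sn0] := eqVneq s 0; [by right|left; split => /=].
  by rewrite s1 lt_neqAle eq_sym sn0 s0.
rewrite /A /= ltNge; apply: contraTN hs => h; rewrite -leNgt.
have w0 : 0 <= wt s by rewrite divr_ge0// exprn_ge0// subr_ge0.
rewrite ComplexField.Normc.normcM cmod_real// mulrC.
exact: ler_wpM2r.
Qed.

End RestIntegral.

(** * Taylor terms and rest of a symbol *)

Section SymbolClasses.
Context (R : realType) (H : normedModType R) (Gam : countType) (e : Gam -> H).
Variables (m : nat) (eps : Gam -> R) (F : (H * H)%type -> R[i]).
Hypothesis heps : forall j, 0 <= eps j.

Let prod_eps_ge0 (s : seq (Gam * bool)) : 0 <= \prod_(w <- s) eps w.1.
Proof. by apply: prodr_ge0. Qed.

(** The infimum is attained: where the product of the [eps] is positive the bound can be divided by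
    it, and where it vanishes the bound does not depend on [M]. *)
Lemma symbol_norm_bound : symbol_class e m eps F ->
  0 <= symbol_norm e m eps F /\ symbol_class_bound e m (symbol_norm e m eps F) eps F.
Proof.
move=> [M0 M00 hM0].
have Sn0 : [set M : R | 0 <= M /\ symbol_class_bound e m M eps F] !=set0 by exists M0.
have N0 : 0 <= symbol_norm e m eps F by apply: lb_le_inf => // M [].
split => //; have [hb hc hd] := hM0; split => // s hs.
have [d1 d2 _] := hd s hs; split => // X.
have [p0|p0] := eqVneq (\prod_(w <- s) eps w.1) 0.
  by have [_ _ /(_ X)] := hd s hs; rewrite p0 !mulr0.
have pp : 0 < \prod_(w <- s) eps w.1 by rewrite lt_neqAle eq_sym p0 prod_eps_ge0.
rewrite -ler_pdivrMr//; apply: lb_le_inf => // M [_ [_ _ h]].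
by rewrite ler_pdivrMr//; have [_ _] := h s hs; exact.
Qed.

Lemma iter_cderive_cat (s s' : seq (H * H)%type) (G : (H * H)%type -> R[i]) :
  iter_cderive (s ++ s') G = iter_cderive s (iter_cderive s' G).
Proof. by rewrite /iter_cderive foldr_cat. Qed.

Lemma iter_cderivable_cat (s s' : seq (H * H)%type) (G : (H * H)%type -> R[i]) :
  iter_cderivable (s ++ s') G -> iter_cderivable s (iter_cderive s' G).
Proof.
elim: s => [//|w s IH] /= [h1 h2]; split; first exact: IH.
by rewrite -iter_cderive_cat.
Qed.

Lemma iter_cderive_bound (M : R) (J : seq (Gam * bool)) X :
  symbol_class_bound e m M eps F -> (size J <= m)%N ->
  cmod (iter_cderive (map (wdir e) J) F X) <= M * \prod_(w <- J) eps w.1.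
Proof.
move=> [_ _ h] Jm; have [|_ _ //] := h J.
by move=> w; apply: leq_trans Jm; exact: count_size.
Qed.

(** Extensions are available for symbols of order 1, which involves one more derivative along each
    direction. A direction then occurs at most [1 + size J] times in [s ++ J], which is where
    [m >= k + 1] enters. *)
Lemma iter_cderive_symbol (M : R) (J : seq (Gam * bool)) : 0 <= M ->
  symbol_class_bound e m M eps F -> (size J < m)%N ->
  symbol_class e 1 eps (iter_cderive (map (wdir e) J) F).
Proof.
move=> M0 hM Jm; exists (M * \prod_(w <- J) eps w.1); first by rewrite mulr_ge0.
have [_ _ h] := hM.
have hJ : forall w, (count_mem w J <= m)%N.
  by move=> w; apply: leq_trans (ltnW Jm); exact: count_size.
split.
- by exists (M * \prod_(w <- J) eps w.1) => X; apply: iter_cderive_bound => //; exact: ltnW.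
- by have [] := h J hJ.
move=> s hs; have [|h1 h2 h3] := h (s ++ J).
  move=> w; rewrite count_cat; apply: leq_trans Jm.
  by rewrite -addn1 addnC leq_add// count_size.
rewrite map_cat in h1 h2 h3; split; first exact: iter_cderivable_cat.
- by rewrite iter_cderive_cat in h2.
- move=> X; have := h3 X; rewrite iter_cderive_cat big_cat /=.
  by rewrite -mulrA (mulrC (\prod_(w <- s) _)).
Qed.

End SymbolClasses.

Section Directions.
Context (R : realType) (H : normedModType R) (dot : {dot H for idfun}).
Context (Gam : countType) (e : Gam -> H).
Hypothesis he : hilbert_basis dot e.

Let dP := dot_inner_product dot.

Lemma wdir_orthonormal : orthonormal_family (ip2 dot) (wdir e).
Proof.
move=> [j b] [j' b']; rewrite /ip2 /wdir /= xpair_eqE.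
case: b b' => [] [] /=; rewrite ?(ip0l dP) ?(ip0r dP) ?addr0 ?add0r ?andbT ?andbF//;
  exact: he.1.
Qed.

Lemma wdir_dense : dense [set x | exists (A : {fset (Gam * bool)}) (c : Gam * bool -> R),
      x = \sum_(w <- A) c w *: wdir e w].
Proof.
set S := [set x | _].
have SD x y : S x -> S y -> S (x + y).
  move=> [A [c ->]] [A' [c' ->]].
  rewrite (sub_span (wdir e) c (fsubsetUl A A')) (sub_span (wdir e) c' (fsubsetUr A A')).
  rewrite -big_split /=; eexists; exists
    (fun w => (if w \in A then c w else 0) + (if w \in A' then c' w else 0)).
  by apply: eq_bigr => w _; rewrite scalerDl.
have SZ c w : S (c *: wdir e w).
  by exists [fset w]%fset, (fun=> c); rewrite big_seq_fset1.
have S0 : S 0 by exists fset0, (fun=> 0); rewrite big_seq_fset0.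
have hd := dense_setX he.2 he.2.
move=> O O0 Oo; have [x [Ox [[A [c xA]] [A' [c' xA']]]]] := hd O O0 Oo.
exists x; split => //.
have -> : x = \sum_(j <- A) c j *: wdir e (j, false) + \sum_(j <- A') c' j *: wdir e (j, true).
  case: x Ox xA xA' => x1 x2 _ /= -> ->.
  have h1 (s : seq Gam) d : \sum_(j <- s) d j *: wdir e (j, false) = (\sum_(j <- s) d j *: e j, 0).
    elim/big_rec2 : _ => [//|i u v _ ->]; rewrite /wdir /=.
    by congr (_, _) => /=; rewrite scaler0 addr0.
  have h2 (s : seq Gam) d : \sum_(j <- s) d j *: wdir e (j, true) = (0, \sum_(j <- s) d j *: e j).
    elim/big_rec2 : _ => [//|i u v _ ->]; rewrite /wdir /=.
    by congr (_, _) => /=; rewrite scaler0 addr0.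
  by rewrite h1 h2; congr (_, _) => /=; rewrite ?addr0 ?add0r.
have Ssum (s : seq Gam) d b : S (\sum_(j <- s) d j *: wdir e (j, b)).
  by elim: s => [|j s IH]; rewrite ?big_nil ?big_cons//; apply: SD.
exact: SD.
Qed.

Context (B : normedModType R) (iota : {linear H -> B}).
Hypothesis heB : forall j, exists y : {scalar B}, dual_elt dot iota y (e j).

Lemma wdir_dual w : exists y : {scalar (B * B)%type}, dual_elt (ip2 dot) (iota2 iota) y (wdir e w).
Proof.
case: w => j b; have [y [yc yE]] := heB j.
have [|z zE] := @scalar_of_fun R (B * B)%type (fun x => y (if b then x.2 else x.1)).
  by move=> c u v; case: b; rewrite /= linearP.
exists z; split.
  rewrite (_ : (z : _ -> R) = fun x => y (if b then x.2 else x.1)); last exact/funext.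
  move=> x; case: b {zE}; (apply: continuous_comp; last exact: yc); [exact: cvg_snd|exact: cvg_fst].
move=> x; rewrite zE /ip2 /wdir /iota2 /=.
by case: b {zE} => /=; rewrite yE (ip0l dP) ?add0r ?addr0.
Qed.

End Directions.

Unset Implicit Arguments.
Set Strict Implicit.
Set Printing Implicit Defensive.

Theorem proposition4p11 (R : realType) (H B : completeNormedModType R)
    (dot : {dot H for idfun}) (iota : {linear H -> B})
    (Gam : countType) (e : Gam -> H)
    (mu : R -> probability (borel (B * B)%type) R)
    (eps : Gam -> R) (k m : nat) (F : (H * H)%type -> R[i]) (h : R)
    (X : (H * H)%type)
    (ell : Gam * bool -> borel (B * B)%type -> R)
    (P : ((H * H)%type -> R[i]) -> borel (B * B)%type -> R[i])
    (hW : wiener_space dot iota)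
    (hmu : forall t : R, 0 < t -> gaussian_measure (ip2 dot) (iota2 iota) t (mu t))
    (he : hilbert_basis dot e)
    (heB : forall j, exists y : {scalar B}, dual_elt dot iota y (e j))
    (heps : forall j, 0 <= eps j)
    (hsum : summable [set: Gam] (fun j => (eps j)%:E))
    (hk : (1 <= k)%N) (hm : (k + 1 <= m)%N)
    (hF : symbol_class e m eps F)
    (hh : 0 < h)
    (hell : forall w, is_ell (ip2 dot) (iota2 iota) (mu (h / 2)) (wdir e w) (ell w))
    (hP : forall G, symbol_class e 1 eps G ->
       forall t : R, 0 < t -> t <= 2 * h -> forall q : R, 1 <= q ->
         stochastic_extension (ip2 dot) (iota2 iota) (mu t) q G (P G)) :
  (forall i : nat, (1 <= i)%N -> (i <= k - 1)%N ->
     [/\ {ae mu (h / 2), forall Y, exists l, has_csum (taylor_summand e F ell X Y (i:=i)) l},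
         in_cLp (mu (h / 2)) 1 (taylor_term e F ell i X) &
         (Nnorm (ip2 dot) (iota2 iota) (mu (h / 2)%R) i (taylor_term e F ell i X)
            <= (taylor_bound e m eps F h i)%:E)%E])
  /\
  [/\ {ae mu (h / 2), forall Y, exists l, has_csum (rest_summand e iota F ell P X Y (k:=k)) l},
      in_cLp (mu (h / 2)) 1 (taylor_rest e iota F ell P k X) &
      (Nnorm (ip2 dot) (iota2 iota) (mu (h / 2)%R) k (taylor_rest e iota F ell P k X)
         <= (taylor_bound e m eps F h k)%:E)%E].
Proof.
have ipP := ip2_inner_product dot.
have iotd := wiener2_dense hW.
have dualW := wiener2_dual hW.
have [d dd] := wiener2_dense_seq hW.
have genW := open_halfspaces dd.
have iot0 : iota2 iota 0 = 0 by rewrite /iota2 /= linear0.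
have h20 : 0 < h / 2 by rewrite divr_gt0.
have odir := wdir_orthonormal he.
have dir1 w : ip2 dot (wdir e w) (wdir e w) = 1 by rewrite odir eqxx.
have dird := wdir_dual heB.
have hS := sum_bool_le heps hsum.
have [N0 hN] := symbol_norm_bound heps hF.
set N := symbol_norm e m eps F in N0 hN.
have eps0 (w : Gam * bool) : 0 <= eps w.1 by [].
pose cf := csum_family ipP iot0 iotd dualW genW hmu h20 dir1 dird hell eps0 hS.
have mell w : measurable_fun [set: borel (B * B)%type] (ell w) by have [] := hell w.
have mprod n (J : n.-tuple (Gam * bool)) :
    measurable_fun [set: borel (B * B)%type] (fun Y => \prod_(w <- J) ell w Y).
  by apply: measurable_prod => w _.
have cReM (a : R) (z : R[i]) : cRe ((a%:C)%C * z) = a * cRe z.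
  by case: z => b c /=; rewrite mul0r subr0.
have cImM (a : R) (z : R[i]) : cIm ((a%:C)%C * z) = a * cIm z.
  by case: z => b c /=; rewrite mul0r addr0.
have mscale (u : borel (B * B)%type -> R) (z : borel (B * B)%type -> R[i]) :
    measurable_fun setT u -> cmeasurable z -> cmeasurable (fun Y => ((u Y)%:C)%C * z Y).
  move=> mu' [m1 m2]; split.
    rewrite (_ : cRe \o _ = fun Y => u Y * (cRe \o z) Y); first exact: measurable_funM.
    by apply/funext => Y /=; rewrite cReM.
  rewrite (_ : cIm \o _ = fun Y => u Y * (cIm \o z) Y); first exact: measurable_funM.
  by apply/funext => Y /=; rewrite cImM.
have cmodZ n (J : n.-tuple (Gam * bool)) Y (z : R[i]) :
    cmod (((\prod_(w <- J) ell w Y)%:C)%C * z) = \prod_(w <- J) `|ell w Y| * cmod z.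
  rewrite ComplexField.Normc.normcM; congr (_ * _).
  by rewrite /= expr0n addr0 sqrtr_sqr normr_prod.
split.
- case=> [//|i] _ ik.
  have im : (i.+1 <= m)%N.
    by apply: leq_trans ik (leq_trans (leq_subr 1 k) (leq_trans (leq_addr 1 k) hm)).
  have [] := cf i (fun J Y => taylor_summand e F ell X Y J) N N0 _ _ ((i.+1)`!%:R^-1) _.
  + move=> J; apply: mscale; first exact: mprod.
    by split; exact: measurable_cst.
  + move=> J; apply: nearW => Y; rewrite /taylor_summand cmodZ mulrC.
    apply: ler_wpM2r; first exact: prodr_ge0.
    apply: (iter_cderive_bound _ hN); rewrite size_tuple; exact: im.
  + by rewrite invr_ge0.
  move=> h1 h2 h3; split => //.
  rewrite (_ : taylor_bound e m eps F h i.+1 = (i.+1)`!%:R^-1 * N *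
    (2 * fine (\esum_(j in [set: Gam]) (eps j)%:E)) ^+ i.+1 *
    Num.max 1 (Num.sqrt (h / 2)) ^+ i.+1 *
    fine (\int[normal_prob 0%R 1%R]_v (((1 + `|v|) ^+ i.+1)%R)%:E)%E)//.
  rewrite /taylor_bound -/N; congr (_ * _).
  by rewrite -[RHS]mulrA -exprMn; congr (_ * _ ^+ _); ring.
case: k hk hm => [//|k'] _ hm.
have km : (k'.+1 < m)%N by rewrite addn1 in hm.
pose G (J : k'.+1.-tuple (Gam * bool)) := iter_cderive (map (wdir e) J) F.
have GS J : symbol_class e 1 eps (G J).
  by apply: (iter_cderive_symbol heps N0 hN); rewrite size_tuple.
have mPG J : cmeasurable (P (G J)).
  by have [_ []] := hP _ (GS J) (h / 2) h20 ltac:(lra) 1 (lexx _).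
have N0k : 0 <= N / (k'.+1)`!%:R by rewrite divr_ge0.
(* The factorial of [k] comes from integrating the weight over [s], so it belongs to the domination
   constant and the prefactor is 1. *)
have [] := cf k' (fun J Y => rest_summand e iota F ell P X Y J) (N / (k'.+1)`!%:R) N0k _ _ 1 ler01.
- move=> J; apply: mscale; first exact: mprod.
  exact: (@cmeasurable_rest_integral R (H * H)%type (B * B)%type (iota2 iota) genW X (P (G J)) k' (mPG J)).
- move=> J.
  have C0 : 0 <= N * \prod_(w <- J) eps w.1 by rewrite mulr_ge0// prodr_ge0.
  have hC t' : 0 < t' -> t' <= h / 2 -> {ae mu t', forall Z, cmod (P (G J) Z) <= N * \prod_(w <- J) eps w.1}.
    move=> t'0 t'h.
    (* Along the segment only the variances [s ^+ 2 * (h / 2)] with [s <= 1] occur, all within the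
       range up to [2 * h] where [P] gives an extension. *)
    have t2h : t' <= 2 * h by lra.
    have hPt := hP _ (GS J) t' t'0 t2h 1 (lexx _).
    apply: (stochastic_extension_bounded ipP iotd t'0 (hmu _ t'0) odir dird (wdir_dense he) hPt).
    by move=> Z; apply: (iter_cderive_bound _ hN); rewrite size_tuple ltnW.
  have := ae_rest_integral_le ipP iotd dualW genW hmu X k' (mPG J) h20 C0 hC.
  apply: filterS => Y hY; rewrite /rest_summand cmodZ mulrC.
  apply: ler_wpM2r; first exact: prodr_ge0.
  by rewrite mulrAC; exact: hY.
have -> : (fun Z => ((1%:C)%C * csum (fun J : k'.+1.-tuple (Gam * bool) =>
      rest_summand e iota F ell P X Z J))%R) =
    taylor_rest e iota F ell P k'.+1 X.
  by apply/funext => Z; rewrite mul1r.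
move=> h1 h2 h3; split => //.
rewrite (_ : taylor_bound e m eps F h k'.+1 = 1 * (N / (k'.+1)`!%:R) *
  (2 * fine (\esum_(j in [set: Gam]) (eps j)%:E)) ^+ k'.+1 *
  Num.max 1 (Num.sqrt (h / 2)) ^+ k'.+1 *
  fine (\int[normal_prob 0%R 1%R]_v (((1 + `|v|) ^+ k'.+1)%R)%:E)%E)//.
rewrite /taylor_bound -/N mul1r (mulrC N); congr (_ * _).
by rewrite -[RHS]mulrA -exprMn; congr (_ * _ ^+ _); ring.
Qed.
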